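(* Let $A$ be a separable $C^*$-algebra and $J$ a real antisymmetric $n\times n$ matrix. Assume that the map $O:CB^\infty(\mathbb{R}^{2n},A)\to\mathcal{HS}$, $O(a)=a(x,D)$, is a bijection. Let $T\in\mathcal{B}^*(\overline{S^A(\mathbb{R}^n)})$ be Heisenberg-smooth and such that $[T,R_g]=0$ for every $g\in S^A(\mathbb{R}^n)$. Then there exists $F\in CB^\infty(\mathbb{R}^n,A)$ such that $T=L_F$.
   Context: $CB^\infty(\mathbb{R}^m,A)$ is the space of $C^\infty$ functions $\mathbb{R}^m\to A$ bounded together with all partial derivatives. $S^A(\mathbb{R}^n)$ is the space of $C^\infty$ functions $f:\mathbb{R}^n\to A$ with $\sup_x\|x^\alpha\partial^\beta f(x)\|<\infty$ for all $\alpha,\beta$, with $A$-valued inner product $\langle f,g\rangle=\int f(x)^*g(x)\,dx$ and norm $\|f\|_2=\|\langle f,f\rangle\|^{1/2}$; $\overline{S^A(\mathbb{R}^n)}$ is its completion. $\mathcal{B}^*(\overline{S^A(\mathbb{R}^n)})$ is the set of continuous linear operators $T$ on it having an adjoint, i.e. a continuous linear $T^*$ with $\langle Tu,v\rangle=\langle u,T^*v\rangle$. Write $\bar d y=(2\pi)^{-n/2}dy$, $\hat u(\xi)=\int e^{-iy\cdot\xi}u(y)\,\bar d y$. For $a\in CB^\infty(\mathbb{R}^{2n},A)$, $a(x,D)$ is the continuous extension to $\overline{S^A(\mathbb{R}^n)}$ of $a(x,D)u(x)=\int e^{ix\cdot\xi}a(x,\xi)\hat u(\xi)\,\bar d\xi$,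 $u\in S^A(\mathbb{R}^n)$. For $z,\zeta\in\mathbb{R}^n$, $E_{z,\zeta}u(x)=e^{i\zeta\cdot x}u(x-z)$; $T$ is Heisenberg-smooth if $(z,\zeta)\mapsto E_{z,\zeta}^{-1}TE_{z,\zeta}$ is $C^\infty$ on $\mathbb{R}^{2n}$ (operator norm). $\mathcal{HS}$ is the set of Heisenberg-smooth elements of $\mathcal{B}^*(\overline{S^A(\mathbb{R}^n)})$; one always has $a(x,D)\in\mathcal{HS}$. The deformed product is $F\times_J G(x)=\int F(x+Ju)G(x+v)e^{iu\cdot v}\,\bar d u\,\bar d v$ (oscillatory integral). $L_F$ ($F\in CB^\infty(\mathbb{R}^n,A)$) and $R_g$ ($g\in S^A(\mathbb{R}^n)$) are the continuous extensions to $\overline{S^A(\mathbb{R}^n)}$ of $L_Fu=F\times_J u$ and $R_gu=u\times_J g$; equivalently, for $u\in S^A(\mathbb{R}^n)$, $L_Fu(x)=\int e^{ix\cdot\xi}F(x-J\xi)\hat u(\xi)\,\bar d\xi$ and $R_gu(x)=\int e^{ix\cdot\xi}\hat u(\xi)g(x+J\xi)\,\bar d\xi$. *)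

(* Defs.v *)
From HB Require Import structures.
From mathcomp Require Import all_boot all_order all_algebra.
From mathcomp Require Import all_classical all_reals all_analysis.
From mathcomp.real_closed Require Export complex.

Set Implicit Arguments.
Unset Strict Implicit.
Unset Printing Implicit Defensive.

Import Order.TTheory GRing.Theory Num.Theory.
Import numFieldNormedType.Exports.

Local Open Scope classical_set_scope.
Local Open Scope ring_scope.

(* Complex Banach spaces.  The library differentiates and integrates functions
   of real variables with values in normed modules over R, so a complex Banach
   space is a real one together with a scalar multiplication by R[i] that
   extends the real one and for which the norm is absolutely homogeneous. *)
HB.mixin Record isComplexBanach (R : realType) V & CompleteNormedModule R V := {
  cscale : R[i] -> V -> V;
  cscaleA : forall (z w : R[i]) (x : V),
    cscale z (cscale w x) = cscale (z * w) x;
  cscaleDl : forall (z w : R[i]) (x : V),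
    cscale (z + w) x = cscale z x + cscale w x;
  cscaleDr : forall (z : R[i]) (x y : V),
    cscale z (x + y) = cscale z x + cscale z y;
  cscale_real : forall (r : R) (x : V), cscale (r%:C)%C x = r *: x;
  norm_cscale : forall (z : R[i]) (x : V),
    `|cscale z x| = ComplexField.Normc.normc z * `|x|
}.

#[short(type="complexBanachType")]
HB.structure Definition ComplexBanach (R : realType) :=
  {V of CompleteNormedModule R V & isComplexBanach R V}.

(* C*-algebras; no unit is required. *)
HB.mixin Record isCstarAlgebra (R : realType) A & ComplexBanach R A := {
  amul : A -> A -> A;
  star : A -> A;
  amulA : forall x y z : A, amul x (amul y z) = amul (amul x y) z;
  amulDl : forall x y z : A, amul (x + y) z = amul x z + amul y z;
  amulDr : forall x y z : A, amul x (y + z) = amul x y + amul x z;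
  amulZl : forall (c : R[i]) (x y : A),
    amul (cscale c x) y = cscale c (amul x y);
  amulZr : forall (c : R[i]) (x y : A),
    amul x (cscale c y) = cscale c (amul x y);
  starK : forall x : A, star (star x) = x;
  starD : forall x y : A, star (x + y) = star x + star y;
  starZ : forall (c : R[i]) (x : A), star (cscale c x) = cscale (c^*)%C (star x);
  starM : forall x y : A, star (amul x y) = amul (star y) (star x);
  norm_amul : forall x y : A, `|amul x y| <= `|x| * `|y|;
  norm_star_amul : forall x : A, `|amul (star x) x| = `|x| ^+ 2
}.

#[short(type="cstarAlgType")]
HB.structure Definition CstarAlgebra (R : realType) :=
  {A of ComplexBanach R A & isCstarAlgebra R A}.

Definition separable_space (T : topologicalType) :=
  exists D : set T, countable D /\ dense D.

(* Points of R^m are column vectors, so that the matrix J acts by J *m u;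
   a point (x, xi) of R^2n is col_mx x xi : 'cV_(n + n). *)

Definition dot (R : realType) (m : nat) (x y : 'cV[R]_m) : R :=
  \sum_(i < m) x i 0 * y i 0.

Definition expi (R : realType) (t : R) : R[i] := (cos t +i* sin t)%C.

Section Smoothness.
Context {R : realType} {m : nat} {V : normedModType R}.
Implicit Type f : 'cV[R]_m -> V.

(* Iterated partial derivative, in the directions listed in s. *)
Definition pderiv (s : seq 'I_m) f : 'cV[R]_m -> V :=
  foldr (fun i g x => 'D_(delta_mx i 0) g x) f s.

Definition smooth f : Prop := forall s : seq 'I_m,
  continuous (pderiv s f) /\
  forall (i : 'I_m) (x : 'cV[R]_m), derivable (pderiv s f) x (delta_mx i 0).

Definition CBinf : set ('cV[R]_m -> V) := [set f | smooth f /\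
  forall s : seq 'I_m, exists M : R, forall x, `|pderiv s f x| <= M].

Definition monomial (alpha : 'I_m -> nat) (x : 'cV[R]_m) : R :=
  \prod_(i < m) x i 0 ^+ alpha i.

Definition schwartz : set ('cV[R]_m -> V) := [set f | smooth f /\
  forall (alpha : 'I_m -> nat) (s : seq 'I_m), exists M : R, forall x,
    `|monomial alpha x *: pderiv s f x| <= M].

End Smoothness.

Section Integration.
Context {R : realType} {V : normedModType R}.

(* Weak (Gelfand-Pettis) integral over the real line: v is the integral of f
   when phi v is the Lebesgue integral of phi \o f for every continuous linear
   functional phi. *)
Definition is_integral (f : R -> V) (v : V) : Prop :=
  forall phi : {linear V -> R^o}, continuous phi ->
    (@lebesgue_measure R).-integrable setT (EFin \o (phi \o f)) /\
    phi v = Rintegral (@lebesgue_measure R) setT (phi \o f).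

Definition integral1 (f : R -> V) : V := xget 0 [set v | is_integral f v].

(* Integral over R^m, as an iterated integral; it is only used for continuous
   rapidly decreasing integrands. *)
Fixpoint integral_Rn (m : nat) : ('cV[R]_m -> V) -> V :=
  match m with
  | 0 => fun f => f 0
  | p.+1 => fun f =>
      integral1 (fun t => integral_Rn (fun x : 'cV[R]_p => f (col_mx t%:M x)))
  end.

(* Integration against (2 pi)^(-m/2) dx. *)
Definition integral_bar (m : nat) (f : 'cV[R]_m -> V) : V :=
  Num.sqrt (2 * pi) ^- m *: integral_Rn f.

End Integration.

Definition fourier (R : realType) (A : complexBanachType R) (n : nat)
    (u : 'cV[R]_n -> A) (xi : 'cV[R]_n) : A :=
  integral_bar (fun y => cscale (expi (- dot y xi)) (u y)).

Section DeformedProduct.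
Context {R : realType} {A : cstarAlgType R} {n : nat}.

(* v is the oscillatory integral of exp(i u.v) b(u, v) against
   (2 pi)^(-n) du dv: whatever the regularizing Schwartz function chi with
   chi(0) = 1, it is the limit as e -> 0+ of the absolutely convergent integrals
   obtained by inserting the factor chi(e u, e v). *)
Definition is_osc_integral (b : 'cV[R]_n -> 'cV[R]_n -> A) (a : A) : Prop :=
  forall chi : 'cV[R]_(n + n) -> R^o, schwartz chi -> chi 0 = 1 ->
    integral_bar (fun u => integral_bar (fun v =>
      cscale (expi (dot u v)) (chi (col_mx (e *: u) (e *: v)) *: b u v)))
    @[e --> 0^'+] --> a.

Definition osc_integral (b : 'cV[R]_n -> 'cV[R]_n -> A) : A :=
  xget 0 [set a | is_osc_integral b a].

Definition deformed_prod (J : 'M[R]_n) (F G : 'cV[R]_n -> A) (x : 'cV[R]_n) : A :=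
  osc_integral (fun u v => amul (F (x + J *m u)) (G (x + v))).

End DeformedProduct.

(* A completion of S^A(R^n) for the norm ||<f, f>||^(1/2), with the continuous
   extension ip of the A-valued inner product.  It is unique up to a unique
   isometric isomorphism.  The values of emb outside S^A(R^n) are irrelevant. *)
Record completion (R : realType) (A : cstarAlgType R) (n : nat) := Completion {
  completion_space :> complexBanachType R;
  emb : ('cV[R]_n -> A) -> completion_space;
  ip : completion_space -> completion_space -> A;
  emb_linear : forall (c : R[i]) (f g : 'cV[R]_n -> A),
    schwartz f -> schwartz g ->
    emb (fun x => cscale c (f x) + g x) = cscale c (emb f) + emb g;
  dense_emb : dense (emb @` schwartz);
  ip_emb : forall f g : 'cV[R]_n -> A, schwartz f -> schwartz g ->
    ip (emb f) (emb g) = integral_Rn (fun x => amul (star (f x)) (g x));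
  ip_continuous : continuous
    (fun p : completion_space * completion_space => ip p.1 p.2);
  norm_ip : forall h : completion_space, `|h| = Num.sqrt `|ip h h|
}.

Section Operators.
Context {R : realType} {A : cstarAlgType R} {n : nat} (H : completion A n).

Definition continuous_linear (T : H -> H) : Prop :=
  (forall (c : R[i]) (h k : H), T (cscale c h + k) = cscale c (T h) + T k) /\
  continuous T.

(* The set B^* of operators having an adjoint. *)
Definition adjointable : set (H -> H) := [set T | continuous_linear T /\
  exists Tstar : H -> H, continuous_linear Tstar /\
    forall u v : H, ip (T u) v = ip u (Tstar v)].

Definition extends (P : ('cV[R]_n -> A) -> ('cV[R]_n -> A)) (T : H -> H) : Prop :=
  continuous_linear T /\
  forall u : 'cV[R]_n -> A, schwartz u -> schwartz (P u) /\ T (emb H u) = emb H (P u).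

(* The continuous extension of P, unique by density when it exists. *)
Definition extension (P : ('cV[R]_n -> A) -> ('cV[R]_n -> A)) : H -> H :=
  xget (fun=> 0) [set T | extends P T].

(* a(x, D) *)
Definition pseudodiff (a : 'cV[R]_(n + n) -> A) : H -> H :=
  extension (fun u x => integral_bar (fun xi =>
    cscale (expi (dot x xi)) (amul (a (col_mx x xi)) (fourier u xi)))).

(* L_F and R_g *)
Definition left_mul (J : 'M[R]_n) (F : 'cV[R]_n -> A) : H -> H :=
  extension (fun u => deformed_prod J F u).

Definition right_mul (J : 'M[R]_n) (g : 'cV[R]_n -> A) : H -> H :=
  extension (fun u => deformed_prod J u g).

(* E_{z, zeta} at the point w = (z, zeta), and its inverse. *)
Definition heisenberg (w : 'cV[R]_(n + n)) : H -> H :=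
  extension (fun u x => cscale (expi (dot (dsubmx w) x)) (u (x - usubmx w))).

Definition heisenberg_inv (w : 'cV[R]_(n + n)) : H -> H :=
  extension (fun u x =>
    cscale (expi (- dot (dsubmx w) (x + usubmx w))) (u (x + usubmx w))).

(* Phi is C^oo for the operator norm: D s is its iterated partial derivative in
   the directions s, and the inequalities say that the operator norm of the
   difference of the two sides is at most eps. *)
Definition op_smooth (m : nat) (Phi : 'cV[R]_m -> H -> H) : Prop :=
  exists D : seq 'I_m -> 'cV[R]_m -> H -> H,
    D [::] = Phi /\
    forall (s : seq 'I_m) (w : 'cV[R]_m) (eps : R), 0 < eps ->
      (\forall w' \near w, forall h : H,
        `|D s w' h - D s w h| <= eps * `|h|) /\
      (forall i : 'I_m, \forall t \near (0 : R)^', forall h : H,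
        `|t^-1 *: (D s (w + t *: delta_mx i 0) h - D s w h) - D (i :: s) w h|
          <= eps * `|h|).

Definition heisenberg_smooth (T : H -> H) : Prop :=
  op_smooth (fun w : 'cV[R]_(n + n) => heisenberg_inv w \o T \o heisenberg w).

Definition HS : set (H -> H) :=
  [set T | adjointable T /\ heisenberg_smooth T].

Definition commutator (S T : H -> H) (h : H) : H := S (T h) - T (S h).

End Operators.

Arguments HS {R A n} H _.
Arguments pseudodiff {R A n} H a _.
Arguments left_mul {R A n} H J F _.
Arguments right_mul {R A n} H J g _.

(* Main.v *)
From HB Require Import structures.
From mathcomp Require Import all_boot all_order all_algebra.
From mathcomp Require Import all_classical all_reals all_analysis.
From mathcomp Require Import measurable_realfun zify ring lra.
Require Import Defs.

Set Implicit Arguments.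
Unset Strict Implicit.
Unset Printing Implicit Defensive.

Import Order.TTheory GRing.Theory Num.Theory.
Import numFieldNormedType.Exports.

Local Open Scope classical_set_scope.
Local Open Scope ring_scope.

(* Put M_z u(x) = exp(i z.x) u(x - J z).  Then u x_J g = int M_z u(x) g^(z) dz (normalized), so
   that R_g is the average of the operators u |-> (M_z u) g^(z), each of which is bounded on the
   completion because M_z is isometric there.  Choosing for g^ the element c of A times a Gaussian
   centered at z, the relation T R_g = R_g T becomes T ((M_z u) c) = (M_z T u) c as the width
   tends to 0; as c is arbitrary, T commutes with M_z.

   By surjectivity T = a(x, D), and M_z^-1 a(x, D) M_z = a'(x, D) with
   a'(x, xi) = a(x + J z, xi + z).  Injectivity gives a' = a, thus a(x, xi) = F(x - J xi) with
   F(x) = a(x, 0), and a(x, D) = L_F. *)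

(** The operators [M_z] act on functions, so moving [T] past them requires that [T] preserve
    Schwartz functions. Hence surjectivity of [O] is used at once: the commutant is studied for an
    operator with [extends P T], and [a(x, D)] is one.

    [A] may have no unit, so shrinking Gaussians give only [T ((M_z u) c) = (M_z T u) c]. Right
    A-linearity of [a(x, D)] turns this into [(M_z d) c = 0] for all [c], where
    [d = a'(x, D) u - a(x, D) u]; taking for [c] the adjoint of [<M_z d, M_z d>] gives [M_z d = 0],
    and [M_z] is isometric.

    The formula for [R_g] as an average is an identity in the completion, where integrals are weak
    and take the value 0 when they fail to exist. Existence must therefore be proved: integrands are
    kept continuous and bounded by products of [1/(1 + t^2)], and their integrals are limits of
    Riemann sums. Norm estimates are obtained by testing with functionals, whence Hahn-Banach. For
    the oscillatory product the required bounds come from integration by parts. *)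

(** * Norming functionals by Zorn's lemma *)

Section HahnBanach.
Context {R : realType} {V : normedModType R}.

(** A partial functional is encoded by its graph, so that extension is inclusion and chains are
    bounded by their unions. Single-valuedness need not be carried along: linearity and the bound by
    the norm imply it. *)
Let lin (M : set (V * R)) := forall p q (a : R), M p -> M q ->
  M (a *: p.1 + q.1, a * p.2 + q.2).
Let bounded_by_norm (M : set (V * R)) := forall p, M p -> p.2 <= `|p.1|.

(** One-dimensional step of Hahn-Banach: by homogeneity only the coefficients 1 and -1 of [v0]
    matter, and they bound the value [c] at [v0] from above and from below. The triangle inequality
    makes the two families of bounds compatible, so the supremum of the lower ones works. *)
Let extend_graph (M : set (V * R)) (v0 : V) : lin M -> bounded_by_norm M ->
  M !=set0 -> exists B : set (V * R),
    [/\ lin B, bounded_by_norm B, M `<=` B & exists c, B (v0, c)].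
Proof.
move=> linM bM [p0 Mp0].
have M0 : M (0, 0).
  have := linM p0 p0 (-1) Mp0 Mp0.
  by rewrite scaleN1r addNr mulN1r addNr.
have scaleM p k : M p -> M (k *: p.1, k * p.2).
  by move=> Mp; have := linM p _ k Mp M0; rewrite /= !addr0.
have key p q : M p -> M q -> p.2 - `|p.1 - v0| <= `|q.1 + v0| - q.2.
  move=> Mp Mq; have := bM _ (linM p q 1 Mp Mq).
  rewrite /= scale1r mul1r => h.
  have : `|p.1 + q.1| <= `|p.1 - v0| + `|q.1 + v0|.
    by rewrite (_ : p.1 + q.1 = (p.1 - v0) + (q.1 + v0)) ?ler_normD// addrCA subrK addrC.
  lra.
pose E := [set p.2 - `|p.1 - v0| | p in M].
have hE : has_sup E.
  split; first by exists (p0.2 - `|p0.1 - v0|), p0.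
  by exists (`|p0.1 + v0| - p0.2) => _ [p Mp <-]; exact: key.
pose c := sup E.
have c1 p : M p -> p.2 - `|p.1 - v0| <= c.
  by move=> Mp; apply: sup_upper_bound => //; exists p.
have c2 q : M q -> c <= `|q.1 + v0| - q.2.
  move=> Mq; apply: ge_sup; first by case: hE.
  by move=> _ [p Mp <-]; exact: key.
exists [set q | exists p a, M p /\ q = (p.1 + a *: v0, p.2 + a * c)]; split.
- move=> _ _ k [p [a [Mp ->]]] [q [b [Mq ->]]] /=.
  exists (k *: p.1 + q.1, k * p.2 + q.2), (k * a + b); split; first exact: linM.
  congr (_, _).
    by rewrite scalerDr scalerDl scalerA addrACA.
  by rewrite mulrDr mulrDl mulrA addrACA.
- move=> _ [p [a [Mp ->]]] /=.
  have [a0|a0|->] := ltgtP a 0; last by rewrite scale0r mul0r !addr0; exact: bM.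
  + have := c1 _ (scaleM p (- a)^-1 Mp); rewrite /= lerBlDr => h.
    have Na0 : 0 < - a by rewrite oppr_gt0.
    have -> : p.1 + a *: v0 = (- a) *: ((- a)^-1 *: p.1 - v0).
      by rewrite scalerBr scalerA divff ?gt_eqF// scale1r scaleNr opprK.
    rewrite normrZ gtr0_norm// -(ler_pM2l (_ : 0 < (- a)^-1)) ?invr_gt0//.
    rewrite mulrA mulVf ?gt_eqF// mul1r mulrDr.
    have -> : (- a)^-1 * (a * c) = - c by field; rewrite lt_eqF.
    lra.
  + have := c2 _ (scaleM p a^-1 Mp); rewrite /= => h.
    have -> : p.1 + a *: v0 = a *: (a^-1 *: p.1 + v0).
      by rewrite scalerDr scalerA divff ?gt_eqF// scale1r.
    rewrite normrZ gtr0_norm// -(ler_pM2l (_ : 0 < a^-1)) ?invr_gt0//.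
    rewrite mulrA mulVf ?gt_eqF// mul1r mulrDr [_ * (a * c)]mulrA.
    by rewrite mulVf ?gt_eqF// mul1r; lra.
- by move=> p Mp; exists p, 0; split=> //; rewrite scale0r mul0r !addr0; case: p {Mp}.
- by exists c, (0, 0), 1; split=> //=; rewrite scale1r mul1r !add0r.
Qed.

Lemma norming_functional (y : V) : exists phi : {linear V -> R^o},
  (forall z, `|phi z| <= `|z|) /\ phi y = `|y|.
Proof.
pose L : set (V * R) := [set (a *: y, a * `|y|) | a in [set: R]].
(* Adjoining [L] inside [P] makes the union of the empty chain satisfy [P], and prescribes the value
   at [y] in every extension. *)
pose P (G : set (V * R)) := lin (G `|` L) /\ bounded_by_norm (G `|` L).
have linL : lin L.
  move=> _ _ k [a _ <-] [b _ <-]; exists (k * a + b) => //=.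
  congr (_, _); first by rewrite scalerDl scalerA.
  by rewrite mulrDl mulrA.
have bL : bounded_by_norm L.
  by move=> _ [a _ <-] /=; rewrite normrZ ler_wpM2r// ler_norm.
have [|G [[linG bG] maxG]] := @Zorn_bigcup _ P.
  move=> F FP Ftot; split.
    move=> p q k Fp Fq.
    have [X [FX sX]] : exists X, (F X \/ X = set0) /\ (X `|` L) p /\ (X `|` L) q.
      case: Fp => [[X FX Xp]|Lp]; case: Fq => [[Y FY Yq]|Lq].
      - have [XY|YX] := Ftot _ _ FX FY.
          by exists Y; split; [left|split; left => //; exact: XY].
        by exists X; split; [left|split; left => //; exact: YX].
      - by exists X; split; [left|split; [left|right]].
      - by exists Y; split; [left|split; [right|left]].
      - by exists set0; split; [right|split; right].
    case: FX sX => [FX|->]; last first.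
      by rewrite set0U => -[Lp Lq]; right; exact: linL.
    move=> [Xp Xq]; have [+ _] := FP _ FX.
    by move=> /(_ _ _ k Xp Xq) [?|?]; [left; exists X|right].
  by move=> p [[X FX Xp]|Lp]; [have [_] := FP _ FX; apply; left|exact: bL].
set M := G `|` L in linG bG.
have My : M (y, `|y|) by right; exists 1 => //; rewrite scale1r mul1r.
have total v : exists c, M (v, c).
  have [|B [linB bB MB [c Bc]]] := extend_graph v linG bG; first by exists (y, `|y|).
  exists c.
  have BL : B `|` L = B.
    by apply/seteqP; split=> [p [//|Lp]|p Bp]; [apply: MB; right|left].
  apply: contrapT => nMc; apply: (maxG B); last by rewrite /P BL.
  split; first by move=> p Gp; apply: MB; left.
  by move=> BG; apply: nMc; left; exact: BG.
have uniq v r s : M (v, r) -> M (v, s) -> r = s.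
  move=> Mr Ms; have := bG _ (linG _ _ (-1) Mr Ms).
  have := bG _ (linG _ _ (-1) Ms Mr).
  by rewrite /= scaleN1r addNr normr0; lra.
pose f v := sval (cid (total v)).
have fM v : M (v, f v) by exact: (svalP (cid (total v))).
have flin : linear (f : V -> R^o).
  by move=> a u v; apply: (uniq (a *: u + v)); [exact: fM|exact: (linG (u, f u) (v, f v))].
pose phi : {linear V -> R^o} := HB.pack_for {linear V -> R^o} (f : V -> R^o)
  (GRing.isLinear.Build R V R^o *:%R f flin).
exists phi; split.
  move=> z; rewrite ler_norml; apply/andP; split.
    rewrite lerNl -linearN -(normrN z); exact: (bG _ (fM (- z))).
  exact: (bG _ (fM z)).
by apply: (uniq y) => //; exact: fM.
Qed.

End HahnBanach.

(** * Weak integrals on the real line *)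

Lemma oneDsqr_gt0 (R : realType) (t : R) : 0 < oneDsqr t.
Proof. exact: lt_le_trans (oneDsqr_ge1 t). Qed.

Lemma oneDsqr_ge0 (R : realType) (t : R) : 0 <= oneDsqr t.
Proof. exact/ltW/oneDsqr_gt0. Qed.

(** The function [1/(1 + t^2)] is the universal dominating function below; products of it over the
    coordinates serve in several variables. *)
Lemma integrable_oneDsqrV (R : realType) :
  (@lebesgue_measure R).-integrable setT (EFin \o (fun t => (oneDsqr t)^-1)).
Proof.
have mf : measurable_fun setT (fun t : R => (oneDsqr t)^-1).
  by apply: continuous_measurable_fun; exact: continuous_oneDsqrV.
apply/integrableP; split; first exact/measurable_EFinP.
have h x : 0 <= (oneDsqr x)^-1 :> R by rewrite invr_ge0 oneDsqr_ge0.
under eq_integral do rewrite /= ger0_norm//.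
rewrite ge0_symfun_integralT//=.
- rewrite (_ : [set x | _] = `[0, +oo[%classic); last first.
    by apply/seteqP; split => x/=; rewrite in_itv/= andbT.
  by rewrite integral0y_oneDsqr -EFinM ltry.
- exact: continuous_oneDsqrV.
- by move=> x /=; rewrite /oneDsqr sqrrN.
Qed.

Lemma integrable_dominated (R : realType) (f : R -> R) (C : R) :
  measurable_fun setT f -> (forall t, `|f t| <= C * (oneDsqr t)^-1) ->
  (@lebesgue_measure R).-integrable setT (EFin \o f).
Proof.
move=> mf fC.
apply: (@le_integrable _ (measurableTypeR R) R lebesgue_measure setT measurableT (EFin \o f) (EFin \o (fun t => C * (oneDsqr t)^-1))) => //.
- by apply/measurable_EFinP; exact: mf.
- by move=> x _ /=; rewrite lee_fin (le_trans (fC x))// ler_norm.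
- exact: (integrableZl measurableT C (integrable_oneDsqrV R)).
Qed.

Lemma cvg_norm_le (R : realType) (V : normedModType R) (T : Type) (F : set_system T)
    {FF : ProperFilter F} (u : T -> V) (l : V) (C : R) :
  u x @[x --> F] --> l -> (\forall x \near F, `|u x| <= C) -> `|l| <= C.
Proof.
move=> ul uC; have h : `|u x| @[x --> F] --> `|l| by apply: cvg_norm.
rewrite -(cvg_lim _ h)//.
by apply: limr_le => //; exact: cvgP h.
Qed.

Lemma Rintegral_dominated_cvg (R : realType) (f_ : nat -> R -> R) (f : R -> R) (C : R) :
  (forall k, measurable_fun setT (f_ k)) ->
  (forall k t, `|f_ k t| <= C * (oneDsqr t)^-1) ->
  (forall t, f_ k t @[k --> \oo] --> f t) ->
  \int[@lebesgue_measure R]_t f_ k t @[k --> \oo] --> \int[@lebesgue_measure R]_t f t.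
Proof.
move=> mf fC ff.
have mlim : measurable_fun setT f.
  by apply: (measurable_fun_cvg mf) => t _; exact: ff.
have fC' t : `|f t| <= C * (oneDsqr t)^-1.
  by apply: cvg_norm_le (ff t) _; apply: nearW => k; exact: fC.
rewrite /Rintegral.
apply: fine_cvg.
rewrite fineK; last first.
  apply: integrable_fin_num => //; exact: integrable_dominated fC'.
have [] // := @dominated_convergence _ _ _ (@lebesgue_measure R) setT measurableT
  (fun k t => (f_ k t)%:E) (fun t => (f t)%:E) (fun t => (C * (oneDsqr t)^-1)%:E).
- by move=> k; apply/measurable_EFinP; exact: mf.
- by apply/measurable_EFinP; exact: mlim.
- by apply: aeW => t _; apply: cvg_EFin; [exact: nearW|exact: ff].
- apply: (@integrable_dominated _ _ `|C|).
    apply: measurable_funM => //.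
    by apply: continuous_measurable_fun; exact: continuous_oneDsqrV.
  by move=> t; rewrite normrM ler_wpM2l// ger0_norm// invr_ge0 oneDsqr_ge0.
- by apply: aeW => t k _; rewrite lee_fin; exact: fC.
Qed.
Lemma continuous_linear_bound (R : realType) (V W : normedModType R)
    (phi : {linear V -> W}) : continuous phi ->
  exists2 K : R, 0 <= K & forall z, `|phi z| <= K * `|z|.
Proof.
move=> cphi; have /linear_boundedP[r [_ h]] := continuous_linear_bounded 0 (cphi 0).
exists (`|r| + 1); first by rewrite addr_ge0.
by apply: h; rewrite (le_lt_trans (ler_norm r))// ltrDl.
Qed.

Lemma bounded_linear_cont (R : realType) (V W : normedModType R)
    (phi : {linear V -> W}) (K : R) :
  (forall z, `|phi z| <= K * `|z|) -> continuous phi.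
Proof.
move=> phiK; apply: bounded_linear_continuous; apply/linear_boundedP.
near=> r => x; rewrite (le_trans (phiK x))// ler_wpM2r//.
Unshelve. all: by end_near. Qed.

(** The norm is attained on a functional of norm at most 1. This turns estimates for real integrals
    into estimates for weak ones. *)
Lemma functional_norm_le (R : realType) (V : normedModType R) (v : V) (C : R) :
  (forall phi : {linear V -> R^o}, continuous phi -> (forall z, `|phi z| <= `|z|) ->
    `|phi v| <= C) -> `|v| <= C.
Proof.
have [phi [phi1 phiv]] := norming_functional v.
move=> /(_ phi); rewrite phiv normr_id; apply=> //.
by apply: (@bounded_linear_cont _ _ _ _ 1) => z; rewrite mul1r.
Qed.

Lemma functional_ext (R : realType) (V : normedModType R) (u v : V) :
  (forall phi : {linear V -> R^o}, continuous phi -> phi u = phi v) -> u = v.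
Proof.
move=> h; apply/eqP; rewrite -subr_eq0 -normr_le0; apply: functional_norm_le.
by move=> phi cphi _; rewrite linearB h// subrr normr0.
Qed.

Lemma is_integral_unique (R : realType) (V : normedModType R) (f : R -> V) (u v : V) :
  is_integral f u -> is_integral f v -> u = v.
Proof.
by move=> fu fv; apply: functional_ext => phi cphi; rewrite (fu _ cphi).2 (fv _ cphi).2.
Qed.

Lemma integral1E (R : realType) (V : normedModType R) (f : R -> V) (v : V) :
  is_integral f v -> integral1 f = v.
Proof.
by move=> fv; apply: (@is_integral_unique _ _ f) => //; exact: (xgetPex _ (ex_intro _ v fv)).
Qed.

(** Keeping only [N] cells makes the integral a finite Riemann sum, which is meaningful in [V]
    itself. The formula by [Num.floor] gives pointwise values, the sum of indicators in [stepf_sum]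
    gives measurability and integrals. *)
Definition stepf (R : realType) (V : lmodType R) (f : R -> V) (h : R) (m : int) (N : nat)
    (t : R) : V :=
  let z := Num.floor (t / h) in
  if (m <= z) && (z < m + N%:Z) then f (z%:~R * h) else 0.

Definition grid_itv (R : realType) (h : R) (z : int) : set R :=
  `[z%:~R * h, (z + 1)%:~R * h[%classic.

Lemma grid_itvE (R : realType) (h : R) (z : int) (t : R) : 0 < h ->
  \1_(grid_itv h z) t = (Num.floor (t / h) == z)%:R :> R.
Proof.
move=> h0; rewrite indicE; congr (_%:R); rewrite floor_eq ler_pdivlMr// ltr_pdivrMr//.
by rewrite mem_setE in_itv.
Qed.

Lemma stepf_sum (R : realType) (V : lmodType R) (f : R -> V) (h : R) (m : int) (N : nat)
    (t : R) : 0 < h ->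
  stepf f h m N t =
  \sum_(i < N) \1_(grid_itv h (m + i%:Z)) t *: f ((m + i%:Z)%:~R * h).
Proof.
move=> h0; elim: N => [|N IH].
  rewrite big_ord0 /stepf addr0; case: ifP => // /andP[a b].
  by have := le_lt_trans a b; rewrite ltxx.
rewrite big_ord_recr/= -IH grid_itvE// /stepf; set z := Num.floor _.
have [->|zm] := eqVneq z (m + N%:Z).
  rewrite scale1r ltxx andbF add0r.
  by have -> : (m <= m + N%:Z) && (m + N%:Z < m + N.+1%:Z) = true by lia.
rewrite scale0r addr0.
by have -> : (z < m + N.+1%:Z) = (z < m + N%:Z) by lia.
Qed.
Lemma integral_stepf (R : realType) (F : R -> R^o) (h : R) (m : int) (N : nat) : 0 < h ->
  (@lebesgue_measure R).-integrable setT (EFin \o stepf F h m N) /\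
  \int[@lebesgue_measure R]_t stepf F h m N t =
    \sum_(i < N) h * F ((m + i%:Z)%:~R * h).
Proof.
move=> h0.
have iT z c : (@lebesgue_measure R).-integrable setT
    (EFin \o (fun t => \1_(grid_itv h z) t * c)).
  have := integrableZr measurableT c (@integrable_indic_itv R (z%:~R * h) ((z + 1)%:~R * h) true true).
  by apply: eq_integrable => // t _.
have eT z c : \int[@lebesgue_measure R]_t (\1_(grid_itv h z) t * c) = h * c.
  have i1 := @integrable_indic_itv R (z%:~R * h) ((z + 1)%:~R * h) true true.
  rewrite (RintegralZr c measurableT i1); congr (_ * _).
  rewrite /Rintegral integral_indic//.
  rewrite setIT; apply: eq_trans; first exact: (congr1 fine (lebesgue_measure_itv
    (Interval (BLeft (z%:~R * h)) (BLeft ((z + 1)%:~R * h))))).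
  by rewrite /= lte_fin ltr_pM2r// ltr_int ltzD1 lexx -EFinB/= -mulrBl intrD addrAC subrr add0r mul1r.
have -> : stepf F h m N =
    (fun t => \sum_(i < N) \1_(grid_itv h (m + i%:Z)) t *: F ((m + i%:Z)%:~R * h)).
  by apply/funext => t; rewrite stepf_sum.
elim: N => [|N [IH1 IH2]].
  split; last by under eq_Rintegral do rewrite big_ord0; rewrite Rintegral_cst// mul0r big_ord0.
  by apply: eq_integrable (integrable0 _ _) => // t _ /=; rewrite big_ord0.
split.
  apply: eq_integrable (integrableD _ IH1 (iT (m + N%:Z) (F ((m + N%:Z)%:~R * h)))) => // t _ /=.
  by rewrite big_ord_recr.
rewrite big_ord_recr/= -IH2 -(eT (m + N%:Z)) -RintegralD//.
by apply: eq_Rintegral => t _; rewrite big_ord_recr.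
Qed.

Lemma measurable_stepf (R : realType) d (X : measurableType d) (F : R -> X -> R)
    (h : R) (m : int) (N : nat) : 0 < h ->
  (forall s, measurable_fun setT (F s)) ->
  measurable_fun setT (fun p : measurableTypeR R * X => stepf (fun s => F s p.2 : R^o) h m N p.1).
Proof.
move=> h0 mF; under eq_fun do rewrite stepf_sum//.
apply: measurable_sum => i; apply: measurable_funM.
  have mI : measurable_fun setT (\1_(grid_itv h (m + i%:Z)) : measurableTypeR R -> R).
    by apply: measurable_indic; exact: measurable_itv.
  exact: (measurableT_comp mI measurable_fst).
exact: (measurableT_comp (mF _) measurable_snd).
Qed.

Section StepApproximation.
Context {R : realType} {V : normedModType R}.

(** Cells of width [1/(k+1)], numbered from [-(k+1)^2] on and [2(k+1)^2] many, cover [[-(k+1),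
    k+1[]: the grid is refined and the line exhausted at the same time. *)
Definition steps (f : R -> V) (k : nat) : R -> V :=
  stepf f k.+1%:R^-1 (- (k.+1 ^ 2)%N%:Z) (2 * k.+1 ^ 2).

Lemma stepsE (f : R -> V) (k : nat) (t : R) : exists2 s, `|s - t| <= k.+1%:R^-1 &
  steps f k t = f s \/ k%:R < `|t| /\ steps f k t = 0.
Proof.
rewrite /steps /stepf; set h := _^-1; set z := Num.floor _.
have h0 : 0 < h by rewrite invr_gt0.
exists (z%:~R * h).
  have /andP[] := floor_itv (t / h).
  rewrite ler_pdivlMr// ltr_pdivrMr// intrD mulrDl mul1r -/z => a b.
  by rewrite ler_norml; lra.
case: ifP => zk; [by left|right]; split=> //.
rewrite ltNge; apply/negP => tk; move/negP: zk; apply.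
have := floor_itv (t / h); rewrite -/z => /andP[a b].
have := tk; rewrite ler_norml => /andP[t1 t2].
have k0 : 0 <= k%:R :> R by [].
have hE : t / h = t * (k%:R + 1) by rewrite /h invrK -natr1.
have kE : ((k.+1 ^ 2)%N%:Z)%:~R = (k%:R + 1) * (k%:R + 1) :> R.
  by rewrite -[_%:~R]/((k.+1 ^ 2)%N%:R) natrX -natr1 expr2.
apply/andP; split.
  rewrite /z floor_ge_int hE intrN kE.
  have : 0 <= (t + k%:R) * (k%:R + 1) by apply: mulr_ge0; lra.
  lra.
rewrite -(ltr_int R); apply: le_lt_trans a _; rewrite hE.
rewrite (_ : - _ + _ = (k.+1 ^ 2)%N%:Z); last by lia.
rewrite kE.
have : 0 <= (k%:R - t) * (k%:R + 1) by apply: mulr_ge0; lra.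
lra.
Qed.

Lemma steps_cvg (f : R -> V) (t : R) : {for t, continuous f} ->
  steps f k t @[k --> \oo] --> f t.
Proof.
move=> /cvgrPdist_le cf; apply/cvgrPdist_le => e e0.
have /nbhs_ballP[d d0 df] := cf _ e0.
near=> k; have [s st [->|[kt _]]] := stepsE f k t.
  apply: df; rewrite /ball/= distrC (le_lt_trans st)//; near: k.
  exact: near_infty_natSinv_lt (PosNum d0).
exfalso; move: kt; rewrite ltNge => /negP; apply; near: k.
exact: nbhs_infty_ger.
Unshelve. all: by end_near. Qed.

(** The constant comes from [t^2 <= 2 s^2 + 2 (t - s)^2 <= 2 s^2 + 2]. *)
Lemma oneDsqr_near (s t : R) : `|s - t| <= 1 -> (oneDsqr s)^-1 <= 3 * (oneDsqr t)^-1.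
Proof.
move=> st; rewrite ler_pdivlMr ?oneDsqr_gt0// mulrC ler_pdivrMr ?oneDsqr_gt0//.
have : (t - s) ^+ 2 <= 1 by rewrite -(real_normK (num_real _)) distrC expr_le1.
by rewrite /oneDsqr; nra.
Qed.

Lemma steps_dominated (f : R -> V) (C : R) k t : 
  (forall t, `|f t| <= C * (oneDsqr t)^-1) -> `|steps f k t| <= 3 * C * (oneDsqr t)^-1.
Proof.
move=> fC; have C0 : 0 <= C.
  have := le_trans (normr_ge0 _) (fC 0).
  by rewrite pmulr_lge0// invr_gt0 oneDsqr_gt0.
have [s st [->|[kt ->]]] := stepsE f k t; last first.
  by rewrite normr0 !mulr_ge0// invr_ge0 oneDsqr_ge0.
rewrite (le_trans (fC s))// [3 * C]mulrC -mulrA ler_wpM2l// oneDsqr_near//.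
by rewrite (le_trans st)// invf_le1// ler1n.
Qed.

End StepApproximation.

Lemma steps_linear (R : realType) (V W : normedModType R) (phi : {linear V -> W})
  (f : R -> V) k t : phi (steps f k t) = steps (phi \o f) k t.
Proof. by rewrite /steps /stepf; case: ifP => // _; rewrite linear0. Qed.

Lemma measurable_norm_continuous (R : realType) (V : normedModType R) (f : R -> V) :
  continuous f -> measurable_fun setT (fun t => `|f t|).
Proof.
by move=> cf; apply: continuous_measurable_fun => t; apply: cvg_norm; exact: cf.
Qed.

(** Measurability is argued on real functions only: the distance is a sampled real function of two
    variables restricted to the diagonal. Subtracting and adding back the norm of [f t] gives the
    right value outside the window, where [stepf] is 0. *)
Lemma measurable_steps_dist (R : realType) (V : normedModType R) (f : R -> V) k :
  continuous f -> measurable_fun setT (fun t => `|steps f k t - f t|).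
Proof.
move=> cf.
have -> : (fun t => `|steps f k t - f t|) =
    (fun t => steps (fun s => `|f s - f t| - `|f t| : R^o) k t + `|f t|).
  apply/funext => t; rewrite /steps /stepf; case: ifP => _; first by rewrite subrK.
  by rewrite sub0r normrN add0r.
apply: measurable_funD; last exact: measurable_norm_continuous.
have h0 : 0 < k.+1%:R^-1 :> R by [].
have m2 := @measurable_stepf R _ (measurableTypeR R) (fun s t => `|f s - f t| - `|f t|) _
  (- (k.+1 ^ 2)%N%:Z) (2 * k.+1 ^ 2) h0.
have mid : measurable_fun setT (@idfun (measurableTypeR R)) by exact: measurable_id.
apply: (measurableT_comp (m2 _) (measurable_fun_pair mid mid)) => s.
apply: measurable_funB; last exact: measurable_norm_continuous.
apply: measurable_norm_continuous => t; apply: cvgB; [exact: cvg_cst|exact: cf].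
Qed.

(** The Riemann sums [S k] satisfy [phi (S k) = \int phi (steps f k)], so testing with functionals
    bounds the distance of [S k] and [S l] by [e k + e l]. Scalar dominated convergence gives
    [e k --> 0], hence the sums are Cauchy, and their limit has the defining property of the
    integral. *)
Lemma is_integral_dominated (R : realType) (V : completeNormedModType R) (f : R -> V)
    (C : R) : continuous f -> (forall t, `|f t| <= C * (oneDsqr t)^-1) ->
  is_integral f (integral1 f).
Proof.
move=> cf fC.
pose mu := @lebesgue_measure R.
pose h k : R := k.+1%:R^-1.
pose S k := \sum_(i < 2 * k.+1 ^ 2) h k *: f ((- (k.+1 ^ 2)%N%:Z + i%:Z)%:~R * h k).
pose e k := \int[mu]_t `|steps f k t - f t|.
have h0 k : 0 < h k by rewrite invr_gt0.
have phiS (phi : {linear V -> R^o}) k :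
    mu.-integrable setT (EFin \o steps (phi \o f) k) /\
    phi (S k) = \int[mu]_t steps (phi \o f) k t.
  have [i1 i2] := integral_stepf (phi \o f) (- (k.+1 ^ 2)%N%:Z) (2 * k.+1 ^ 2) (h0 k).
  split; [exact: i1|rewrite /steps i2 linear_sum; apply: eq_bigr => i _].
  by rewrite linearZ.
have dC k t : `|steps f k t - f t| <= (3 * C + C) * (oneDsqr t)^-1.
  rewrite mulrDl (le_trans (ler_normB _ _))// lerD//; exact: steps_dominated.
have ie k : mu.-integrable setT (EFin \o (fun t => `|steps f k t - f t|)).
  apply: integrable_dominated (measurable_steps_dist k cf) _.
  by move=> t; rewrite normr_id; exact: dC.
have e0 : e k @[k --> \oo] --> 0.
  have -> : 0 = \int[mu]_(t in setT) (0 : R).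
    by rewrite Rintegral_cst// mul0r.
  apply: (@Rintegral_dominated_cvg _ _ _ (3 * C + C)).
  - by move=> k; exact: measurable_steps_dist.
  - by move=> k t; rewrite normr_id.
  - move=> t; have : (steps f k t - f t) @[k --> \oo] --> f t - f t.
      by apply: cvgB; [exact: steps_cvg (cf t)|exact: cvg_cst].
    by rewrite subrr => /cvg_norm; rewrite normr0.
have iphi (phi : {linear V -> R^o}) : continuous phi ->
    mu.-integrable setT (EFin \o (phi \o f)).
  move=> cphi; have [K K0 phiK] := continuous_linear_bound cphi.
  apply: (@integrable_dominated _ _ (K * C)).
    by apply: continuous_measurable_fun => t; apply: continuous_comp; [exact: cf|exact: cphi].
  by move=> t /=; rewrite (le_trans (phiK _))// -mulrA ler_wpM2l.
have key (phi : {linear V -> R^o}) (K : R) k : 0 <= K -> (forall z, `|phi z| <= K * `|z|) ->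
    `|phi (S k) - \int[mu]_t (phi (f t))| <= K * e k.
  move=> K0 phiK; have [i1 ->] := phiS phi k.
  have i2 := iphi _ (bounded_linear_cont phiK).
  rewrite -(RintegralB measurableT i1 i2).
  apply: (le_trans (le_normr_Rintegral measurableT (integrableB measurableT i1 i2))).
  rewrite -(RintegralZl K measurableT (ie k)); apply: le_Rintegral => //.
  - have := integrable_norm (integrableB measurableT i1 i2). 
    by apply: eq_integrable.
  - exact: (integrableZl measurableT K (ie k)).
  - by move=> t _; rewrite -steps_linear -linearB.
have SS k l : `|S k - S l| <= e k + e l.
  apply: functional_norm_le => phi _ phi1.
  have phi1' z : `|phi z| <= 1 * `|z| by rewrite mul1r.
  have := key phi 1 k ler01 phi1'; have := key phi 1 l ler01 phi1'.
  rewrite !mul1r linearB !ler_norml => /andP[a1 a2] /andP[b1 b2].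
  by apply/andP; split; lra.
have cS : cvg (S k @[k --> \oo]).
  apply/cauchy_cvgP/cauchyP => d d0; 
  have : \forall k \near \oo, `|0 - e k| < d / 2.
    by move/cvgrPdist_lt : e0; apply; rewrite divr_gt0.
  move=> [N _ hN]; exists (S N); exists N => // k /= Nk.
  rewrite -ball_normE/= (le_lt_trans (SS _ _))//.
  have := hN _ (leqnn N); have := hN _ Nk; rewrite /= !sub0r !normrN.
  by move=> /ltr_normlW + /ltr_normlW; lra.
suff : is_integral f (lim (S k @[k --> \oo])) by move=> fv; rewrite (integral1E fv).
move=> phi cphi; split; first exact: iphi.
have [K K0 phiK] := continuous_linear_bound cphi.
have c1 : phi (S k) @[k --> \oo] --> phi (lim (S k @[k --> \oo])).
  by apply: continuous_cvg => //; exact: cphi.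
apply: (cvg_unique _ c1) => //.
apply/cvgrPdist_le => d d0; move/cvgrPdist_lt : e0 => /(_ (d / (K + 1))).
rewrite divr_gt0 ?ltr_wpDl// => /(_ isT); apply: filterS => k.
rewrite sub0r normrN => /ltr_normlW ek; rewrite distrC (le_trans (key _ _ _ K0 phiK))//.
have K1 : 0 < K + 1 by rewrite ltr_wpDl.
move: ek; rewrite ltr_pdivlMr// => ek.
have : 0 <= e k by apply: Rintegral_ge0.
by nra.
Qed.
(** * Iterated integrals *)

(** Dominated convergence is a statement on sequences, so continuity in a parameter is reduced to
    them. The imposed rate [1/(k+1)] keeps every term in the unit ball around [x], where local
    domination is assumed. *)
Lemma sequential_continuity (R : realType) (T : pseudoMetricType R) (V : normedModType R)
    (f : T -> V) (x : T) :
  (forall u : nat -> T, (forall k, ball x k.+1%:R^-1 (u k)) -> f (u k) @[k --> \oo] --> f x) ->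
  {for x, continuous f}.
Proof.
move=> h; apply/cvgrPdist_lt => e e0; apply: contrapT => nfe.
have [u uP] : exists u : nat -> T,
    forall k, ball x k.+1%:R^-1 (u k) /\ ~ (`|f x - f (u k)| < e).
  suff E k : exists y, ball x k.+1%:R^-1 y /\ ~ (`|f x - f y| < e).
    by exists (fun k => sval (cid (E k))) => k; exact: (svalP (cid (E k))).
  apply: contrapT => /forallNP hk; apply: nfe.
  apply/nbhs_ballP; exists k.+1%:R^-1 => /=; first by rewrite invr_gt0.
  by move=> y xy; apply: contrapT => nfy; apply: (hk y).
have /cvgrPdist_lt/(_ e e0) [N _ /(_ _ (leqnn N))] := h u (fun k => (uP k).1).
exact: (uP N).2.
Qed.

(** The restriction [u k <= 1] is what later bounds the derivatives of the dilated cut-offs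
    [chi (e u, e v)] uniformly in the scale. *)
Lemma sequential_at_right (R : realType) (V : normedModType R) (f : R -> V) (l : V) :
  (forall u : nat -> R, (forall k, 0 < u k <= 1) -> u k @[k --> \oo] --> (0 : R) ->
    f (u k) @[k --> \oo] --> l) -> f e @[e --> 0^'+] --> l.
Proof.
move=> h; apply/cvgrPdist_lt => e e0; apply: contrapT => nfe.
have [u uP] : exists u : nat -> R,
    forall k, 0 < u k < k.+1%:R^-1 /\ ~ (`|l - f (u k)| < e).
  suff E k : exists y, 0 < y < k.+1%:R^-1 /\ ~ (`|l - f y| < e).
    by exists (fun k => sval (cid (E k))) => k; exact: (svalP (cid (E k))).
  apply: contrapT => /forallNP hk; apply: nfe.
  near=> y; apply: contrapT => nfy; apply: (hk y); split=> //; apply/andP; split.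
    by near: y; exact: nbhs_right_gt.
  by near: y; apply: nbhs_right_lt; rewrite invr_gt0.
have u01 k : 0 < u k <= 1.
  have [/andP[-> uk] _] := uP k.
  by rewrite (le_trans (ltW uk))// invf_le1// ler1n.
have u0 : u k @[k --> \oo] --> (0 : R).
  apply/cvgrPdist_lt => d d0; near=> k; rewrite sub0r normrN.
  have [/andP[uk uk'] _] := uP k; rewrite gtr0_norm// (lt_trans uk')//.
  near: k; exact: near_infty_natSinv_lt (PosNum d0).
have /cvgrPdist_lt/(_ e e0) [N _ /(_ _ (leqnn N))] := h u u01 u0.
exact: (uP N).2.
Unshelve. all: by end_near. Qed.

Lemma ball_seq_cvg (R : realType) (T : pseudoMetricType R) (x : T) (u : nat -> T) :
  (forall k, ball x k.+1%:R^-1 (u k)) -> u k @[k --> \oo] --> x.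
Proof.
move=> xu; apply/cvg_ballP => e e0; have := near_infty_natSinv_lt (PosNum e0).
by apply: filterS => k /ltW ke; exact: le_ball (xu k).
Qed.

Section ColumnLimits.
Context {R : realType} {T : Type} {F : set_system T} {FF : Filter F}.

Lemma cvg_cV m (u : T -> 'cV[R]_m) (l : 'cV[R]_m) :
  (forall i, u x i 0 @[x --> F] --> l i 0) -> u x @[x --> F] --> l.
Proof.
move=> ul; apply/cvg_ballP => e e0.
have : \forall x \near F, forall i : 'I_m, `|l i 0 - u x i 0| < e.
  apply: filter_forall => i; have /cvgrPdist_lt := ul i; exact.
apply: filterS => x h; split=> // i j; rewrite ord1 -ball_normE /=; exact: h.
Qed.

Lemma cvg_coord m (u : T -> 'cV[R]_m) (l : 'cV[R]_m) i :
  u x @[x --> F] --> l -> u x i 0 @[x --> F] --> l i 0.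
Proof.
move=> ul; exact: (cvg_comp _ _ ul (@coord_continuous R m 1 i 0 l)).
Qed.

Lemma cvg_col_mx m p (u : T -> 'cV[R]_m) (v : T -> 'cV[R]_p)
    (a : 'cV[R]_m) (b : 'cV[R]_p) :
  u x @[x --> F] --> a -> v x @[x --> F] --> b ->
  col_mx (u x) (v x) @[x --> F] --> col_mx a b.
Proof.
move=> ua vb; apply: cvg_cV => i; case: (split_ordP i) => j ->.
  by under eq_fun do rewrite col_mxEu; rewrite col_mxEu; exact: cvg_coord.
by under eq_fun do rewrite col_mxEd; rewrite col_mxEd; exact: cvg_coord.
Qed.

Lemma cvg_scalar_mx (u : T -> R) (l : R) :
  u x @[x --> F] --> l -> ((u x)%:M : 'cV[R]_1) @[x --> F] --> (l%:M : 'cV[R]_1).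
Proof.
move=> ul; apply: cvg_cV => i; rewrite ord1.
by under eq_fun do rewrite mxE eqxx mulr1n; rewrite mxE eqxx mulr1n.
Qed.

Lemma cvg_bigsum (V : normedModType R) (I : Type) (r : seq I) (f : T -> I -> V) (l : I -> V) :
  (forall i, f x i @[x --> F] --> l i) ->
  \sum_(i <- r) f x i @[x --> F] --> \sum_(i <- r) l i.
Proof.
move=> fl; elim: r => [|i r IH].
  by under eq_fun do rewrite big_nil; rewrite big_nil; exact: cvg_cst.
by under eq_fun do rewrite big_cons; rewrite big_cons; apply: cvgD.
Qed.

Lemma cvg_mulmxr m p (M : 'M[R]_(p, m)) (u : T -> 'cV[R]_m) (l : 'cV[R]_m) :
  u x @[x --> F] --> l -> M *m u x @[x --> F] --> M *m l.
Proof.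
move=> ul; apply: cvg_cV => i; under eq_fun do rewrite mxE; rewrite mxE.
apply: (@cvg_bigsum R^o) => j; apply: cvgM; [exact: cvg_cst|exact: cvg_coord].
Qed.

Lemma cvg_dot m (u v : T -> 'cV[R]_m) (a b : 'cV[R]_m) :
  u x @[x --> F] --> a -> v x @[x --> F] --> b -> dot (u x) (v x) @[x --> F] --> dot a b.
Proof.
by move=> ua vb; apply: (@cvg_bigsum R^o) => j; apply: cvgM; exact: cvg_coord.
Qed.

End ColumnLimits.

(** A product over coordinates rather than a power of the norm: it factors along [col_mx], as
    iterated integrals require. *)
Definition weight (R : realType) m (x : 'cV[R]_m) : R := \prod_(i < m) (oneDsqr (x i 0))^-1.

Lemma weight_gt0 (R : realType) m (x : 'cV[R]_m) : 0 < weight x.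
Proof. by apply: prodr_gt0 => i _; rewrite invr_gt0 oneDsqr_gt0. Qed.

Lemma weight_ge0 (R : realType) m (x : 'cV[R]_m) : 0 <= weight x.
Proof. exact/ltW/weight_gt0. Qed.

Lemma weight_le1 (R : realType) m (x : 'cV[R]_m) : weight x <= 1.
Proof.
by apply: prodr_ile1 => i _; rewrite invr_ge0 oneDsqr_ge0 oneDsqrV_le1.
Qed.

Lemma weight_col_mx (R : realType) m p (x : 'cV[R]_m) (y : 'cV[R]_p) :
  weight (col_mx x y) = weight x * weight y.
Proof.
rewrite /weight big_split_ord/=; congr (_ * _).
  by apply: eq_bigr => i _; rewrite col_mxEu.
by apply: eq_bigr => i _; rewrite col_mxEd.
Qed.

Lemma weight_scalar_mx (R : realType) (t : R) : weight (t%:M : 'cV[R]_1) = (oneDsqr t)^-1.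
Proof. by rewrite /weight big_ord1 mxE mulr1n. Qed.

Lemma weightN (R : realType) m (x : 'cV[R]_m) : weight (- x) = weight x.
Proof. by apply: eq_bigr => i _; rewrite mxE /oneDsqr sqrrN. Qed.
Section ContinuousColumns.
Context {R : realType} {T : topologicalType}.

Lemma continuous_mx_cst m (a : 'cV[R]_m) : continuous (fun _ : T => a).
Proof. by move=> x; exact: cvg_cst. Qed.

Lemma continuous_coord m (u : T -> 'cV[R]_m) i : continuous u ->
  continuous (fun x => u x i 0).
Proof. by move=> cu x; apply: (@cvg_coord _ _ (nbhs x)); exact: cu. Qed.

Lemma continuous_col_mx m p (u : T -> 'cV[R]_m) (v : T -> 'cV[R]_p) :
  continuous u -> continuous v -> continuous (fun x => col_mx (u x) (v x)).
Proof.
by move=> cu cv x; apply: (@cvg_col_mx _ _ (nbhs x)); [exact: cu|exact: cv].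
Qed.

Lemma continuous_scalar_mx (u : T -> R) :
  continuous u -> continuous (fun x => (u x)%:M : 'cV[R]_1).
Proof. by move=> cu x; apply: (@cvg_scalar_mx _ _ (nbhs x)); exact: cu. Qed.

Lemma continuous_mulmxr m p (M : 'M[R]_(p, m)) (u : T -> 'cV[R]_m) :
  continuous u -> continuous (fun x => M *m u x).
Proof. by move=> cu x; apply: (@cvg_mulmxr _ _ (nbhs x)); exact: cu. Qed.

Lemma continuous_dot m (u v : T -> 'cV[R]_m) :
  continuous u -> continuous v -> continuous (fun x => dot (u x) (v x)).
Proof. by move=> cu cv x; apply: (@cvg_dot _ _ (nbhs x)); [exact: cu|exact: cv]. Qed.

Lemma continuous_add (V : normedModType R) (u v : T -> V) :
  continuous u -> continuous v -> continuous (fun x => u x + v x).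
Proof. by move=> cu cv x; apply: cvgD; [exact: cu|exact: cv]. Qed.

Lemma continuous_sub (V : normedModType R) (u v : T -> V) :
  continuous u -> continuous v -> continuous (fun x => u x - v x).
Proof. by move=> cu cv x; apply: cvgB; [exact: cu|exact: cv]. Qed.

Lemma continuous_scale (V : normedModType R) (u : T -> R) (v : T -> V) :
  continuous u -> continuous v -> continuous (fun x => u x *: v x).
Proof. by move=> cu cv x; apply: cvgZ; [exact: cu|exact: cv]. Qed.

Lemma continuous_comp_fun (U W : topologicalType) (g : U -> W) (u : T -> U) :
  continuous g -> continuous u -> continuous (fun x => g (u x)).
Proof. by move=> cg cu x; apply: continuous_comp; [exact: cu|exact: cg]. Qed.

End ContinuousColumns.

Definition wint (R : realType) : R := \int[@lebesgue_measure R]_t (oneDsqr t)^-1.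

Section Integral1.
Context {R : realType} {V : completeNormedModType R}.
Implicit Types f g : R -> V.
Notation mu := (@lebesgue_measure R).

(** Functionals of norm at most 1 bound the distance of the two weak integrals by the real integral
    of the norm of [f_ k - f], to which scalar dominated convergence applies. *)
Lemma integral1_dct (f_ : nat -> R -> V) f (C : R) :
  (forall k, continuous (f_ k)) -> (forall k t, `|f_ k t| <= C * (oneDsqr t)^-1) ->
  continuous f -> (forall t, f_ k t @[k --> \oo] --> f t) ->
  integral1 (f_ k) @[k --> \oo] --> integral1 f.
Proof.
move=> cf fC cg fg.
have gC t : `|f t| <= C * (oneDsqr t)^-1.
  by apply: cvg_norm_le (fg t) _; apply: nearW => k; exact: fC.
have cd k : continuous (fun t => f_ k t - f t).
  by move=> t; apply: cvgB; [exact: cf|exact: cg].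
pose e k := \int[mu]_t `|f_ k t - f t|.
have dC k t : `|f_ k t - f t| <= (C + C) * (oneDsqr t)^-1.
  by rewrite mulrDl (le_trans (ler_normB _ _))// lerD.
have e0 : e k @[k --> \oo] --> 0.
  have -> : 0 = \int[mu]_(t in setT) (0 : R) by rewrite Rintegral_cst// mul0r.
  apply: (@Rintegral_dominated_cvg _ _ _ (C + C)).
  - by move=> k; exact: measurable_norm_continuous.
  - by move=> k t; rewrite normr_id.
  - move=> t; have : (f_ k t - f t) @[k --> \oo] --> f t - f t.
      by apply: cvgB => //; exact: cvg_cst.
    by rewrite subrr => /cvg_norm; rewrite normr0.
have le_e k : `|integral1 (f_ k) - integral1 f| <= e k.
  apply: functional_norm_le => phi cphi phi1.
  have [i1 e1] := is_integral_dominated (cf k) (fC k) cphi.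
  have [i2 e2] := is_integral_dominated cg gC cphi.
  rewrite linearB e1 e2 -(RintegralB measurableT i1 i2).
  apply: (le_trans (le_normr_Rintegral measurableT (integrableB measurableT i1 i2))).
  apply: le_Rintegral => //.
  - have := integrable_norm (integrableB measurableT i1 i2).
    by apply: eq_integrable.
  - apply: integrable_dominated (measurable_norm_continuous (cd k)) _.
    by move=> t; rewrite normr_id; exact: dC.
  - by move=> t _; rewrite /= -linearB.
apply/cvgrPdist_le => d d0; move/cvgrPdist_le : e0 => /(_ _ d0); apply: filterS => k.
rewrite sub0r normrN distrC => ek; rewrite (le_trans (le_e k))//.
by rewrite (le_trans (ler_norm _)).
Qed.

Lemma integral1_norm_le f (C : R) : continuous f ->
  (forall t, `|f t| <= C * (oneDsqr t)^-1) -> `|integral1 f| <= C * wint R.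
Proof.
move=> cf fC; apply: functional_norm_le => phi cphi phi1.
have [i1 ->] := is_integral_dominated cf fC cphi.
rewrite (le_trans (le_normr_Rintegral measurableT i1))//.
rewrite -(RintegralZl C measurableT (integrable_oneDsqrV R)).
apply: le_Rintegral => //.
- by apply: eq_integrable (integrable_norm i1).
- exact: (integrableZl measurableT C (integrable_oneDsqrV R)).
- by move=> t _; rewrite (le_trans (phi1 _)).
Qed.

Lemma integral1D f g C D : continuous f -> (forall t, `|f t| <= C * (oneDsqr t)^-1) ->
  continuous g -> (forall t, `|g t| <= D * (oneDsqr t)^-1) ->
  integral1 (fun t => f t + g t) = integral1 f + integral1 g.
Proof.
move=> cf fC cg gD; apply: integral1E => phi cphi.
have [i1 e1] := is_integral_dominated cf fC cphi.
have [i2 e2] := is_integral_dominated cg gD cphi.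
split.
  by apply: eq_integrable (integrableD measurableT i1 i2) => // t _; rewrite /= linearD.
rewrite linearD e1 e2 -(RintegralD measurableT i1 i2).
by apply: eq_Rintegral => t _; rewrite /= linearD.
Qed.

Lemma integral1_linear (W : completeNormedModType R) (L : {linear V -> W}) f C :
  continuous L -> continuous f -> (forall t, `|f t| <= C * (oneDsqr t)^-1) ->
  integral1 (L \o f) = L (integral1 f).
Proof.
move=> cL cf fC; apply: integral1E => phi cphi.
have cphiL : continuous (phi \o L).
  by move=> v; apply: continuous_comp; [exact: cL|exact: cphi].
exact: (is_integral_dominated cf fC (phi := phi \o L : {linear V -> R^o}) cphiL).
Qed.

End Integral1.

Definition dominated (R : realType) (m : nat) (V : normedModType R) (C : R)
    (f : 'cV[R]_m -> V) : Prop :=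
  continuous f /\ forall x, `|f x| <= C * weight x.

Section Dominated.
Context {R : realType} {V : completeNormedModType R}.

Lemma dominated_slice (m : nat) (C : R) (f : 'cV[R]_m.+1 -> V) (t : R) :
  dominated C f ->
  dominated (C * (oneDsqr t)^-1) (fun x : 'cV[R]_m => f (col_mx t%:M x)).
Proof.
move=> [cf fC]; split.
  apply: (continuous_comp_fun cf); apply: (continuous_col_mx (m := 1)).
    exact: continuous_mx_cst.
  by move=> x; exact: cvg_id.
by move=> x; rewrite (le_trans (fC _))// (weight_col_mx (m := 1)) weight_scalar_mx mulrA.
Qed.

Lemma continuous_slice (m : nat) (f : 'cV[R]_m.+1 -> V) (x : 'cV[R]_m) :
  continuous f -> continuous (fun t : R => f (col_mx t%:M x)).
Proof.
move=> cf; apply: (continuous_comp_fun cf); apply: (continuous_col_mx (m := 1)).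
  by apply: continuous_scalar_mx => x'; exact: cvg_id.
exact: continuous_mx_cst.
Qed.

Lemma dominated_ge0 (m : nat) (C : R) (f : 'cV[R]_m -> V) : dominated C f -> 0 <= C.
Proof.
by move=> [_ /(_ 0)] /(le_trans (normr_ge0 _)); rewrite pmulr_lge0// weight_gt0.
Qed.

(** The two claims need a joint induction: to integrate over the first coordinate one needs a
    continuous and dominated slice integral; continuity is dominated convergence one dimension
    lower, and domination is the norm bound there. *)
Let integral_Rn_bundle (m : nat) :
  (forall (f : 'cV[R]_m -> V) C, dominated C f -> `|integral_Rn f| <= C * wint R ^+ m) /\
  (forall (f_ : nat -> 'cV[R]_m -> V) f C, (forall k, dominated C (f_ k)) -> continuous f ->
    (forall x, f_ k x @[k --> \oo] --> f x) ->
    integral_Rn (f_ k) @[k --> \oo] --> integral_Rn f).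
Proof.
elim: m => [|m [IHn IHc]].
  split=> [f C [_ /(_ 0)] /=|f_ f C _ _ /(_ 0)//].
  by rewrite /weight big_ord0 expr0.
have slice_cont (f : 'cV[R]_m.+1 -> V) C : dominated C f ->
    continuous (fun t => integral_Rn (fun x : 'cV[R]_m => f (col_mx t%:M x))).
  move=> fC t; apply: sequential_continuity => u tu; apply: (IHc _ _ C) => //.
  - move=> k; have [cs sC] := dominated_slice (u k) fC; split=> // x.
    rewrite (le_trans (sC x))// ler_wpM2r ?weight_ge0// ler_piMr ?oneDsqrV_le1//.
    exact: dominated_ge0 fC.
  - exact: (dominated_slice t fC).1.
  - move=> x; have c := @continuous_slice m f x fC.1 t.
    exact: (cvg_comp u _ (ball_seq_cvg tu) c).
have slice_bound (f : 'cV[R]_m.+1 -> V) C t : dominated C f ->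
    `|integral_Rn (fun x : 'cV[R]_m => f (col_mx t%:M x))|
      <= C * wint R ^+ m * (oneDsqr t)^-1.
  by move=> /(dominated_slice t) /IHn h; rewrite mulrAC.
split=> [f C fC|f_ f C fC cf ff] /=.
  rewrite exprSr mulrA; apply: integral1_norm_le; first exact: slice_cont fC.
  by move=> t; exact: slice_bound.
have domf : dominated C f.
  split=> // x; apply: cvg_norm_le (ff x) _; apply: nearW => k; exact: (fC k).2.
apply: (integral1_dct (C := C * wint R ^+ m)).
- by move=> k; exact: slice_cont (fC k).
- by move=> k t; exact: slice_bound (fC k).
- exact: slice_cont domf.
- move=> t; apply: (IHc _ _ (C * (oneDsqr t)^-1)).
  + by move=> k; exact: dominated_slice.
  + exact: (dominated_slice t domf).1.
  + by move=> x; exact: ff.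
Qed.

Lemma integral_Rn_norm_le m (f : 'cV[R]_m -> V) C :
  dominated C f -> `|integral_Rn f| <= C * wint R ^+ m.
Proof. exact: (integral_Rn_bundle m).1. Qed.

Lemma integral_Rn_dct m (f_ : nat -> 'cV[R]_m -> V) f C :
  (forall k, dominated C (f_ k)) -> continuous f ->
  (forall x, f_ k x @[k --> \oo] --> f x) ->
  integral_Rn (f_ k) @[k --> \oo] --> integral_Rn f.
Proof. exact: (integral_Rn_bundle m).2. Qed.

Lemma integral_Rn_continuous (T : pseudoMetricType R) m (f : T -> 'cV[R]_m -> V) C (x0 : T) :
  (forall x, ball x0 1 x -> dominated C (f x)) ->
  (forall y, {for x0, continuous (f^~ y)}) ->
  {for x0, continuous (fun x => integral_Rn (f x))}.
Proof.
move=> fC cf; apply: sequential_continuity => u x0u.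
apply: (@integral_Rn_dct _ _ _ C).
- move=> k; apply: fC; apply: le_ball (x0u k); by rewrite invf_le1// ler1n.
- by have [] := fC x0 (ballxx _ ltr01).
- by move=> y; exact: (cvg_comp u (f^~ y) (ball_seq_cvg x0u) (cf y)).
Qed.

Lemma slice_integral_continuous m (f : 'cV[R]_m.+1 -> V) C : dominated C f ->
  continuous (fun t => integral_Rn (fun x : 'cV[R]_m => f (col_mx t%:M x))).
Proof.
move=> fC t; apply: (@integral_Rn_continuous _ _ _ C).
  move=> s _; have [cs sC] := dominated_slice s fC; split=> // x.
  rewrite (le_trans (sC x))// ler_wpM2r ?weight_ge0// ler_piMr ?oneDsqrV_le1//.
  exact: dominated_ge0 fC.
by move=> x; exact: (continuous_slice fC.1).
Qed.

Lemma slice_integral_bound m (f : 'cV[R]_m.+1 -> V) C t : dominated C f ->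
  `|integral_Rn (fun x : 'cV[R]_m => f (col_mx t%:M x))|
    <= C * wint R ^+ m * (oneDsqr t)^-1.
Proof. by move=> /(dominated_slice t) /integral_Rn_norm_le h; rewrite mulrAC. Qed.

Lemma integral_RnD m (f g : 'cV[R]_m -> V) C D : dominated C f -> dominated D g ->
  integral_Rn (fun x => f x + g x) = integral_Rn f + integral_Rn g.
Proof.
elim: m f g C D => [//|m IH] f g C D fC gD /=.
rewrite -(integral1D (slice_integral_continuous fC)
  (fun t => slice_integral_bound t fC) (slice_integral_continuous gD)
  (fun t => slice_integral_bound t gD)).
congr integral1; apply/funext => t.
exact: IH (dominated_slice t fC) (dominated_slice t gD).
Qed.

End Dominated.

Lemma integral_Rn_linear (R : realType) (V W : completeNormedModType R) m
    (L : {linear V -> W}) (f : 'cV[R]_m -> V) C : continuous L -> dominated C f ->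
  integral_Rn (fun x => L (f x)) = L (integral_Rn f).
Proof.
move=> cL; elim: m f C => [//|m IH] f C fC /=.
rewrite -(integral1_linear cL (slice_integral_continuous fC)
  (fun t => slice_integral_bound t fC)).
by congr integral1; apply/funext => t; exact: IH (dominated_slice t fC).
Qed.

(** * Affine changes of variables *)

Section AffineSubstitution.
Context {R : realType}.
Notation mu := (@lebesgue_measure R).
Notation mR := (measurableTypeR R).

Definition affine_map (c b : R) (t : mR) : mR := c * t + b.

Lemma measurable_affine_map c b : measurable_fun setT (affine_map c b).
Proof. by apply: measurable_funD => //; exact: measurable_funM. Qed.

Lemma affine_preimage_itv (c b x y : R) : c != 0 -> x < y ->
  mu (affine_map c b @^-1` `]x, y]%classic) = (`|c|^-1 * (y - x))%:E.
Proof.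
move=> c0 xy; have [cn|cp] : c < 0 \/ 0 < c by move: c0; rewrite neq_lt => /orP.
  have -> : affine_map c b @^-1` `]x, y]%classic = `[(y - b) / c, (x - b) / c[%classic.
    apply/seteqP; split => t /=; rewrite !in_itv/= /affine_map ler_ndivrMr// ltr_ndivlMr//.
      by move=> /andP[? ?]; apply/andP; split; lra.
    by move=> /andP[? ?]; apply/andP; split; lra.
  apply: eq_trans; first exact: (lebesgue_measure_itv
    (Interval (BLeft ((y - b) / c)) (BLeft ((x - b) / c)))).
  rewrite /= lte_fin ltr_ndivrMr// divfK// ltrD2r xy -EFinB ltr0_norm//.
  by congr EFin; field.
have -> : affine_map c b @^-1` `]x, y]%classic = `](x - b) / c, (y - b) / c]%classic.
  apply/seteqP; split => t /=; rewrite !in_itv/= /affine_map ler_pdivlMr// ltr_pdivrMr//.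
    by move=> /andP[? ?]; apply/andP; split; lra.
  by move=> /andP[? ?]; apply/andP; split; lra.
apply: eq_trans; first exact: (lebesgue_measure_itv
  (Interval (BRight ((x - b) / c)) (BRight ((y - b) / c)))).
rewrite /= lte_fin ltr_pdivlMr// divfK// ltrD2r xy -EFinB gtr0_norm//.
by congr EFin; field.
Qed.

Definition affine_pushforward (c b : R) : {measure set mR -> \bar R}.
Proof.
unshelve refine (pushforward mu (affine_map c b) : {measure set mR -> \bar R}).
exact: measurable_affine_map.
Defined.

Definition affine_measure (c b : R) : {measure set mR -> \bar R} :=
  mscale (NngNum (normr_ge0 c)) (affine_pushforward c b).

Lemma affine_measureE (c b : R) (A : set mR) :
  affine_measure c b A = (`|c|%:E * mu (affine_map c b @^-1` A))%E.
Proof. by []. Qed.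

(** By uniqueness of Lebesgue measure it is enough to compare on the intervals []x, y]]. *)
Lemma lebesgue_measure_affine (c b : R) (A : set mR) : c != 0 -> measurable A ->
  mu A = affine_measure c b A.
Proof.
move=> c0; apply: lebesgue_measure_unique => X /ocitvP[->|[[x y] /= xy ->]].
  by rewrite measure0; symmetry; exact: measure0.
rewrite affine_measureE affine_preimage_itv//.
apply: eq_trans; first exact: (lebesgue_measure_itv (Interval (BRight x) (BRight y))).
rewrite /= lte_fin xy -EFinM mulrA divff ?normr_eq0// mul1r -EFinB//.
Qed.
End AffineSubstitution.

Section AffineIntegral.
Context {R : realType}.
Notation mu := (@lebesgue_measure R).

Lemma integrable_affine (f : R -> R) (c b : R) : c != 0 ->
  mu.-integrable setT (EFin \o f) ->
  mu.-integrable setT (EFin \o (fun t => f (c * t + b))).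
Proof.
move=> c0 /integrableP[mf fi].
have mf' : measurable_fun setT (f : measurableTypeR R -> R) by apply/measurable_EFinP.
have mg : measurable_fun setT (f \o affine_map c b).
  exact: (measurableT_comp mf' (measurable_affine_map c b)).
apply/integrableP; split; first by apply/measurable_EFinP.
have mfn : measurable_fun setT (fun t : measurableTypeR R => (`|f t|%:E)).
  by apply/measurable_EFinP; exact: measurableT_comp.
have E : (\int[affine_pushforward c b]_x (`|f x|%:E) =
    \int[mu]_x (`|f (affine_map c b x)|%:E))%E.
  by rewrite (ge0_integral_pushforward (measurable_affine_map c b)).
rewrite [X in (X < _)%E](_ : _ = (\int[mu]_x (`|f (affine_map c b x)|%:E))%E)// -E.
move: fi; rewrite (@eq_measure_integral _ _ _ _ (affine_measure c b)); last first.
  by move=> A mA _; exact: lebesgue_measure_affine.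
rewrite (ge0_integral_mscale _ _ _ mfn)// => h.
rewrite ltey; apply/eqP => h'; move: h; rewrite h' gt0_muley ?ltxx//.
by rewrite lte_fin normr_gt0.
Qed.

Lemma Rintegral_affine (f : R -> R) (c b : R) : c != 0 ->
  mu.-integrable setT (EFin \o f) ->
  \int[mu]_t f t = `|c| * \int[mu]_t (f (c * t + b)).
Proof.
move=> c0 fi; have gi := integrable_affine b c0 fi.
have /integrableP[mf _] := fi.
rewrite /Rintegral (@eq_measure_integral _ _ _ _ (affine_measure c b)); last first.
  by move=> A mA _; exact: lebesgue_measure_affine.
have pi : (affine_pushforward c b).-integrable setT (EFin \o f).
  exact: (integrable_pushforward (measurable_affine_map c b)).
have -> : (\int[affine_measure c b]_t (f t)%:E = `|c|%:E * \int[affine_pushforward c b]_t (f t)%:E)%E.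
  rewrite integralE [in RHS]integralE.
  rewrite (ge0_integral_mscale _ _ _ (measurable_funepos mf))//.
  rewrite (ge0_integral_mscale _ _ _ (measurable_funeneg mf))//.
  symmetry; apply: (@muleBr _ _ (\int[affine_pushforward c b]_x (EFin \o f)^\+ x)%E
    (\int[affine_pushforward c b]_x (EFin \o f)^\- x)%E) => //.
  exact: (integrable_add_def measurableT pi).
rewrite (integral_pushforward (measurable_affine_map c b))//.
rewrite fineM//.
exact: (integrable_fin_num _ gi).
Qed.

End AffineIntegral.

Lemma is_integral_affine (R : realType) (V : normedModType R) (f : R -> V) (v : V) (c b : R) :
  c != 0 -> is_integral f v -> is_integral (fun t => f (c * t + b)) (`|c|^-1 *: v).
Proof.
move=> c0 fv phi cphi; have [i1 e1] := fv phi cphi.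
split; first exact: (integrable_affine b c0 i1).
rewrite linearZ e1 (Rintegral_affine b c0 i1).
by rewrite -[LHS]/(_ * _) mulrA mulVf ?normr_eq0// mul1r.
Qed.

(** Valid for every [f]: the inverse substitution shows that both weak integrals exist or neither
    does, and in the latter case both sides are the default value 0. The same dichotomy proves
    [integral1Z]. *)
Lemma integral1_affine (R : realType) (V : normedModType R) (f : R -> V) (c b : R) :
  c != 0 -> integral1 (fun t => f (c * t + b)) = `|c|^-1 *: integral1 f.
Proof.
move=> c0; have [[v fv]|nf] := pselect (exists v, is_integral f v).
  by rewrite (integral1E fv) (integral1E (is_integral_affine b c0 fv)).
rewrite /integral1 !xgetPN ?scaler0// => v fv; apply: nf; first by exists v.
exists (`|c^-1|^-1 *: v); have cV0 : c^-1 != 0 by rewrite invr_eq0.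
have := is_integral_affine (- (b / c)) cV0 fv.
congr is_integral; apply/funext => t; congr f.
by rewrite mulrDr mulrA divff// mul1r mulrN mulrCA divff// mulr1 subrK.
Qed.

Lemma integral1Z (R : realType) (V : normedModType R) (f : R -> V) (c : R) :
  c != 0 -> integral1 (fun t => c *: f t) = c *: integral1 f.
Proof.
have isZ (g : R -> V) v k : is_integral g v -> is_integral (fun t => k *: g t) (k *: v).
  move=> gv phi cphi; have [i1 e1] := gv phi cphi; split.
    apply: eq_integrable (integrableZl measurableT k i1) => // t _.
    by rewrite /= linearZ.
  rewrite linearZ e1 -[LHS](RintegralZl k measurableT i1).
  by apply: eq_Rintegral => t _; rewrite /= linearZ.
move=> c0; have [[v fv]|nf] := pselect (exists v, is_integral f v).
  by rewrite (integral1E fv) (integral1E (isZ _ _ c fv)).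
rewrite /integral1 !xgetPN ?scaler0// => v fv; apply: nf; first by exists v.
exists (c^-1 *: v); have := isZ _ _ c^-1 fv.
by under eq_fun do rewrite scalerA mulVf// scale1r.
Qed.

Lemma integral_RnZ (R : realType) (V : normedModType R) m (f : 'cV[R]_m -> V) (c : R) :
  c != 0 -> integral_Rn (fun x => c *: f x) = c *: integral_Rn f.
Proof.
move=> c0; elim: m f => [//|m IH] f /=.
by under eq_fun do rewrite IH; rewrite integral1Z.
Qed.

Lemma integral_Rn_affine (R : realType) (V : normedModType R) m (f : 'cV[R]_m -> V)
    (c : R) (b : 'cV[R]_m) : c != 0 ->
  integral_Rn (fun x => f (c *: x + b)) = `|c| ^- m *: integral_Rn f.
Proof.
move=> c0; elim: m f b => [|m IH] f b /=.
  by rewrite expr0 invr1 scale1r; congr f; apply/matrixP => -[].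
have cm0 : `|c| ^- m != 0 by rewrite invr_eq0 expf_neq0// normr_eq0.
rewrite -[b](@vsubmxK _ 1 m) [usubmx _]mx11_scalar.
set b0 := (X in X%:M); set b1 := dsubmx _.
transitivity (integral1 (fun t => `|c| ^- m *:
   integral_Rn (fun x => f (col_mx (c * t + b0)%:M x)))).
  congr integral1; apply/funext => t; rewrite -(IH _ b1); congr integral_Rn.
  apply/funext => x; congr f.
  apply: eq_trans (congr1 (fun z : 'cV[R]_(1 + m) => z + col_mx b0%:M b1)
    (scale_col_mx c (t%:M : 'cV[R]_1) x)) _.
  by rewrite add_col_mx scale_scalar_mx -raddfD.
rewrite (integral1Z (fun t => integral_Rn (fun x => f (col_mx (c * t + b0)%:M x))) cm0).
rewrite (integral1_affine (fun t => integral_Rn (fun x => f (col_mx t%:M x))))//.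
by rewrite scalerA exprSr invfM.
Qed.

Lemma integral_Rn_shift (R : realType) (V : normedModType R) m (f : 'cV[R]_m -> V)
    (b : 'cV[R]_m) : integral_Rn (fun x => f (x + b)) = integral_Rn f.
Proof.
have := integral_Rn_affine f b (oner_neq0 R).
by rewrite normr1 expr1n invr1 scale1r => <-; under [in RHS]eq_fun do rewrite scale1r.
Qed.

Lemma integral_Rn_opp (R : realType) (V : normedModType R) m (f : 'cV[R]_m -> V) :
  integral_Rn (fun x => f (- x)) = integral_Rn f.
Proof.
have := @integral_Rn_affine R V m f (-1) 0; rewrite oppr_eq0 oner_neq0 => /(_ isT).
rewrite normrN1 expr1n invr1 scale1r => <-.
by under [in RHS]eq_fun do rewrite scaleN1r addr0.
Qed.

(** * Interchange of integrals *)

Section Fubini.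
Context {R : realType}.
Notation mu := (@lebesgue_measure R).

(** Separate continuity suffices: [F] is the pointwise limit of its samplings in the first variable,
    which are jointly measurable. Integrability on the product then follows from the product bound
    by Tonelli. *)
Lemma Rintegral_swap (F : R -> R -> R) (C : R) :
  (forall s, continuous (F s)) -> (forall t, continuous (F^~ t)) ->
  (forall s t, `|F s t| <= C * (oneDsqr s)^-1 * (oneDsqr t)^-1) ->
  \int[mu]_s (\int[mu]_t F s t) = \int[mu]_t (\int[mu]_s F s t).
Proof.
move=> c2 c1 FC.
have C0 : 0 <= C.
  have := le_trans (normr_ge0 _) (FC 0 0).
  by rewrite !pmulr_lge0// invr_gt0 oneDsqr_gt0.
have mF2 s : measurable_fun setT (F s) by exact: continuous_measurable_fun (c2 s).
have mF1 t : measurable_fun setT (F^~ t) by exact: continuous_measurable_fun (c1 t).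
have mF : measurable_fun setT (fun p : measurableTypeR R * measurableTypeR R => F p.1 p.2).
  have h0 k : 0 < k.+1%:R^-1 :> R by [].
  apply: (measurable_fun_cvg (h := fun k (p : measurableTypeR R * measurableTypeR R) =>
    steps (fun s => F s p.2 : R^o) k p.1)).
    by move=> k; exact: (measurable_stepf _ _ (h0 k) mF2).
  by move=> p _; apply: (@steps_cvg _ R^o); exact: c1.
have mFE : measurable_fun setT
    (fun p : measurableTypeR R * measurableTypeR R => (F p.1 p.2)%:E).
  exact/measurable_EFinP.
have iF2 s : mu.-integrable setT (EFin \o F s) by exact: integrable_dominated (FC s).
have iF1 t : mu.-integrable setT (EFin \o F^~ t).
  apply: (@integrable_dominated _ _ (C * (oneDsqr t)^-1) (mF1 t)) => s.
  by rewrite mulrAC.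
have iF : (mu \x mu)%E.-integrable setT
    (fun p : measurableTypeR R * measurableTypeR R => (F p.1 p.2)%:E).
  apply: (@integrable12ltyP _ _ _ _ R mu mu _ mFE).2.
  apply: (@le_lt_trans _ _ (\int[mu]_s (C * wint R * (oneDsqr s)^-1)%:E)%E).
    apply: ge0_le_integral => //.
    - by move=> s _; apply: integral_ge0.
    - apply: (@measurable_fun_fubini_tonelli_F _ _ _ _ R mu
        (fun p : measurableTypeR R * measurableTypeR R => `|F p.1 p.2|%:E)) => //.
      by apply/measurable_EFinP; exact: measurableT_comp.
    - apply/measurable_EFinP; apply: measurable_funM => //.
      by apply: continuous_measurable_fun; exact: continuous_oneDsqrV.
    - move=> s _ /=.
      have -> : (C * wint R * (oneDsqr s)^-1)%:E =
          (\int[mu]_t (C * (oneDsqr s)^-1 * (oneDsqr t)^-1)%:E)%E.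
        rewrite -[RHS]fineK; last first.
          exact: integrable_fin_num (integrableZl measurableT _ (integrable_oneDsqrV R)).
        congr EFin; rewrite -[RHS]/(\int[mu]_t (_ * _)) RintegralZl//; last exact: integrable_oneDsqrV.
        by rewrite mulrAC.
      apply: ge0_le_integral => //.
      + by apply/measurable_EFinP; exact: (@measurable_norm_continuous _ R^o _ (c2 s)).
      + apply/measurable_EFinP; apply: measurable_funM => //.
        by apply: continuous_measurable_fun; exact: continuous_oneDsqrV.
      + by move=> t _; rewrite lee_fin.
  have := integrableZl measurableT (C * wint R) (integrable_oneDsqrV R).
  by move=> /integrable_fin_num; rewrite ltey_eq => ->.
have := Fubini iF; rewrite /Rintegral /= => E.
under eq_integral do rewrite fineK ?(integrable_fin_num _ (iF2 _))//.
under [in RHS]eq_integral do rewrite fineK ?(integrable_fin_num _ (iF1 _))//.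
by rewrite E.
Qed.

End Fubini.
#[global] Opaque integral1.

Definition bidominated (R : realType) (V : normedModType R) m p (C : R)
    (f : 'cV[R]_m -> 'cV[R]_p -> V) : Prop :=
  [/\ forall y, continuous (f y), forall x, continuous (f^~ x) &
      forall y x, `|f y x| <= C * weight y * weight x].

Section VectorFubini.
Context {R : realType} {V : completeNormedModType R}.

Lemma integral1_continuous (f : R -> R -> V) C s :
  (forall s, continuous (f s)) -> (forall t, continuous (f^~ t)) ->
  (forall s t, `|f s t| <= C * (oneDsqr t)^-1) ->
  {for s, continuous (fun s => integral1 (f s))}.
Proof.
move=> c2 c1 fC; apply: sequential_continuity => u su.
apply: (@integral1_dct _ _ _ _ C) => // t.
exact: (cvg_comp u (f^~ t) (ball_seq_cvg su) (c1 t s)).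
Qed.

(** A functional passes through both weak integrals, which leaves the scalar statement; functionals
    separate points. *)
Lemma integral1_swap (f : R -> R -> V) (C : R) :
  (forall s, continuous (f s)) -> (forall t, continuous (f^~ t)) ->
  (forall s t, `|f s t| <= C * (oneDsqr s)^-1 * (oneDsqr t)^-1) ->
  integral1 (fun s => integral1 (f s)) = integral1 (fun t => integral1 (f^~ t)).
Proof.
move=> c2 c1 fC.
have C0 : 0 <= C.
  have := le_trans (normr_ge0 _) (fC 0 0).
  by rewrite !pmulr_lge0// invr_gt0 oneDsqr_gt0.
have fC' s t : `|f s t| <= C * (oneDsqr t)^-1 * (oneDsqr s)^-1 by rewrite mulrAC.
have dropl s t : `|f s t| <= C * (oneDsqr t)^-1.
  rewrite (le_trans (fC s t))// ler_wpM2r ?invr_ge0 ?oneDsqr_ge0//.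
  by rewrite ler_piMr// oneDsqrV_le1.
have dropr s t : `|f s t| <= C * (oneDsqr s)^-1.
  rewrite (le_trans (fC s t))// ler_piMr ?oneDsqrV_le1//.
  by rewrite mulr_ge0// invr_ge0 oneDsqr_ge0.
have cA : continuous (fun s => integral1 (f s)).
  by move=> s; exact: integral1_continuous c2 c1 dropl.
have cB : continuous (fun t => integral1 (f^~ t)).
  move=> t; apply: (@integral1_continuous (fun t s => f s t) C) => // *; exact: dropr.
have bA s : `|integral1 (f s)| <= C * wint R * (oneDsqr s)^-1.
  by rewrite mulrAC; exact: integral1_norm_le.
have bB t : `|integral1 (f^~ t)| <= C * wint R * (oneDsqr t)^-1.
  by rewrite mulrAC; exact: integral1_norm_le.
apply: functional_ext => phi cphi.
have [_ eA] := is_integral_dominated cA bA cphi.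
have [_ eB] := is_integral_dominated cB bB cphi.
apply: eq_trans eA _; apply: eq_trans _ (esym eB); rewrite /comp.
under eq_Rintegral do rewrite (is_integral_dominated (c2 _) (fC _) cphi).2.
under [in RHS]eq_Rintegral do rewrite (is_integral_dominated (c1 _) (fC'^~ _) cphi).2.
have [K K0 phiK] := continuous_linear_bound cphi.
apply: (@Rintegral_swap _ (fun s t => phi (f s t)) (K * C)).
- by move=> s; apply: continuous_comp_fun cphi (c2 s).
- by move=> t; apply: continuous_comp_fun cphi (c1 t).
- by move=> s t; rewrite (le_trans (phiK _))// -!mulrA ler_wpM2l// !mulrA.
Qed.

Lemma integral1_Rn_swap p (f : R -> 'cV[R]_p -> V) (C : R) :
  (forall s, continuous (f s)) -> (forall x, continuous (f^~ x)) ->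
  (forall s x, `|f s x| <= C * (oneDsqr s)^-1 * weight x) ->
  integral1 (fun s => integral_Rn (f s)) = integral_Rn (fun x => integral1 (f^~ x)).
Proof.
elim: p f C => [//|p IH] f C c2 c1 fC.
have C0 : 0 <= C.
  have := le_trans (normr_ge0 _) (fC 0 0).
  by rewrite pmulr_lge0 ?weight_gt0// pmulr_lge0// invr_gt0 oneDsqr_gt0.
have domf s : dominated (C * (oneDsqr s)^-1) (f s) by split; [exact: c2|exact: fC].
have le1 s : C * (oneDsqr s)^-1 <= C by rewrite ler_piMr// oneDsqrV_le1.
rewrite /=.
rewrite (@integral1_swap (fun s t => integral_Rn (fun x : 'cV[R]_p => f s (col_mx t%:M x)))
  (C * wint R ^+ p)).
- congr integral1; apply/funext => t.
  apply: (IH (fun s x => f s (col_mx t%:M x)) (C * (oneDsqr t)^-1)).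
  + by move=> s; case: (dominated_slice t (domf s)).
  + by move=> x; exact: c1.
  + move=> s x; case: (dominated_slice t (domf s)) => _ /(_ x).
    by rewrite [C * _ * _ in X in _ -> X]mulrAC.
- by move=> s; exact: slice_integral_continuous (domf s).
- move=> t s; apply: (@integral_Rn_continuous _ _ _ _ _ C); last first.
    by move=> x; exact: c1.
  move=> s' _; have [a b] := dominated_slice t (domf s'); split=> // x.
  rewrite (le_trans (b x))// ler_wpM2r ?weight_ge0//.
  rewrite (le_trans _ (le1 s'))// ler_piMr ?oneDsqrV_le1//.
  by rewrite mulr_ge0// invr_ge0 oneDsqr_ge0.
- move=> s t; rewrite (le_trans (slice_integral_bound t (domf s)))//.
  by rewrite [C * (oneDsqr s)^-1 * _]mulrAC.
Qed.

Lemma bidominated_dominatedr m p C (f : 'cV[R]_m -> 'cV[R]_p -> V) y :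
  bidominated C f -> dominated (C * weight y) (f y).
Proof. by move=> [c2 c1 fC]; split. Qed.

Lemma bidominatedC m p C (f : 'cV[R]_m -> 'cV[R]_p -> V) :
  bidominated C f -> bidominated C (fun x y => f y x).
Proof. by move=> [c2 c1 fC]; split=> // x y; rewrite mulrAC. Qed.

Lemma bidominated_integral m p C (f : 'cV[R]_m -> 'cV[R]_p -> V) :
  bidominated C f -> dominated (C * wint R ^+ p) (fun y => integral_Rn (f y)).
Proof.
move=> fC; have [c2 c1 b] := fC; split; last first.
  by move=> y; rewrite mulrAC; exact: integral_Rn_norm_le (bidominated_dominatedr y fC).
move=> y; apply: (@integral_Rn_continuous _ _ _ _ _ C); last by move=> x; exact: c1.
move=> z _; have [a d] := bidominated_dominatedr z fC; split=> // x.
rewrite (le_trans (d x))// ler_wpM2r ?weight_ge0// ler_piMr ?weight_le1//.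
have := le_trans (normr_ge0 _) (b 0 0).
by rewrite !pmulr_lge0 ?weight_gt0.
Qed.

Lemma integral_Rn_swap m p (f : 'cV[R]_m -> 'cV[R]_p -> V) C : bidominated C f ->
  integral_Rn (fun y => integral_Rn (f y)) = integral_Rn (fun x => integral_Rn (f^~ x)).
Proof.
elim: m f C => [//|m IH] f C fC; have [c2 c1 b] := fC.
have sC t : bidominated (C * (oneDsqr t)^-1) (fun y : 'cV[R]_m => f (col_mx t%:M y)).
  split=> [y|x y|y x]; first exact: c2.
    have : dominated (C * weight x) (f^~ x) by split=> // z; rewrite mulrAC.
    by move=> /(dominated_slice t) [+ _]; apply.
  by rewrite (le_trans (b _ _))// (weight_col_mx (m := 1)) weight_scalar_mx mulrA.
rewrite /=.
under eq_fun do rewrite (IH _ _ (sC _)).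
apply: (@integral1_Rn_swap p (fun t x => integral_Rn (fun y : 'cV[R]_m => f (col_mx t%:M y) x))
  (C * wint R ^+ m)).
- move=> t; have [a _] := bidominated_integral (bidominatedC (sC t)); exact: a.
- move=> x; have dx : dominated (C * weight x) (f^~ x) by split=> // z; rewrite mulrAC.
  exact: slice_integral_continuous dx.
- move=> t x; have [_ /(_ x)] := bidominated_integral (bidominatedC (sC t)).
  by rewrite [C * _ * _ in X in _ -> X]mulrAC.
Qed.

End VectorFubini.

Section MapIntegral.
Context {R : realType} {V W : completeNormedModType R}.
Variables (L : V -> W) (K : R).
Hypotheses (L_linear : forall (r : R) u v, L (r *: u + v) = r *: L u + L v)
  (L_bounded : forall v, `|L v| <= K * `|v|).

Let pL : {linear V -> W} := HB.pack_for {linear V -> W} L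
  (GRing.isLinear.Build R V W *:%R L L_linear).

Lemma bounded_additive_continuous : continuous L.
Proof. exact: (@bounded_linear_cont _ _ _ pL K L_bounded). Qed.

Lemma dominated_map m (f : 'cV[R]_m -> V) C :
  0 <= K -> dominated C f -> dominated (K * C) (fun x => L (f x)).
Proof.
move=> K0 [cf fC]; split; first exact: continuous_comp_fun bounded_additive_continuous cf.
by move=> x; rewrite (le_trans (L_bounded _))// -mulrA ler_wpM2l.
Qed.

Lemma integral_Rn_map m (f : 'cV[R]_m -> V) C : dominated C f ->
  integral_Rn (fun x => L (f x)) = L (integral_Rn f).
Proof. exact: (@integral_Rn_linear _ _ _ _ pL _ _ bounded_additive_continuous). Qed.

Lemma integral_bar_map m (f : 'cV[R]_m -> V) C : dominated C f ->
  integral_bar (fun x => L (f x)) = L (integral_bar f).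
Proof.
move=> fC; rewrite /integral_bar (integral_Rn_map fC).
have L0 : L 0 = 0.
  have := L_linear (-1) 0 0.
  by rewrite scaler0 addr0 scaleN1r addNr.
by have := L_linear (Num.sqrt (2 * pi) ^- m) (integral_Rn f) 0; rewrite !addr0 L0 addr0.
Qed.

End MapIntegral.

(** * Complex phases and the operations of the algebra *)

Section ComplexScalars.
Context {R : realType} {V : complexBanachType R}.
Implicit Types (x y : V) (z w : R[i]) (r t : R).

Lemma cscale1 x : cscale 1 x = x.
Proof. by rewrite (cscale_real 1 x) scale1r. Qed.

Lemma cscale_scale z r x : cscale z (r *: x) = r *: cscale z x.
Proof. by rewrite -!cscale_real !cscaleA mulrC. Qed.

Lemma cscale_linear z r x y : cscale z (r *: x + y) = r *: cscale z x + cscale z y.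
Proof. by rewrite cscaleDr cscale_scale. Qed.

Lemma cscaler0 z : cscale z (0 : V) = 0.
Proof. by have := cscale_scale z 0 0; rewrite scale0r => ->; rewrite scale0r. Qed.

Lemma cscalerN z x : cscale z (- x) = - cscale z x.
Proof. by rewrite -scaleN1r cscale_scale scaleN1r. Qed.

Lemma cscalerB z x y : cscale z (x - y) = cscale z x - cscale z y.
Proof. by rewrite cscaleDr cscalerN. Qed.

Lemma norm_expi t : ComplexField.Normc.normc (expi t) = 1.
Proof. by rewrite /= cos2Dsin2 sqrtr1. Qed.

Lemma expiD s t : expi (s + t) = expi s * expi t :> R[i].
Proof.
by apply/eqP; rewrite eq_complex /= cosD sinD [sin s * _]mulrC addrC eqxx andTb addrC addrC.
Qed.

Lemma expi0 : expi 0 = 1 :> R[i].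
Proof. by rewrite /expi cos0 sin0. Qed.

Lemma norm_cscale_expi t x : `|cscale (expi t) x| = `|x|.
Proof. by rewrite norm_cscale norm_expi mul1r. Qed.

Lemma cscale_expiD s t x : cscale (expi (s + t)) x = cscale (expi s) (cscale (expi t) x).
Proof. by rewrite expiD cscaleA. Qed.

Lemma cscale_expiK t x : cscale (expi (- t)) (cscale (expi t) x) = x.
Proof. by rewrite -cscale_expiD addNr expi0 cscale1. Qed.

(** Reduces continuity and differentiation of phases to the real functions [cos] and [sin]. *)
Lemma cscale_expiE t x : cscale (expi t) x = cos t *: x + sin t *: cscale 'i%C x.
Proof.
rewrite /expi -(cscale_real (cos t)) -(cscale_real (sin t)) cscaleA -cscaleDl.
congr cscale; apply/eqP; rewrite eq_complex /=.
by rewrite !(mulr0, mulr1, mul0r, subr0, addr0, add0r) !eqxx.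
Qed.

Lemma continuous_cscale z : continuous (cscale z : V -> V).
Proof.
apply: (@bounded_additive_continuous _ _ _ _ (ComplexField.Normc.normc z)).
  by move=> r u v; exact: cscale_linear.
by move=> v; rewrite norm_cscale.
Qed.

Lemma cvg_cscale_expi (T : Type) (F : set_system T) {FF : Filter F} (u : T -> R) (v : T -> V)
    t x : u y @[y --> F] --> t -> v y @[y --> F] --> x ->
  cscale (expi (u y)) (v y) @[y --> F] --> cscale (expi t) x.
Proof.
move=> ut vx; under eq_fun do rewrite cscale_expiE; rewrite cscale_expiE.
apply: cvgD; apply: cvgZ => //.
- exact: (cvg_comp u cos ut (@continuous_cos _ _)).
- exact: (cvg_comp u sin ut (@continuous_sin _ _)).
- exact: (cvg_comp v (cscale 'i%C) vx (@continuous_cscale _ _)).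
Qed.

Lemma continuous_cscale_expi (T : topologicalType) (u : T -> R) (v : T -> V) :
  continuous u -> continuous v -> continuous (fun p => cscale (expi (u p)) (v p)).
Proof. by move=> cu cv p; apply: (@cvg_cscale_expi _ (nbhs p)); [exact: cu|exact: cv]. Qed.

End ComplexScalars.

Section CstarOperations.
Context {R : realType} {A : cstarAlgType R}.
Implicit Types (x y a : A) (r : R).

Lemma amulZrl r x y : amul (r *: x) y = r *: amul x y.
Proof. by rewrite -!cscale_real amulZl. Qed.

Lemma amulZrr r x y : amul x (r *: y) = r *: amul x y.
Proof. by rewrite -!cscale_real amulZr. Qed.

Lemma amul_linearl a r x y : amul (r *: x + y) a = r *: amul x a + amul y a.
Proof. by rewrite amulDl amulZrl. Qed.

Lemma amul_linearr a r x y : amul a (r *: x + y) = r *: amul a x + amul a y.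
Proof. by rewrite amulDr amulZrr. Qed.

Lemma amul0l x : amul 0 x = 0.
Proof. by have := amulZrl 0 0 x; rewrite scale0r => ->; rewrite scale0r. Qed.

Lemma amul0r x : amul x 0 = 0.
Proof. by have := amulZrr 0 x 0; rewrite scale0r => ->; rewrite scale0r. Qed.

Lemma amulNl x y : amul (- x) y = - amul x y.
Proof. by rewrite -scaleN1r amulZrl scaleN1r. Qed.

Lemma amulNr x y : amul x (- y) = - amul x y.
Proof. by rewrite -scaleN1r amulZrr scaleN1r. Qed.

Lemma amulBl x y a : amul (x - y) a = amul x a - amul y a.
Proof. by rewrite amulDl amulNl. Qed.

Lemma amulBr a x y : amul a (x - y) = amul a x - amul a y.
Proof. by rewrite amulDr amulNr. Qed.

Lemma starZr r x : star (r *: x) = r *: star x.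
Proof. by rewrite -!cscale_real starZ /= oppr0. Qed.

Lemma star_linear r x y : star (r *: x + y) = r *: star x + star y.
Proof. by rewrite starD starZr. Qed.

Lemma norm_star x : `|star x| = `|x|.
Proof.
suff le y : `|y| <= `|star y| by apply/eqP; rewrite eq_le le andbT -{2}(starK x) le.
have [->|y0] := eqVneq y 0; first by rewrite normr0.
have := norm_amul (star y) y; rewrite norm_star_amul expr2.
by rewrite ler_pM2r// normr_gt0.
Qed.

Lemma star_cscale_expi t x : star (cscale (expi t) x) = cscale (expi (- t)) (star x).
Proof. by rewrite starZ /expi cosN sinN. Qed.

Lemma continuous_star : continuous (star : A -> A).
Proof.
apply: (@bounded_additive_continuous _ _ _ _ 1); first exact: star_linear.
by move=> x; rewrite norm_star mul1r.
Qed.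

Lemma cvg_amul (T : Type) (F : set_system T) {FF : Filter F} (u v : T -> A) x y :
  u z @[z --> F] --> x -> v z @[z --> F] --> y ->
  amul (u z) (v z) @[z --> F] --> amul x y.
Proof.
move=> ux vy.
have h : `|u z - x| * `|v z| + `|x| * `|v z - y| @[z --> F] --> 0 * `|y| + `|x| * 0.
  have ux0 : `|u z - x| @[z --> F] --> (0 : R).
    by rewrite -(@normr0 _ A) -(subrr x); apply: cvg_norm; apply: cvgB => //; exact: cvg_cst.
  have vy0 : `|v z - y| @[z --> F] --> (0 : R).
    by rewrite -(@normr0 _ A) -(subrr y); apply: cvg_norm; apply: cvgB => //; exact: cvg_cst.
  apply: cvgD; apply: cvgM => //; [exact: cvg_norm|exact: cvg_cst].
move: h; rewrite mul0r mulr0 addr0 => h.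
apply/cvgrPdist_le => e e0; move/cvgrPdist_le : h => /(_ _ e0); apply: filterS => z.
rewrite sub0r normrN => h; rewrite distrC.
have -> : amul (u z) (v z) - amul x y = amul (u z - x) (v z) + amul x (v z - y).
  by rewrite amulBl amulBr addrA subrK.
rewrite (le_trans (ler_normD _ _))//.
rewrite (le_trans (lerD (norm_amul _ _) (norm_amul _ _)))//.
by rewrite (le_trans (ler_norm _)).
Qed.

Lemma continuous_amul (T : topologicalType) (u v : T -> A) :
  continuous u -> continuous v -> continuous (fun z => amul (u z) (v z)).
Proof. by move=> cu cv z; apply: (@cvg_amul _ (nbhs z)); [exact: cu|exact: cv]. Qed.

End CstarOperations.

(** * Smooth and Schwartz functions *)

Section DirectionalDerivative.
Context {R : realType}.

Lemma is_deriveP (V W : normedModType R) (f : V -> W) (x v : V) (l : W) :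
  is_derive x v f l <-> h^-1 *: (f (h *: v + x) - f x) @[h --> (0 : R)^'] --> l.
Proof.
split=> [[+ <-]//|fl]; split; first exact: cvgP fl.
exact: (cvg_lim _ fl).
Qed.

Lemma is_derive_cvg (V W : normedModType R) (f : V -> W) (x v : V) (l : W) :
  is_derive x v f l -> f (h *: v + x) @[h --> (0 : R)^'] --> f x.
Proof.
move=> /is_deriveP fl.
have h0 : h @[h --> (0 : R)^'] --> (0 : R) by exact: cvg_within.
have H : h *: (h^-1 *: (f (h *: v + x) - f x)) + f x @[h --> (0 : R)^'] --> 0 *: l + f x.
  by apply: cvgD; [apply: cvgZ|exact: cvg_cst].
move: H; rewrite scale0r add0r; apply: cvg_trans; apply: near_eq_cvg.
near=> h; rewrite scalerA divff ?scale1r ?subrK//.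
by near: h; exact: nbhs_dnbhs_neq.
Unshelve. all: by end_near. Qed.

Lemma is_derive_scale (V W : normedModType R) (k : V -> R) (f : V -> W) (x v : V) (dk : R)
    (df : W) : is_derive x v (k : V -> R^o) dk -> is_derive x v f df ->
  is_derive x v (fun y => k y *: f y) (dk *: f x + k x *: df).
Proof.
move=> dK dF; have /is_deriveP lf := dF; have /is_deriveP lk := dK.
apply/is_deriveP; have cf := is_derive_cvg dF.
have H : (h^-1 *: (k (h *: v + x) - k x) : R^o) *: f (h *: v + x) +
    k x *: (h^-1 *: (f (h *: v + x) - f x)) @[h --> (0 : R)^'] --> dk *: f x + k x *: df.
  by apply: cvgD; apply: cvgZ => //; exact: cvg_cst.
apply: cvg_trans H; apply: near_eq_cvg; apply: nearW => h.
rewrite -[_ *: (k _ - k x)]/(_ * _).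
rewrite -scalerA [k x *: _]scalerA [k x * _]mulrC -[_ * k x *: _]scalerA -scalerDr.
by rewrite scalerBl scalerBr addrA subrK.
Qed.

Lemma is_derive_linear (V W U : normedModType R) (L : W -> U) (f : V -> W) (x v : V) (df : W) :
  (forall (r : R) u w, L (r *: u + w) = r *: L u + L w) -> continuous L ->
  is_derive x v f df -> is_derive x v (fun y => L (f y)) (L df).
Proof.
move=> linL cL /is_deriveP fl; apply/is_deriveP.
have L0 : L 0 = 0 by have := linL (-1) 0 0; rewrite scaler0 addr0 scaleN1r addNr.
have := cvg_comp _ L fl (cL df).
apply: cvg_trans; apply: near_eq_cvg; apply: nearW => h /=.
have := linL h^-1 (f (h *: v + x) - f x) 0; rewrite !addr0 L0 addr0 => ->.
congr (_ *: _); have := linL (-1) (f x) (f (h *: v + x)).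
by rewrite !scaleN1r addrC => ->; rewrite addrC.
Qed.

Lemma is_derive_line (V W : normedModType R) (f : V -> W) (x v : V) (s : R) (l : W) :
  is_derive (s *: v + x) v f l -> is_derive s (1 : R) (fun s : R^o => f (s *: v + x)) l.
Proof.
move=> /is_deriveP fl; apply/is_deriveP; move: fl; apply: cvg_trans; apply: near_eq_cvg.
by apply: nearW => h; rewrite -[h *: 1]/(h * 1) mulr1 scalerDl addrA.
Qed.

(** The scalar mean value theorem is applied to [phi \o f]; the intermediate point depends on [phi],
    but the bound [M] does not. *)
Lemma mean_value_le (V : normedModType R) (f df : R -> V) (a b M : R) : a <= b ->
  (forall s, is_derive s (1 : R) (f : R^o -> V) (df s)) ->
  (forall s, a <= s <= b -> `|df s| <= M) -> `|f b - f a| <= M * (b - a).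
Proof.
move=> ab dF dM; apply: functional_norm_le => phi cphi phi1.
have dphi s : is_derive s (1 : R) (fun s => phi (f s) : R) (phi (df s)).
  have := is_derive_linear (L := phi) _ cphi (dF s); apply=> r u w; exact: linearP.
have [|c] := @MVT_segment R (fun s => phi (f s)) (fun s => phi (df s)) a b ab.
  by apply: derivable_within_continuous => s _; exact: ex_derive.
rewrite in_itv/= => cab; rewrite linearB => ->.
rewrite normrM [`|b - a|]ger0_norm ?subr_ge0// ler_wpM2r ?subr_ge0//.
by rewrite (le_trans (phi1 _))// dM.
Qed.

Lemma directional_mean_value (V W : normedModType R) (f df : V -> W) (x v : V) (h M : R) :
  (forall y, is_derive y v f (df y)) ->
  (forall s, `|s| <= `|h| -> `|df (s *: v + x)| <= M) ->
  `|f (h *: v + x) - f x| <= M * `|h|.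
Proof.
move=> dF dM; have dl s : is_derive s (1 : R) (fun s : R^o => f (s *: v + x)) (df (s *: v + x)).
  exact: is_derive_line.
have [h0|h0] := leP 0 h.
  have := mean_value_le h0 dl (M := M); rewrite scale0r add0r subr0 ger0_norm//.
  by apply=> s /andP[s0 sh]; apply: dM; rewrite !ger0_norm.
have := mean_value_le (ltW h0) dl (M := M); rewrite scale0r add0r sub0r distrC ltr0_norm//.
by apply=> s /andP[hs s0]; apply: dM; rewrite (ltr0_norm h0) (ler0_norm s0) lerN2.
Qed.

Lemma sequential_dnbhs (V : normedModType R) (F : R -> V) (l : V) :
  (forall u : nat -> R, (forall k, u k != 0 /\ `|u k| <= 1) ->
    u k @[k --> \oo] --> (0 : R) -> F (u k) @[k --> \oo] --> l) ->
  F h @[h --> (0 : R)^'] --> l.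
Proof.
move=> H; apply/cvgrPdist_lt => e e0; apply: contrapT => nfe.
have [u uP] : exists u : nat -> R,
    forall k, [/\ u k != 0, `|u k| < k.+1%:R^-1 & ~ (`|l - F (u k)| < e)].
  suff E k : exists y : R, [/\ y != 0, `|y| < k.+1%:R^-1 & ~ (`|l - F y| < e)].
    by exists (fun k => sval (cid (E k))) => k; exact: (svalP (cid (E k))).
  apply: contrapT => /forallNP hk; apply: nfe.
  near=> y; apply: contrapT => nfy; apply: (hk y); split=> //.
    by near: y; exact: nbhs_dnbhs_neq.
  near: y; apply/nbhs_dnbhs/nbhs_normP; exists k.+1%:R^-1; first by rewrite /= invr_gt0.
  by move=> y /=; rewrite sub0r normrN.
have u1 k : u k != 0 /\ `|u k| <= 1.
  have [u0 uk _] := uP k; split=> //; rewrite (le_trans (ltW uk))//.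
  by rewrite invf_le1// ler1n.
have u0 : u k @[k --> \oo] --> (0 : R).
  apply/cvgrPdist_lt => d d0; near=> k; rewrite sub0r normrN.
  have [_ uk _] := uP k; rewrite (lt_trans uk)//.
  near: k; exact: near_infty_natSinv_lt (PosNum d0).
have /cvgrPdist_lt/(_ e e0) [N _ /(_ _ (leqnn N))] := H u u1 u0.
by have [] := uP N.
Unshelve. all: by end_near. Qed.

Lemma dnbhs_sequence (V : normedModType R) (F : R -> V) (l : V) (u : nat -> R) :
  F h @[h --> (0 : R)^'] --> l -> (forall k, u k != 0) -> u k @[k --> \oo] --> (0 : R) ->
  F (u k) @[k --> \oo] --> l.
Proof.
move=> Fl un u0; apply/cvgrPdist_lt => e e0.
have /cvgrPdist_lt/(_ e e0) := Fl; rewrite near_withinE => /nbhs_normP[d /= d0 dF].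
move/cvgrPdist_lt : u0 => /(_ _ d0); apply: filterS => k kd.
exact: (dF _ kd (un k)).
Qed.

End DirectionalDerivative.

Section DerivativeUnderIntegral.
Context {R : realType} {W : normedModType R} {V : completeNormedModType R} {p : nat}.

(** Dominated convergence for difference quotients along a sequence of increments of size at most 1;
    the mean value inequality bounds the quotients by the bound on [g] along the segment. *)
Lemma is_derive_integral (f g : W -> 'cV[R]_p -> V) (x v : W) (C : R) :
  (forall x y, is_derive x v (f^~ y) (g x y)) ->
  (forall x, exists D, dominated D (f x)) -> continuous (g x) ->
  (forall s, `|s| <= 1 -> forall y, `|g (s *: v + x) y| <= C * weight y) ->
  is_derive x v (fun x => integral_Rn (f x)) (integral_Rn (g x)).
Proof.
move=> dF domf cg gC; apply/is_deriveP; apply: sequential_dnbhs => u u1 u0.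
have un k : u k != 0 by have [] := u1 k.
have -> : (fun k => (u k)^-1 *: (integral_Rn (f (u k *: v + x)) - integral_Rn (f x))) =
   (fun k => integral_Rn (fun y => (u k)^-1 *: (f (u k *: v + x) y - f x y))).
  apply/funext => k; rewrite integral_RnZ ?invr_eq0//; congr (_ *: _).
  have [D1 d1] := domf (u k *: v + x); have [D2 d2] := domf x.
  have d2' : dominated D2 (fun y => - 1 *: f x y).
    split; first by apply: continuous_scale => //; [exact: cst_continuous|case: d2].
    by move=> y; rewrite scaleN1r normrN; case: d2.
  under [in RHS]eq_fun do rewrite -scaleN1r.
  by rewrite (integral_RnD d1 d2') integral_RnZ ?scaleN1r//.
apply: (@integral_Rn_dct _ _ _ _ _ C) => //.
  move=> k; split.
    apply: continuous_scale; first exact: cst_continuous.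
    apply: continuous_sub; [case: (domf (u k *: v + x)) => ? []|case: (domf x) => ? []] => //.
  move=> y; rewrite normrZ normfV ler_pdivrMl ?normr_gt0// mulrC.
  apply: directional_mean_value => // s su; apply: gC.
  by rewrite (le_trans su)//; have [] := u1 k.
move=> y; have /is_deriveP := dF x y; move=> /dnbhs_sequence; exact.
Qed.

End DerivativeUnderIntegral.

Section SmoothClasses.
Context {R : realType} {m : nat} {V : normedModType R}.
Implicit Types f g : 'cV[R]_m -> V.

Notation delta i := (delta_mx i 0 : 'cV[R]_m).

Lemma pderiv_cat (s t : seq 'I_m) f : pderiv (s ++ t) f = pderiv s (pderiv t f).
Proof. exact: foldr_cat. Qed.

Lemma smooth_pderiv (t : seq 'I_m) f : smooth f -> smooth (pderiv t f).
Proof. by move=> sf s; rewrite -pderiv_cat; exact: sf. Qed.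

Lemma smooth_is_derive f i x : smooth f -> is_derive x (delta i) f (pderiv [:: i] f x).
Proof. by move=> sf; apply: DeriveDef => //; exact: (sf [::]).2. Qed.

Lemma smooth_continuous f : smooth f -> continuous f.
Proof. by move=> sf; exact: (sf [::]).1. Qed.

Lemma pderiv1 f g i : (forall x, is_derive x (delta i) f (g x)) -> pderiv [:: i] f = g.
Proof. by move=> dF; apply/funext => x; case: (dF x). Qed.

(** Smoothness from a stable class: if all members are continuous and each partial derivative is
    again a member, no formula for iterated derivatives is needed. Families indexed by [I] allow [P]
    to carry bounds uniform in the index. *)
Lemma smooth_class (I : Type) (P : (I -> 'cV[R]_m -> V) -> Prop) :
  (forall F, P F -> (forall k, continuous (F k)) /\
     forall i, exists G, P G /\ forall k x, is_derive x (delta i) (F k) (G k x)) ->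
  forall F, P F -> (forall k, smooth (F k)) /\ forall s, P (fun k => pderiv s (F k)).
Proof.
move=> Pcl F PF.
have Ps s : P (fun k => pderiv s (F k)).
  elim: s => [//|i s IH]; have [_ /(_ i)[G [PG Gd]]] := Pcl _ IH.
  suff -> : (fun k => pderiv (i :: s) (F k)) = G by [].
  by apply/funext => k; exact: pderiv1 (Gd k).
split=> // k s; have [c d] := Pcl _ (Ps s); split; first exact: c.
by move=> i x; have [G [_ /(_ k x) []]] := d i.
Qed.

Definition rapid f := forall N : nat, exists M : R, forall x, (1 + `|x|) ^+ N * `|f x| <= M.

Lemma coord_le_norm (x : 'cV[R]_m) i : `|x i 0| <= `|x|.
Proof.
rewrite [`|x|]mx_normrE.
by apply: le_trans (le_bigmax _ (fun ij : 'I_m * 'I_1 => `|x ij.1 ij.2|) (i, 0)).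
Qed.

Lemma norm_coord (x : 'cV[R]_m) : x = 0 \/ exists i, `|x| = `|x i 0|.
Proof.
have [->|x0] := eqVneq x 0; [by left|right].
have [|[i j] h] := @mx_norm_neq0 R m 1 x.
  by apply/eqP => /mx_norm_eq0/eqP; rewrite (negbTE x0).
by exists i; rewrite -[LHS]/(mx_norm x) h /= (ord1 j).
Qed.

Lemma japanese_ge1 (x : 'cV[R]_m) : 1 <= 1 + `|x|.
Proof. by rewrite lerDl. Qed.

Lemma japanese_gt0 (x : 'cV[R]_m) : 0 < 1 + `|x|.
Proof. exact: lt_le_trans (japanese_ge1 x). Qed.

Lemma monomial_le (alpha : 'I_m -> nat) (x : 'cV[R]_m) :
  `|monomial alpha x| <= (1 + `|x|) ^+ (\sum_(i < m) alpha i).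
Proof.
rewrite /monomial normr_prod -prodrXr; apply: ler_prod => i _.
rewrite normr_ge0 /= normrX; apply: lerXn2r; rewrite ?nnegrE ?addr_ge0//.
by rewrite (le_trans (coord_le_norm x i))// lerDr.
Qed.

Lemma weight_inv_le (x : 'cV[R]_m) : (weight x)^-1 <= (1 + `|x|) ^+ (2 * m).
Proof.
rewrite /weight prodfV invrK.
rewrite -[X in (2 * X)%N]card_ord -sum1_card big_distrr/= -prodrXr.
apply: ler_prod => i _; rewrite oneDsqr_ge0/= muln1 /oneDsqr.
have := coord_le_norm x i; rewrite -[x i 0 ^+ 2]real_normK ?num_real//.
by have := normr_ge0 (x i 0); nra.
Qed.

(** The norm of a column is the largest absolute value of a coordinate. Hence the constant monomial
    settles norm at most 1, and the pure powers [x_j ^ N] settle larger norms; the factor [2 ^ N]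
    compares 1 plus the norm with the norm. *)
Lemma schwartzP f : schwartz f <-> smooth f /\ forall s, rapid (pderiv s f).
Proof.
split=> [[sf h]|[sf h]]; split=> //.
  move=> s N; pose al j := fun i : 'I_m => if i == j then N else 0%N.
  have alE j (x : 'cV[R]_m) : monomial (al j) x = x j 0 ^+ N.
    rewrite /monomial (bigD1 j)//= /al eqxx big1 ?mulr1// => i /negbTE ->.
    by rewrite expr0.
  have [M0 hM0] := h (fun=> 0%N) s.
  have [M hM] : exists M, forall j (x : 'cV[R]_m), `|x j 0 ^+ N *: pderiv s f x| <= M j.
    have E j : exists M, forall x : 'cV[R]_m, `|x j 0 ^+ N *: pderiv s f x| <= M.
      by have [M hM] := h (al j) s; exists M => x; rewrite -alE.
    by exists (fun j => sval (cid (E j))) => j; exact: (svalP (cid (E j))).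
  have M0' x : `|pderiv s f x| <= M0.
    have := hM0 x; rewrite /monomial big1 ?scale1r// => i _; exact: expr0.
  have M00 : 0 <= M0 by exact: le_trans (M0' 0).
  have M_0 j : 0 <= M j by exact: le_trans (hM j 0).
  exists (2 ^+ N * (M0 + \sum_j M j)) => x.
  have S0 : 0 <= \sum_j M j by exact: sumr_ge0.
  have [x1|x1] := leP `|x| 1.
    apply: ler_pM => //.
      by apply: lerXn2r; rewrite ?nnegrE ?addr_ge0//; lra.
    by rewrite (le_trans (M0' x))// lerDl.
  have [x0|[j xj]] := norm_coord x; first by move: x1; rewrite x0 normr0 ltr10.
  apply: (@le_trans _ _ (2 ^+ N * (`|x| ^+ N * `|pderiv s f x|))).
    rewrite mulrA -exprMn ler_wpM2r//; apply: lerXn2r; rewrite ?nnegrE ?addr_ge0 ?mulr_ge0//.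
    by lra.
  rewrite ler_wpM2l ?exprn_ge0// xj -normrX -normrZ (le_trans (hM j x))//.
  by rewrite (bigD1 j)//= addrCA lerDl addr_ge0// sumr_ge0.
move=> al s; have [M hM] := h s (\sum_(i < m) al i); exists M => x.
by rewrite normrZ (le_trans _ (hM x))// ler_wpM2r// monomial_le.
Qed.

Lemma rapid_dominated f : continuous f -> rapid f -> exists C, dominated C f.
Proof.
move=> cf /(_ (2 * m)) [M hM]; exists M; split=> // x.
rewrite -ler_pdivrMr ?weight_gt0// mulrC (le_trans _ (hM x))//.
by rewrite ler_wpM2r// weight_inv_le.
Qed.

Lemma schwartz_dominated f s : schwartz f -> exists C, dominated C (pderiv s f).
Proof. by move=> /schwartzP[sf rf]; apply: rapid_dominated => //; exact: (sf s).1. Qed.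

Lemma schwartz_smooth f : schwartz f -> smooth f.
Proof. by case. Qed.

Lemma schwartz_bounded f : schwartz f -> exists M, forall x, `|f x| <= M.
Proof.
move=> /(schwartz_dominated [::]) [C [_ h]]; exists C => x.
have C0 : 0 <= C by have := le_trans (normr_ge0 _) (h 0); rewrite pmulr_lge0 ?weight_gt0.
by rewrite (le_trans (h x))// ler_piMr// weight_le1.
Qed.

Lemma schwartz_pderiv f s : schwartz f -> schwartz (pderiv s f).
Proof.
move=> /schwartzP[sf rf]; apply/schwartzP; split; first exact: smooth_pderiv.
by move=> t; rewrite -pderiv_cat.
Qed.

Lemma rapidD f g : rapid f -> rapid g -> rapid (fun x => f x + g x).
Proof.
move=> rf rg N; have [M hM] := rf N; have [M' hM'] := rg N; exists (M + M') => x.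
by rewrite (le_trans _ (lerD (hM x) (hM' x)))// -mulrDr ler_wpM2l ?ler_normD.
Qed.

Lemma rapid_le (W : normedModType R) (f : 'cV[R]_m -> V) (g : 'cV[R]_m -> W) (C : R) d :
  0 <= C -> (forall x, `|g x| <= C * (1 + `|x|) ^+ d * `|f x|) ->
  (forall N : nat, exists M : R, forall x, (1 + `|x|) ^+ N * `|f x| <= M) ->
  forall N : nat, exists M : R, forall x, (1 + `|x|) ^+ N * `|g x| <= M.
Proof.
move=> C0 gf rf N; have [M hM] := rf (N + d)%N; exists (C * M) => x.
apply: (@le_trans _ _ ((1 + `|x|) ^+ N * (C * (1 + `|x|) ^+ d * `|f x|))).
  by rewrite ler_wpM2l// exprn_ge0// ltW// japanese_gt0.
rewrite -mulrA mulrCA ler_wpM2l//; have := hM x; rewrite exprD.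
by rewrite mulrA.
Qed.

End SmoothClasses.

Section AffineComposition.
Context {R : realType}.

(** Chain rule when [L] maps the line through [x] in direction [v] to a line in direction [w] with
    speed [c]. The case [c = 0] is separate because the increments [u k * c] must not vanish in a
    difference quotient. *)
Lemma is_derive_comp_line (W U V : normedModType R) (L : W -> U) (f : U -> V) (x v : W)
    (w : U) (c : R) (l : V) : (forall h, L (h *: v + x) = (h * c) *: w + L x) ->
  is_derive (L x) w f l -> is_derive x v (fun y => f (L y)) (c *: l).
Proof.
move=> Lx dF; apply/is_deriveP; apply: sequential_dnbhs => u u1 u0.
under eq_fun do rewrite Lx; have [->|c0] := eqVneq c 0.
  under eq_fun do rewrite mulr0 scale0r add0r subrr scaler0.
  by rewrite scale0r; exact: cvg_cst.
have uc0 : u k * c @[k --> \oo] --> (0 : R).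
  by rewrite -(mul0r c); apply: cvgM => //; exact: cvg_cst.
have /is_deriveP/dnbhs_sequence/(_ _ uc0) := dF.
have ucn k : u k * c != 0 by rewrite mulf_neq0//; have [] := u1 k.
move=> /(_ ucn) H.
have -> : (fun k => (u k)^-1 *: (f ((u k * c) *: w + L x) - f (L x))) =
    (fun k => c *: ((u k * c)^-1 *: (f ((u k * c) *: w + L x) - f (L x)))).
  by apply/funext => k; rewrite scalerA invfM mulrCA divff// mulr1.
by apply: cvgZ => //; exact: cvg_cst.
Qed.

Section Coordinates.
Context {m p : nat} {V : normedModType R} (L : 'cV[R]_m -> 'cV[R]_p) (sg : 'I_m -> 'I_p) (c : R).
Hypotheses (cL : continuous L) (Lcoord : forall h i x,
  L (h *: delta_mx i 0 + x) = (h * c) *: delta_mx (sg i) 0 + L x).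
Context (f : 'cV[R]_p -> V) (sf : smooth f).

Let is_derive_pderiv_comp (s : seq 'I_m) (k : R) i x :
  is_derive x (delta_mx i 0 : 'cV[R]_m) (fun y => k *: pderiv (map sg s) f (L y))
    ((k * c) *: pderiv (map sg (i :: s)) f (L x)).
Proof.
rewrite -scalerA; apply: (@is_deriveZ _ _ _ (fun y => pderiv (map sg s) f (L y))).
apply: is_derive_comp_line; first by move=> h; exact: Lcoord.
exact: smooth_is_derive (smooth_pderiv _ sf).
Qed.

(** Covers translations, dilations and the affine embeddings of R^n in R^2n along either block of
    coordinates: direction [i] goes to direction [sg i], always with the factor [c]. *)
Lemma pderiv_comp_coord (s : seq 'I_m) :
  pderiv s (fun x => f (L x)) = fun x => c ^+ size s *: pderiv (map sg s) f (L x).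
Proof.
elim: s => [|i s IH]; first by apply/funext => x; rewrite expr0 scale1r.
rewrite (pderiv_cat [:: i] s) IH; apply: pderiv1 => x.
by rewrite exprSr; exact: is_derive_pderiv_comp.
Qed.

Lemma smooth_comp_coord : smooth (fun x => f (L x)).
Proof.
move=> s; rewrite pderiv_comp_coord; split.
  apply: continuous_scale; first exact: cst_continuous.
  exact: continuous_comp_fun (sf _).1 cL.
by move=> i x; case: (is_derive_pderiv_comp s (c ^+ size s) i x).
Qed.
End Coordinates.

Lemma smooth_shift m (V : normedModType R) (f : 'cV[R]_m -> V) (b : 'cV[R]_m) :
  smooth f -> smooth (fun x => f (x + b)) /\
  forall s, pderiv s (fun x => f (x + b)) = fun x => pderiv s f (x + b).
Proof.
move=> sf; have Lc h (i : 'I_m) (x : 'cV[R]_m) :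
    h *: delta_mx i 0 + x + b = (h * 1) *: delta_mx (id i) 0 + (x + b).
  by rewrite mulr1 addrA.
have cL : continuous (fun x : 'cV[R]_m => x + b).
  by apply: continuous_add; [move=> x; exact: cvg_id|exact: continuous_mx_cst].
split; first exact: (@smooth_comp_coord m m V (fun x => x + b) id 1 cL Lc f sf).
move=> s; rewrite (@pderiv_comp_coord m m V (fun x => x + b) id 1 Lc f sf); apply/funext => x.
by rewrite expr1n scale1r map_id.
Qed.

Lemma schwartz_class m (V : normedModType R) (P : ('cV[R]_m -> V) -> Prop) :
  (forall f, P f -> [/\ continuous f, rapid f & forall i, exists g, P g /\
     forall x, is_derive x (delta_mx i 0 : 'cV[R]_m) f (g x)]) ->
  forall f, P f -> schwartz f.
Proof.
move=> Pcl f Pf; apply/schwartzP.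
have [|/(_ tt) sf Ps] := @smooth_class R m V unit (fun F => P (F tt)) _ (fun=> f) Pf.
  move=> F /Pcl[cF _ dF]; split=> [[]//|i].
  by have [g [Pg gd]] := dF i; exists (fun=> g); split=> // -[].
by split=> // s; have [] := Pcl _ (Ps s).
Qed.

Lemma schwartz_comp_bounded_linear m (V W : normedModType R) (L : V -> W) (K : R)
    (f : 'cV[R]_m -> V) : (forall (r : R) u w, L (r *: u + w) = r *: L u + L w) ->
  0 <= K -> (forall v, `|L v| <= K * `|v|) -> continuous L -> schwartz f ->
  schwartz (fun x => L (f x)).
Proof.
move=> linL K0 LK cL; move: f.
pose P (g : 'cV[R]_m -> W) := exists2 u, schwartz u & g = fun x => L (u x).
have cl : forall g, P g -> schwartz g.
  apply: (@schwartz_class m W P) => g [u su ->]; have [sm ru] := (schwartzP u).1 su; split.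
  - exact: continuous_comp_fun cL (smooth_continuous sm).
  - move=> N; have [M hM] := ru [::] N; exists (K * M) => x.
    by rewrite (le_trans _ (ler_wpM2l K0 (hM x)))// mulrCA ler_wpM2l.
  - move=> i; exists (fun x => L (pderiv [:: i] u x)); split.
      by exists (pderiv [:: i] u) => //; exact: schwartz_pderiv.
    by move=> x; apply: is_derive_linear => //; exact: smooth_is_derive.
by move=> f sf; apply: cl; exists f.
Qed.

Lemma schwartzD m (V : normedModType R) (f g : 'cV[R]_m -> V) :
  schwartz f -> schwartz g -> schwartz (fun x => f x + g x).
Proof.
pose P (h : 'cV[R]_m -> V) :=
  exists u v, [/\ schwartz u, schwartz v & h = fun x => u x + v x].
have cl : forall h, P h -> schwartz h.
  apply: (@schwartz_class m V P) => h [u [v [su sv ->]]].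
  have [smu ru] := (schwartzP u).1 su; have [smv rv] := (schwartzP v).1 sv; split.
  - by apply: continuous_add; exact: smooth_continuous.
  - exact: rapidD (ru [::]) (rv [::]).
  - move=> i; exists (fun x => pderiv [:: i] u x + pderiv [:: i] v x); split.
      by exists (pderiv [:: i] u), (pderiv [:: i] v); split=> //; exact: schwartz_pderiv.
    by move=> x; apply: is_deriveD; exact: smooth_is_derive.
by move=> sf sg; apply: cl; exists f, g.
Qed.

Lemma schwartzZ m (V : normedModType R) (k : R) (f : 'cV[R]_m -> V) :
  schwartz f -> schwartz (fun x => k *: f x).
Proof.
apply: (@schwartz_comp_bounded_linear m V V ( *:%R k) `|k|) => //.
- by move=> r u w; rewrite scalerDr !scalerA mulrC.
- by move=> v; rewrite normrZ.
- by apply: continuous_scale; [exact: cst_continuous|move=> v; exact: cvg_id].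
Qed.

Lemma is_derive_coord m (i j : 'I_m) (x : 'cV[R]_m) :
  is_derive x (delta_mx i 0 : 'cV[R]_m) (fun y => y j 0 : R^o) (i == j)%:R.
Proof.
apply/is_deriveP.
have E : (fun h : R => h^-1 *: ((h *: delta_mx i 0 + x) j 0 - x j 0 : R^o)) =
    (fun h => h^-1 * h * (i == j)%:R).
  apply/funext => h; rewrite !mxE eqxx andbT addrK -[LHS]/(_ * _) mulrA.
  by rewrite (eq_sym j).
rewrite E -[X in _ --> X]mul1r; apply: cvgM; last exact: cvg_cst.
have H : (fun _ : R => 1 : R) h @[h --> (0 : R)^'] --> (1 : R) by exact: cvg_cst.
apply: cvg_trans H; apply: near_eq_cvg.
near=> h; rewrite mulVf//; near: h; exact: nbhs_dnbhs_neq.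
Unshelve. all: by end_near. Qed.

(** The products [x_j u] alone are not stable under derivatives, as differentiating [x_j] leaves a
    term without this factor; the sums [x_j u + v] are. *)
Lemma schwartz_coordM m (V : normedModType R) (j : 'I_m) (f : 'cV[R]_m -> V) :
  schwartz f -> schwartz (fun x => x j 0 *: f x).
Proof.
pose P (h : 'cV[R]_m -> V) :=
  exists u v, [/\ schwartz u, schwartz v & h = fun x => x j 0 *: u x + v x].
have cl : forall h, P h -> schwartz h.
  apply: (@schwartz_class m V P) => h [u [v [su sv ->]]].
  have [smu ru] := (schwartzP u).1 su; have [smv rv] := (schwartzP v).1 sv; split.
  - apply: continuous_add; last exact: smooth_continuous.
    apply: continuous_scale; last exact: smooth_continuous.
    by apply: continuous_coord => x; exact: cvg_id.
  - apply: rapidD (rv [::]); apply: (@rapid_le _ _ _ _ u _ 1 1 ler01 _ (ru [::])) => x.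
    rewrite normrZ mul1r expr1 ler_wpM2r// (le_trans (coord_le_norm x j))//.
    by rewrite lerDr.
  - move=> i; exists (fun x : 'cV[R]_m => x j 0 *: pderiv [:: i] u x +
      ((i == j)%:R *: u x + pderiv [:: i] v x)); split.
      exists (pderiv [:: i] u), (fun x => (i == j)%:R *: u x + pderiv [:: i] v x).
      split=> //; first exact: schwartz_pderiv.
      by apply: schwartzD; [exact: schwartzZ|exact: schwartz_pderiv].
    move=> x; rewrite addrCA addrA; apply: is_deriveD; last exact: smooth_is_derive.
    apply: is_derive_scale; [exact: is_derive_coord|exact: smooth_is_derive].
have s0 : schwartz (fun _ : 'cV[R]_m => 0 : V).
  pose Q (h : 'cV[R]_m -> V) := h = (fun=> 0).
  have c0 : forall h, Q h -> schwartz h.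
    apply: (@schwartz_class m V Q) => h ->; split; first exact: cst_continuous.
      by move=> N; exists 0 => x; rewrite normr0 mulr0.
    by move=> i; exists (fun=> 0); split=> // x; exact: is_derive_cst.
  exact: c0.
by move=> sf; apply: cl; exists f, (fun=> 0); split=> //; apply/funext => x; rewrite addr0.
Qed.

Lemma schwartz_comp_coord m (V : normedModType R) (f : 'cV[R]_m -> V) (c : R) (b : 'cV[R]_m) :
  c != 0 -> schwartz f -> schwartz (fun x => f (c *: x + b)).
Proof.
move=> c0 /schwartzP[sf rf].
have Lc h (i : 'I_m) (x : 'cV[R]_m) :
    c *: (h *: delta_mx i 0 + x) + b = (h * c) *: delta_mx (id i) 0 + (c *: x + b).
  by rewrite scalerDr scalerA mulrC addrA.
have cL : continuous (fun x : 'cV[R]_m => c *: x + b).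
  apply: continuous_add; last exact: continuous_mx_cst.
  by apply: continuous_scale; [exact: cst_continuous|move=> x; exact: cvg_id].
apply/schwartzP; split.
  exact: (@smooth_comp_coord m m V (fun x => c *: x + b) id c cL Lc f sf).
move=> s N; rewrite (@pderiv_comp_coord m m V (fun x => c *: x + b) id c Lc f sf).
have [M hM] := rf (map id s) N.
(* Chosen so that 1 plus the norm of [x] is at most [K] times 1 plus the norm of [c x + b], from
   [x = c^-1 ((c x + b) - b)]. *)
pose K := (1 + `|c|^-1) * (1 + `|b|).
exists (`|c ^+ size s| * K ^+ N * M) => x.
have cn : 0 < `|c| by rewrite normr_gt0.
have K0 : 0 <= K by rewrite mulr_ge0 ?addr_ge0// invr_ge0.
have xK : 1 + `|x| <= K * (1 + `|c *: x + b|).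
  have h1 : `|x| <= `|c|^-1 * (`|c *: x + b| + `|b|).
    rewrite -[x in X in X <= _](scalerK c0) normrZ normfV ler_wpM2l ?invr_ge0//.
    by rewrite -{1}(addrK b (c *: x)) ler_normB.
  have i0 : 0 <= `|c|^-1 by rewrite invr_ge0.
  have := normr_ge0 b; have := normr_ge0 (c *: x + b); rewrite /K.
  move: h1 i0; set i := `|c|^-1; set B := `|b|; set X := `|c *: x + b| => h1 i0 X0 B0.
  have : 0 <= B * X by rewrite mulr_ge0.
  have : 0 <= i * B * X by rewrite !mulr_ge0.
  by nra.
rewrite normrZ mulrCA -!mulrA ler_wpM2l//.
apply: (@le_trans _ _ ((K * (1 + `|c *: x + b|)) ^+ N * `|pderiv (map id s) f (c *: x + b)|)).
  rewrite ler_wpM2r//; apply: lerXn2r => //; rewrite ?nnegrE ?addr_ge0//.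
  by rewrite mulr_ge0// addr_ge0.
by rewrite exprMn -mulrA ler_wpM2l// exprn_ge0.
Qed.

End AffineComposition.

Lemma dotDr (R : realType) m (x y z : 'cV[R]_m) : dot x (y + z) = dot x y + dot x z.
Proof. by rewrite /dot -big_split; apply: eq_bigr => i _; rewrite mxE mulrDr. Qed.

Lemma dotC (R : realType) m (x y : 'cV[R]_m) : dot x y = dot y x.
Proof. by apply: eq_bigr => i _; rewrite mulrC. Qed.

Lemma dotDl (R : realType) m (x y z : 'cV[R]_m) : dot (y + z) x = dot y x + dot z x.
Proof. by rewrite dotC dotDr !(dotC x). Qed.

Lemma dotZr (R : realType) m (k : R) (x y : 'cV[R]_m) : dot x (k *: y) = k * dot x y.
Proof. by rewrite /dot mulr_sumr; apply: eq_bigr => i _; rewrite mxE mulrCA. Qed.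

Lemma dotNr (R : realType) m (x y : 'cV[R]_m) : dot x (- y) = - dot x y.
Proof. by rewrite -scaleN1r dotZr mulN1r. Qed.

Lemma dotNl (R : realType) m (x y : 'cV[R]_m) : dot (- x) y = - dot x y.
Proof. by rewrite dotC dotNr dotC. Qed.

Lemma dot_delta (R : realType) m (x : 'cV[R]_m) i : dot x (delta_mx i 0) = x i 0.
Proof.
rewrite /dot (bigD1 i)//= mxE !eqxx mulr1 big1 ?addr0// => j /negbTE ij.
by rewrite mxE ij mulr0.
Qed.

Section Modulation.
Context {R : realType} {V : complexBanachType R} {m : nat}.
Implicit Types (z : 'cV[R]_m) (f : 'cV[R]_m -> V).

Definition modulate z f : 'cV[R]_m -> V := fun x => cscale (expi (dot z x)) (f x).

Lemma is_derive_modulate z f i x (l : V) :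
  is_derive x (delta_mx i 0 : 'cV[R]_m) f l ->
  is_derive x (delta_mx i 0 : 'cV[R]_m) (modulate z f)
    (cscale (expi (dot z x)) (z i 0 *: cscale 'i%C (f x) + l)).
Proof.
move=> dF.
have lin h : dot z (h *: delta_mx i 0 + x) = (h * z i 0) *: (1 : R^o) + dot z x.
  by rewrite dotDr dotZr dot_delta -[_ *: 1]/(_ * _) mulr1.
have dcos := is_derive_comp_line lin (is_derive_cos (dot z x)).
have dsin := is_derive_comp_line lin (is_derive_sin (dot z x)).
have linI (r : R) (u w : V) := cscale_linear 'i%C r u w.
have dI := is_derive_linear linI (continuous_cscale (z := 'i%C)) dF.
have -> : modulate z f = (fun y => cos (dot z y) *: f y) + (fun y => sin (dot z y) *: cscale 'i%C (f y)).
  by apply/funext => y; rewrite /modulate cscale_expiE.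
have := is_deriveD (is_derive_scale dcos dF) (is_derive_scale dsin dI).
congr is_derive; rewrite cscale_expiE cscaleDr cscale_scale cscaleA.
have -> : ('i * 'i)%C = (- 1)%:C%C :> R[i].
  by apply/eqP; rewrite eq_complex /= !(mulr0, mulr1, mul0r, subr0, addr0, add0r, sub0r) !eqxx.
rewrite cscale_real scaleN1r scalerN !scalerDr !scalerN !scalerA.
rewrite -[z i 0 *: sin _]/(_ * _) -[z i 0 *: cos _]/(_ * _) scaleNr ![z i 0 * _]mulrC.
by rewrite [LHS]addrACA [in RHS]addrACA; congr (_ + _); rewrite addrC.
Qed.

Lemma norm_modulate z f x : `|modulate z f x| = `|f x|.
Proof. exact: norm_cscale_expi. Qed.

Lemma continuous_modulate z f : continuous f -> continuous (modulate z f).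
Proof.
move=> cf; apply: continuous_cscale_expi => //; apply: continuous_dot.
  exact: continuous_mx_cst.
by move=> x; exact: cvg_id.
Qed.

Lemma schwartz_cscale (c : R[i]) f : schwartz f -> schwartz (fun x => cscale c (f x)).
Proof.
apply: (@schwartz_comp_bounded_linear _ _ _ _ (cscale c) (ComplexField.Normc.normc c)).
- by move=> r u v; exact: cscale_linear.
- by case: (c) => a b; exact: sqrtr_ge0.
- by move=> v; rewrite norm_cscale.
- exact: continuous_cscale.
Qed.

Lemma schwartz_modulate z f : schwartz f -> schwartz (modulate z f).
Proof.
pose P (h : 'cV[R]_m -> V) := exists2 u, schwartz u & h = modulate z u.
have cl : forall h, P h -> schwartz h.
  apply: (@schwartz_class _ m V P) => h [u su ->]; have [sm ru] := (schwartzP u).1 su; split.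
  - exact: continuous_modulate (smooth_continuous sm).
  - by move=> N; have [M hM] := ru [::] N; exists M => x; rewrite norm_modulate.
  - move=> i; exists (modulate z (fun x => z i 0 *: cscale 'i%C (u x) + pderiv [:: i] u x)); split.
      exists (fun x => z i 0 *: cscale 'i%C (u x) + pderiv [:: i] u x) => //.
      apply: schwartzD; last exact: schwartz_pderiv.
      exact: schwartzZ (schwartz_cscale _ _).
    by move=> x; apply: is_derive_modulate; exact: smooth_is_derive.
by move=> sf; apply: cl; exists f.
Qed.

Lemma dominated_modulate z f C : dominated C f -> dominated C (modulate z f).
Proof.
by move=> [cf fC]; split; [exact: continuous_modulate|move=> x; rewrite norm_modulate].
Qed.

End Modulation.

Section UniformFamilies.
Context {R : realType} {m : nat} {I : Type}.

(** The index gathers the parameters in which bounds have to be uniform; in the oscillatory integral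
    they are the scale of the cut-off and the outer variable. *)
Definition unif_bounded (V : normedModType R) (k : I -> 'cV[R]_m -> V) : Prop :=
  (forall j, smooth (k j)) /\ forall s, exists C, forall j x, `|pderiv s (k j) x| <= C.

Definition unif_dominated (V : normedModType R) (G : I -> 'cV[R]_m -> V) : Prop :=
  (forall j, smooth (G j)) /\
  forall s, exists C, forall j x, `|pderiv s (G j) x| <= C * weight x.

Lemma unif_bounded_pderiv (V : normedModType R) (k : I -> 'cV[R]_m -> V) t :
  unif_bounded k -> unif_bounded (fun j => pderiv t (k j)).
Proof.
move=> [sk bk]; split=> [j|s]; first exact: smooth_pderiv.
by have [C hC] := bk (s ++ t); exists C => j x; rewrite -pderiv_cat.
Qed.

Lemma unif_dominated_pderiv (V : normedModType R) (k : I -> 'cV[R]_m -> V) t :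
  unif_dominated k -> unif_dominated (fun j => pderiv t (k j)).
Proof.
move=> [sk bk]; split=> [j|s]; first exact: smooth_pderiv.
by have [C hC] := bk (s ++ t); exists C => j x; rewrite -pderiv_cat.
Qed.

(** Sums of products of a uniformly bounded scalar and a uniformly dominated function: stable under
    derivatives by the product rule, so that [smooth_class] replaces the binomial Leibniz
    formula. *)
Inductive leibniz_class (V : normedModType R) : (I -> 'cV[R]_m -> V) -> Prop :=
| leibniz_scale (k : I -> 'cV[R]_m -> R^o) (G : I -> 'cV[R]_m -> V) :
    unif_bounded k -> unif_dominated G -> leibniz_class (fun j x => k j x *: G j x)
| leibniz_add F G : leibniz_class F -> leibniz_class G ->
    leibniz_class (fun j x => F j x + G j x).

Lemma unif_dominated_leibniz (V : normedModType R) (F : I -> 'cV[R]_m -> V) :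
  leibniz_class F -> unif_dominated F.
Proof.
move=> LF; have bound G : leibniz_class G -> exists C, forall j x, `|G j x| <= C * weight x.
  elim=> {F LF G} [k G [_ /(_ [::])[C hC]] [_ /(_ [::])[D hD]]|F G _ [C hC] _ [D hD]].
    exists (C * D) => j x; rewrite normrZ -mulrA.
    by apply: ler_pM => //; [exact: hC|exact: hD].
  exists (C + D) => j x; rewrite mulrDl (le_trans (ler_normD _ _))//.
  by rewrite lerD.
have step G : leibniz_class G -> (forall j, continuous (G j)) /\
    forall i, exists G', leibniz_class G' /\
      forall j x, is_derive x (delta_mx i 0 : 'cV[R]_m) (G j) (G' j x).
  elim=> {F LF G} [k G bk dG|F G _ [cF dF] _ [cG dG]].
    split=> [j|i].
      by apply: continuous_scale; apply: smooth_continuous; [exact: bk.1|exact: dG.1].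
    exists (fun j x => pderiv [:: i] (k j) x *: G j x + k j x *: pderiv [:: i] (G j) x); split.
      apply: leibniz_add; apply: leibniz_scale => //.
        exact: (unif_bounded_pderiv [:: i] bk).
      exact: (unif_dominated_pderiv [:: i] dG).
    move=> j x; apply: is_derive_scale; apply: smooth_is_derive; [exact: bk.1|exact: dG.1].
  split=> [j|i]; first exact: continuous_add.
  have [F' [LF' hF]] := dF i; have [G' [LG' hG]] := dG i.
  exists (fun j x => F' j x + G' j x); split; first exact: leibniz_add.
  by move=> j x; exact: is_deriveD.
have [sF PF] := smooth_class (@step V) LF; split=> // s.
exact: bound _ _ (PF s).
Qed.

End UniformFamilies.

Lemma dominatedD (R : realType) (V : normedModType R) m (C D : R) (f g : 'cV[R]_m -> V) :
  dominated C f -> dominated D g -> dominated (C + D) (fun x => f x + g x).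
Proof.
move=> [cf fC] [cg gD]; split; first exact: continuous_add.
by move=> x; rewrite mulrDl (le_trans (ler_normD _ _))// lerD.
Qed.

Lemma dominatedZ (R : realType) (V : normedModType R) m (C k : R) (f : 'cV[R]_m -> V) :
  dominated C f -> dominated (`|k| * C) (fun x => k *: f x).
Proof.
move=> [cf fC]; split; first by apply: continuous_scale => //; exact: cst_continuous.
by move=> x; rewrite normrZ -mulrA ler_wpM2l.
Qed.

Lemma weight_shift_coord (R : realType) m (x : 'cV[R]_m) (i : 'I_m) (s : R) : `|s| <= 1 ->
  weight (s *: delta_mx i 0 + x) <= 3 * weight x.
Proof.
move=> s1; rewrite /weight (bigD1 i)//= [in leRHS](bigD1 i)//= mulrA.
have -> : \prod_(j < m | j != i) (oneDsqr ((s *: delta_mx i 0 + x) j 0))^-1 =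
    \prod_(j < m | j != i) (oneDsqr (x j 0))^-1.
  by apply: eq_bigr => j /negbTE ji; rewrite !mxE ji mulr0 add0r.
rewrite ler_wpM2r//; first by apply: prodr_ge0 => j _; rewrite invr_ge0 oneDsqr_ge0.
by apply: oneDsqr_near; rewrite !mxE !eqxx mulr1 addrK.
Qed.

(** * Oscillatory integrals and the deformed product *)

Section IntegrationByParts.
Context {R : realType} {m : nat}.

(* Translation invariance makes the difference quotients of f have integral zero. *)
Lemma integral_derive_eq0 (V : completeNormedModType R) (f g : 'cV[R]_m -> V) i C D :
  (forall x, is_derive x (delta_mx i 0 : 'cV[R]_m) f (g x)) ->
  dominated C f -> dominated D g -> integral_Rn g = 0.
Proof.
move=> dF fC gD; have D0 := dominated_ge0 gD; pose u k : R := k.+1%:R^-1.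
have un k : u k != 0 by rewrite invr_eq0.
have u0 : u k @[k --> \oo] --> (0 : R).
  apply/cvgrPdist_lt => d d0; near=> k; rewrite sub0r normrN gtr0_norm ?invr_gt0//.
  by near: k; exact: near_infty_natSinv_lt (PosNum d0).
pose q k x := (u k)^-1 *: (f (u k *: delta_mx i 0 + x) - f x).
have shiftd k : dominated (3 * C) (fun x => f (u k *: delta_mx i 0 + x)).
  split.
    apply: (continuous_comp_fun fC.1); apply: continuous_add; first exact: continuous_mx_cst.
    by move=> x; exact: cvg_id.
  move=> x; rewrite (le_trans (fC.2 _))// mulrAC [_ * C]mulrC ler_wpM2l//.
    exact: dominated_ge0 fC.
  by rewrite weight_shift_coord// ger0_norm ?invr_ge0// invf_le1// ler1n.
have q0 k : integral_Rn (q k) = 0.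
  rewrite /q integral_RnZ ?invr_eq0//.
  under eq_fun do rewrite -scaleN1r.
  rewrite (integral_RnD (shiftd k) (dominatedZ (-1) fC)) integral_RnZ ?oppr_eq0 ?oner_eq0//.
  under eq_fun do rewrite addrC.
  by rewrite integral_Rn_shift scaleN1r subrr scaler0.
have : integral_Rn (q k) @[k --> \oo] --> integral_Rn g.
  apply: (@integral_Rn_dct _ _ _ _ _ (3 * D)) => [k||x]; last 2 first.
  - exact: gD.1.
  - have /is_deriveP H := dF x; exact: dnbhs_sequence H un u0.
  split.
    apply: continuous_scale; first exact: cst_continuous.
    exact: continuous_sub (shiftd k).1 fC.1.
  move=> x; rewrite normrZ normfV ler_pdivrMl ?normr_gt0// mulrC.
  apply: directional_mean_value => // s su.
  rewrite (le_trans (gD.2 _))// mulrAC [_ * D]mulrC ler_wpM2l// weight_shift_coord//.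
  by rewrite (le_trans su)// ger0_norm ?invr_ge0// invf_le1// ler1n.
under eq_fun do rewrite q0.
by move=> /(cvg_unique _ (cvg_cst 0)) <-.
Unshelve. all: by end_near. Qed.

Context {V : complexBanachType R}.

(** Integration by parts: the derivative of [modulate u G] has integral zero and is the sum of the
    terms on the two sides. *)
Lemma integral_modulate_pderiv (G : 'cV[R]_m -> V) (u : 'cV[R]_m) i C D :
  smooth G -> dominated C G -> dominated D (pderiv [:: i] G) ->
  integral_Rn (modulate u (pderiv [:: i] G)) =
  - (u i 0 *: cscale 'i%C (integral_Rn (modulate u G))).
Proof.
move=> sG GC GD.
have lin (r : R) (v w : V) := cscale_linear (0 +i* u i 0)%C r v w.
have LE (v : V) : cscale (0 +i* u i 0)%C v = u i 0 *: cscale 'i%C v.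
  rewrite -cscale_real cscaleA; congr cscale.
  by apply/eqP; rewrite eq_complex /= mulr0 mul0r subr0 mulr1 mul0r addr0 !eqxx.
have bnd (v : V) : `|cscale (0 +i* u i 0)%C v| <= `|u i 0| * `|v|.
  by rewrite LE normrZ norm_cscale /= expr0n expr1n /= add0r sqrtr1 mul1r.
have dA := dominated_map lin bnd (normr_ge0 _) (dominated_modulate u GC).
have dB := dominated_modulate u GD.
have E : (fun x => cscale (expi (dot u x)) (u i 0 *: cscale 'i%C (G x) + pderiv [:: i] G x)) =
   (fun x => cscale (0 +i* u i 0)%C (modulate u G x) + modulate u (pderiv [:: i] G) x).
  by apply/funext => x; rewrite cscaleDr -LE /modulate !cscaleA mulrC.
have dF x := is_derive_modulate u (smooth_is_derive i x sG).
have := integral_derive_eq0 dF (dominated_modulate u GC).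
rewrite E => /(_ _ (dominatedD dA dB)).
rewrite (integral_RnD dA dB) (integral_Rn_map lin bnd (dominated_modulate u GC)) LE.
by move=> /eqP; rewrite addrC addr_eq0 => /eqP.
Qed.

Lemma unif_dominated_member (I : Type) (G : I -> 'cV[R]_m -> V) s : unif_dominated G ->
  exists C, forall j, dominated C (pderiv s (G j)).
Proof.
move=> [sG /(_ s)[C hC]]; exists C => j; split; first exact: (sG j s).1.
exact: hC.
Qed.

(** Replacing [G] by [G - d_i^2 G] multiplies its transform by [1 + u_i^2]. Doing so once for each
    coordinate gives exactly the decay [weight u]; since [G] changes at every step, the induction on
    the list of coordinates quantifies over [G]. *)
Lemma unif_dominated_decay (I : Type) (G : I -> 'cV[R]_m -> V) : unif_dominated G ->
  exists C, forall j u, `|integral_Rn (modulate u (G j))| <= C * weight u.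
Proof.
suff H (js : seq 'I_m) : forall G : I -> 'cV[R]_m -> V, unif_dominated G ->
    exists C, forall j (u : 'cV[R]_m),
      \prod_(i <- js) oneDsqr (u i 0) * `|integral_Rn (modulate u (G j))| <= C.
  move=> dG; have [C hC] := H (index_enum 'I_m) _ dG; exists C => j u.
  rewrite /weight prodfV ler_pdivlMr 1?mulrC; last by apply: prodr_gt0 => i _; exact: oneDsqr_gt0.
  exact: hC.
elim: js => [|i js IH] {}G dG.
  have [C hC] := unif_dominated_member [::] dG.
  exists (C * wint R ^+ m) => j u; rewrite big_nil mul1r.
  exact: integral_Rn_norm_le (dominated_modulate u (hC j)).
have cst_ub (c : R) : unif_bounded (fun (_ : I) (_ : 'cV[R]_m) => c : R^o).
  have E s : exists k : R, pderiv s (fun _ : 'cV[R]_m => c : R^o) = fun=> k.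
    elim: s => [|l s [k IHs]]; first by exists c.
    by exists 0; rewrite (pderiv_cat [:: l] s) IHs; apply: pderiv1 => x; exact: is_derive_cst.
  split=> [_ s|s]; have [k ->] := E s; last by exists `|k| => _ _.
  split; first exact: cst_continuous.
  by move=> l x; exact: derivable_cst.
pose G' j x := (1 : R^o) *: G j x + (-1 : R^o) *: pderiv [:: i; i] (G j) x.
have dG' : unif_dominated G'.
  apply: unif_dominated_leibniz; apply: leibniz_add.
    exact: (leibniz_scale (cst_ub 1) dG).
  exact: (leibniz_scale (cst_ub (-1)) (unif_dominated_pderiv [:: i; i] dG)).
have [C hC] := IH _ dG'; exists C => j u; rewrite big_cons mulrAC mulrC.
have [C0 d0] := unif_dominated_member [::] dG.
have [C1 d1] := unif_dominated_member [:: i] dG.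
have [C2 d2] := unif_dominated_member [:: i; i] dG.
have sG := dG.1 j.
have sum_eq : integral_Rn (modulate u (G' j)) = oneDsqr (u i 0) *: integral_Rn (modulate u (G j)).
  have -> : modulate u (G' j) =
      (fun x => modulate u (G j) x + (-1) *: modulate u (pderiv [:: i; i] (G j)) x).
    by apply/funext => x; rewrite /modulate /G' scale1r cscaleDr cscale_scale.
  rewrite (integral_RnD (dominated_modulate u (d0 j)) (dominatedZ (-1) (dominated_modulate u (d2 j)))).
  rewrite integral_RnZ ?oppr_eq0 ?oner_eq0//.
  rewrite (integral_modulate_pderiv u (smooth_pderiv [:: i] sG) (d1 j) (d2 j)).
  rewrite (integral_modulate_pderiv u sG (d0 j) (d1 j)).
  rewrite scaleN1r opprK cscalerN cscale_scale cscaleA.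
  have -> : ('i * 'i)%C = (- 1)%:C%C :> R[i].
    by apply/eqP; rewrite eq_complex /= !(mulr0, mulr1, mul0r, subr0, addr0, add0r, sub0r) !eqxx.
  by rewrite cscale_real scaleN1r !scalerN opprK scalerA /oneDsqr scalerDl scale1r expr2.
by have := hC j u; rewrite sum_eq normrZ [`|oneDsqr _|]ger0_norm ?oneDsqr_ge0// mulrCA mulrC [in X in X -> _]mulrC.
Qed.

End IntegrationByParts.

Section BarIntegral.
Context {R : realType} {V : completeNormedModType R} {m : nat}.
Implicit Types f g : 'cV[R]_m -> V.

Lemma bar_constant_neq0 : Num.sqrt (2 * pi) ^- m != 0 :> R.
Proof. by rewrite invr_eq0 expf_neq0// gt_eqF// sqrtr_gt0 mulr_gt0// pi_gt0. Qed.

Lemma integral_bar_shift f (b : 'cV[R]_m) :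
  integral_bar (fun x => f (x + b)) = integral_bar f.
Proof. by rewrite /integral_bar integral_Rn_shift. Qed.

Lemma integral_bar_opp f : integral_bar (fun x => f (- x)) = integral_bar f.
Proof. by rewrite /integral_bar integral_Rn_opp. Qed.

Lemma integral_bar_dct (f_ : nat -> 'cV[R]_m -> V) f C :
  (forall k, dominated C (f_ k)) -> continuous f ->
  (forall x, f_ k x @[k --> \oo] --> f x) ->
  integral_bar (f_ k) @[k --> \oo] --> integral_bar f.
Proof.
move=> fC cf ff; apply: cvgZ; first exact: cvg_cst.
exact: integral_Rn_dct fC cf ff.
Qed.

Lemma integral_bar_continuous (T : pseudoMetricType R) (f : T -> 'cV[R]_m -> V) C :
  (forall x, dominated C (f x)) -> (forall y, continuous (f^~ y)) ->
  continuous (fun x => integral_bar (f x)).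
Proof.
move=> fC cf; apply: continuous_scale; first exact: cst_continuous.
by move=> x; apply: (@integral_Rn_continuous _ _ _ _ _ C) => // y; exact: cf.
Qed.

End BarIntegral.

Section OscillatoryIntegral.
Context {R : realType} {A : cstarAlgType R} {n : nat}.

Lemma fourier_modulate (G : 'cV[R]_n -> A) xi :
  fourier G xi = integral_bar (modulate (- xi) G).
Proof.
by congr integral_bar; apply/funext => y; rewrite /modulate dotNl dotC.
Qed.

Lemma integral_bar_cscale_expi (G : 'cV[R]_n -> A) C t : dominated C G ->
  integral_bar (fun y => cscale (expi t) (G y)) = cscale (expi t) (integral_bar G).
Proof.
apply: (@integral_bar_map _ _ _ _ 1); first by move=> r u v; exact: cscale_linear.
by move=> v; rewrite norm_cscale_expi mul1r.
Qed.

Lemma fourier_shift (G : 'cV[R]_n -> A) C x xi : dominated C G ->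
  integral_bar (modulate (- xi) (fun v => G (x + v))) = cscale (expi (dot x xi)) (fourier G xi).
Proof.
move=> GC; rewrite -(integral_bar_shift _ (- x)) fourier_modulate.
rewrite -(integral_bar_cscale_expi _ (dominated_modulate (- xi) GC)).
congr integral_bar; apply/funext => y; rewrite /modulate [x + _]addrC subrK.
rewrite dotDr dotNr !dotNl opprK addrC cscale_expiD.
by rewrite (dotC xi x).
Qed.

(** As [F] is only bounded, decay in [u] must come from the inner integral over [v], a Fourier
    integral of [chi (e u, e v) G (x + v)]. Integration by parts in [v] bounds it by a multiple of
    [weight u] uniformly in [e], so dominated convergence applies first to the outer and then to the
    inner integral. *)
Lemma is_osc_integral_product (J : 'M[R]_n) (F G : 'cV[R]_n -> A) (x : 'cV[R]_n) (K : R) :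
  continuous F -> (forall y, `|F y| <= K) -> schwartz G ->
  is_osc_integral (fun u v => amul (F (x + J *m u)) (G (x + v)))
    (integral_bar (fun xi => cscale (expi (dot x xi)) (amul (F (x - J *m xi)) (fourier G xi)))).
Proof.
move=> cF FK sG chi schi chi0; have K0 : 0 <= K := le_trans (normr_ge0 _) (FK 0).
have [chi_smooth chi_rapid] := (schwartzP chi).1 schi.
have [CG domG] := schwartz_dominated [::] sG.
(* Each derivative of the cut-off in [v] brings out a factor [e <= 1], hence bounds uniform over all
   pairs [(e, u)]. *)
pose I := ({e : R | 0 < e <= 1} * 'cV[R]_n)%type.
pose k (j : I) : 'cV[R]_n -> R^o := fun v => chi (col_mx (sval j.1 *: j.2) (sval j.1 *: v)).
have Lc (j : I) h (i : 'I_n) (v : 'cV[R]_n) :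
    col_mx (sval j.1 *: j.2) (sval j.1 *: (h *: delta_mx i 0 + v)) =
    (h * sval j.1) *: delta_mx (rshift n i) 0 + col_mx (sval j.1 *: j.2) (sval j.1 *: v).
  apply/colP => l; rewrite !mxE; case: (split_ordP l) => l' ->.
    by rewrite !mxE eq_lrshift mulr0 add0r.
  by rewrite !mxE eq_rshift mulrDr mulrA [sval j.1 * h]mulrC.
have cL (j : I) : continuous (fun v : 'cV[R]_n => col_mx (sval j.1 *: j.2) (sval j.1 *: v)).
  apply: continuous_col_mx; first exact: continuous_mx_cst.
  by apply: continuous_scale; [exact: cst_continuous|move=> v; exact: cvg_id].
have ub : unif_bounded k.
  split=> [j|s].
    exact: (@smooth_comp_coord _ n (n + n) _ _ (@rshift n n) (sval j.1) (cL j) (Lc j) chi chi_smooth).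
  have [M hM] := schwartz_bounded (schwartz_pderiv (map (@rshift n n) s) schi).
  exists M => j v.
  rewrite (@pderiv_comp_coord _ n (n + n) _ _ (@rshift n n) (sval j.1) (Lc j) chi chi_smooth).
  have /andP[e0 e1] := svalP j.1.
  rewrite normrZ (le_trans _ (hM (col_mx (sval j.1 *: j.2) (sval j.1 *: v))))// ler_piMl//.
  by rewrite normrX exprn_ile1// gtr0_norm.
have sGx : schwartz (fun v => G (x + v)).
  have := schwartz_comp_coord x (oner_neq0 R) sG.
  by under eq_fun do rewrite scale1r addrC.
have ud : unif_dominated (fun _ : I => fun v => G (x + v)).
  split=> [_|s]; first exact: schwartz_smooth.
  have [C [_ hC]] := schwartz_dominated s sGx.
  by exists C => _.
pose Gf (j : I) v := k j v *: G (x + v).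
have udG : unif_dominated Gf by apply: unif_dominated_leibniz; exact: leibniz_scale.
have [C0 dom0] := unif_dominated_member [::] udG.
have [C1 dec1] := unif_dominated_decay udG.
have [Cx domx] := schwartz_dominated [::] sGx.
pose c := Num.sqrt (2 * pi) ^- n : R.
have c0 : 0 <= c by rewrite invr_ge0 exprn_ge0// sqrtr_ge0.
pose Phi u := amul (F (x + J *m u)) (integral_bar (modulate u (fun v => G (x + v)))).
have cFJ : continuous (fun u : 'cV[R]_n => F (x + J *m u)).
  apply: (continuous_comp_fun cF); apply: continuous_add; first exact: continuous_mx_cst.
  by apply: continuous_mulmxr => u; exact: cvg_id.
have cmod (H : 'cV[R]_n -> 'cV[R]_n -> A) v : continuous (H^~ v) ->
    continuous (fun u => modulate u (H u) v).
  move=> cH; apply: continuous_cscale_expi => //; apply: continuous_dot.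
    by move=> u; exact: cvg_id.
  exact: continuous_mx_cst.
have cPhi : continuous Phi.
  apply: continuous_amul => //; apply: (@integral_bar_continuous _ _ _ _ _ Cx).
    by move=> u; exact: dominated_modulate domx.
  move=> v; apply: (cmod (fun=> fun v => G (x + v))); exact: cst_continuous.
(* The substitution [u = - xi] produces the Fourier transform and [x - J xi]; translating [v] by [x]
   produces the phase. *)
have Phi_eq : integral_bar Phi = integral_bar (fun xi =>
    cscale (expi (dot x xi)) (amul (F (x - J *m xi)) (fourier G xi))).
  rewrite -integral_bar_opp; congr integral_bar; apply/funext => xi.
  by rewrite /Phi (fourier_shift x xi domG) mulmxN amulZr.
rewrite -Phi_eq; apply: sequential_at_right => e e01 e0.
pose j0 k0 u : I := (exist _ (e k0) (e01 k0), u).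
have inner k0 u : integral_bar (fun v => cscale (expi (dot u v))
    (chi (col_mx (e k0 *: u) (e k0 *: v)) *: amul (F (x + J *m u)) (G (x + v)))) =
    amul (F (x + J *m u)) (integral_bar (modulate u (Gf (j0 k0 u)))).
  rewrite -(@integral_bar_map _ _ _ _ `|F (x + J *m u)| _ _ _ _ _ (dominated_modulate u (dom0 (j0 k0 u)))).
  - by congr integral_bar; apply/funext => v; rewrite /modulate amulZr amulZrr.
  - by move=> r a b; exact: amul_linearr.
  - by move=> a; exact: norm_amul.
under eq_fun do under eq_fun do rewrite inner.
apply: (@integral_bar_dct _ _ _ _ _ (K * (c * C1))) => //.
  move=> k0; split.
    apply: continuous_amul => //; apply: (@integral_bar_continuous _ _ _ _ _ C0).
      by move=> u; exact: dominated_modulate (dom0 (j0 k0 u)).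
    move=> v; apply: cmod; apply: continuous_scale; last exact: cst_continuous.
    have cc : continuous (fun u : 'cV[R]_n => col_mx (e k0 *: u) (e k0 *: v)).
      apply: continuous_col_mx; last exact: continuous_mx_cst.
      by apply: continuous_scale; [exact: cst_continuous|move=> u; exact: cvg_id].
    exact: (continuous_comp_fun (smooth_continuous chi_smooth) cc).
  move=> u; rewrite (le_trans (norm_amul _ _))// -mulrA; apply: ler_pM => //.
  by rewrite normrZ ger0_norm// -mulrA ler_wpM2l.
move=> u; apply: cvg_amul; first exact: cvg_cst.
apply: (@integral_bar_dct _ _ _ _ _ C0).
- by move=> k0; exact: dominated_modulate (dom0 (j0 k0 u)).
- exact: continuous_modulate domx.1.
move=> v; apply: cvg_cscale_expi; first exact: cvg_cst.
rewrite -[X in _ --> X]scale1r -chi0; apply: cvgZ; last exact: cvg_cst.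
have h0 : col_mx (e k0 *: u) (e k0 *: v) @[k0 --> \oo] --> (0 : 'cV[R]_(n + n)).
  have -> : 0 = col_mx (0 *: u) (0 *: v) by rewrite !scale0r col_mx0.
  by apply: cvg_col_mx; apply: cvgZ => //; exact: cvg_cst.
have cchi : {for (0 : 'cV[R]_(n + n)), continuous chi} by exact: (smooth_continuous chi_smooth).
exact: (cvg_comp _ chi h0 cchi).
Qed.

End OscillatoryIntegral.

(** * Gaussians as Schwartz functions and as cut-offs *)

Section Gaussian.
Context {R : realType} {m : nat}.

Definition gaussian (x : 'cV[R]_m) : R := \prod_(i < m) gauss_fun (x i 0).

Lemma gaussian_gt0 x : 0 < gaussian x.
Proof. by apply: prodr_gt0 => i _; exact: expR_gt0. Qed.

Lemma gaussian0 : gaussian 0 = 1.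
Proof. by rewrite /gaussian big1// => i _; rewrite mxE /gauss_fun expr0n oppr0 expR0. Qed.

Lemma gaussianN x : gaussian (- x) = gaussian x.
Proof. by apply: eq_bigr => i _; rewrite mxE /gauss_fun sqrrN. Qed.

Lemma gaussian_le_coord x i : gaussian x <= gauss_fun (x i 0).
Proof.
rewrite /gaussian (bigD1 i)//= ler_piMr ?gauss_fun_ge0//.
by apply: prodr_ile1 => j _; rewrite gauss_fun_ge0 gauss_fun_le1.
Qed.

Lemma gaussian_le1 x : gaussian x <= 1.
Proof. by apply: prodr_ile1 => j _; rewrite gauss_fun_ge0 gauss_fun_le1. Qed.

(** From [1 + r <= (N+1) exp (r/(N+1))] the left side is at most [(N+1)^N exp (r - r^2)], and
    [r - r^2 <= 1]. The denominator [N+1] instead of [N] includes [N = 0]. *)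
Lemma gauss_fun_decay (N : nat) (r : R) : 0 <= r ->
  (1 + r) ^+ N * gauss_fun r <= N.+1%:R ^+ N * expR 1.
Proof.
move=> r0; have h : 1 + r <= N.+1%:R * expR (r / N.+1%:R).
  apply: (@le_trans _ _ (N.+1%:R * (1 + r / N.+1%:R))).
    rewrite mulrDr mulr1 mulrCA divff// mulr1 lerD2r ler1n//.
  by rewrite ler_wpM2l// expR_ge1Dx.
apply: (@le_trans _ _ ((N.+1%:R * expR (r / N.+1%:R)) ^+ N * gauss_fun r)).
  rewrite ler_wpM2r ?gauss_fun_ge0//; apply: lerXn2r => //; rewrite nnegrE ?addr_ge0// mulr_ge0 ?expR_ge0.
rewrite exprMn -mulrA ler_wpM2l ?exprn_ge0// /gauss_fun -expRM_natl -expRD ler_expR.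
have : r / N.+1%:R *+ N <= r.
  rewrite -[leLHS]mulr_natl mulrCA -[leRHS]mulr1 ler_wpM2l//.
  by rewrite ler_pdivrMr// mul1r ler_nat.
have : 0 <= (r - 1) ^+ 2 by rewrite sqr_ge0.
rewrite -mulr_natl; move: (N%:R * _) => y; rewrite sqrrB1; lra.
Qed.

Lemma rapid_gaussian : rapid (fun x => gaussian x : R^o).
Proof.
move=> N; exists (1 + N.+1%:R ^+ N * expR 1) => x.
rewrite ger0_norm; last exact/ltW/gaussian_gt0.
have [->|[i ->]] := norm_coord x.
  by rewrite normr0 addr0 expr1n mul1r (le_trans (gaussian_le1 _))// lerDl mulr_ge0 ?exprn_ge0 ?expR_ge0.
rewrite (le_trans (y := (1 + `|x i 0|) ^+ N * gauss_fun `|x i 0|))//.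
  rewrite ler_wpM2l ?exprn_ge0 ?addr_ge0// (le_trans (gaussian_le_coord x i))//.
  by rewrite /gauss_fun real_normK// num_real.
by rewrite (le_trans (gauss_fun_decay N (normr_ge0 _)))// lerDr.
Qed.

Lemma is_derive_gauss_fun (t : R) : is_derive t (1 : R) (gauss_fun : R^o -> R^o) (- (2 * t * gauss_fun t)).
Proof.
have d2 : is_derive t (1 : R) ((fun s : R => - s ^+ 2) : R^o -> R^o) (- (2 * t)).
  by apply: is_derive_eq; rewrite -[X in - X = _]/(t * 1 + t * 1) mulr1 -mulr2n mulr_natl.
have := @is_derive1_comp R expR (fun s : R => - s ^+ 2) t _ _ (is_derive_expR (- t ^+ 2)) d2.
by rewrite mulrN mulrC.
Qed.

Lemma is_derive_gaussian (x : 'cV[R]_m) i :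
  is_derive x (delta_mx i 0 : 'cV[R]_m) (fun y => gaussian y : R^o) (- (2 * x i 0 * gaussian x)).
Proof.
pose rest (y : 'cV[R]_m) : R^o := \prod_(j < m | j != i) gauss_fun (y j 0).
have gE : (fun y => gaussian y : R^o) = (fun y : 'cV[R]_m => gauss_fun (y i 0) *: rest y).
  by apply/funext => y; rewrite /gaussian (bigD1 i).
have dr : is_derive x (delta_mx i 0 : 'cV[R]_m) rest 0.
  apply/is_deriveP.
  have -> : (fun h : R => h^-1 *: (rest (h *: delta_mx i 0 + x) - rest x)) = fun=> 0.
    apply/funext => h; suff -> : rest (h *: delta_mx i 0 + x) = rest x by rewrite subrr scaler0.
    by apply: eq_bigr => j /negbTE ji; rewrite !mxE ji mulr0 add0r.
  exact: cvg_cst.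
have lin h : (h *: delta_mx i 0 + x : 'cV[R]_m) i 0 = (h * 1) *: (1 : R^o) + x i 0.
  by rewrite !mxE !eqxx !mulr1 -[_ *: 1]/(_ * _) mulr1.
have dg := is_derive_comp_line (L := fun y : 'cV[R]_m => y i 0 : R^o) lin (is_derive_gauss_fun (x i 0)).
rewrite gE; have := is_derive_scale dg dr.
congr is_derive; rewrite scaler0 addr0 scale1r -[LHS]/(_ * _) mulNr.
by rewrite [gaussian x](congr1 (fun F => F x) gE) /= -[gauss_fun _ *: _]/(_ * _) mulrA.
Qed.

(** Polynomials times the Gaussian are the class stable under derivatives that shows the Gaussian to
    be Schwartz. *)
Inductive polynomial_fun : ('cV[R]_m -> R^o) -> Prop :=
| polynomial_cst (c : R) : polynomial_fun (fun=> c)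
| polynomial_coord i : polynomial_fun (fun x => x i 0)
| polynomial_add p q : polynomial_fun p -> polynomial_fun q ->
    polynomial_fun (fun x => p x + q x)
| polynomial_mul p q : polynomial_fun p -> polynomial_fun q ->
    polynomial_fun (fun x => p x *: q x).

Lemma polynomial_fun_derive p i : polynomial_fun p -> exists2 q, polynomial_fun q &
  forall x, is_derive x (delta_mx i 0 : 'cV[R]_m) p (q x).
Proof.
elim=> {p} [c|j|p q _ [p' pp' dp] _ [q' pq' dq]|p q pp [p' pp' dp] pq [q' pq' dq]].
- exists (fun=> 0); first exact: polynomial_cst.
  by move=> x; exact: is_derive_cst.
- exists (fun=> (i == j)%:R); first exact: polynomial_cst.
  by move=> x; exact: is_derive_coord.
- exists (fun x => p' x + q' x); first exact: polynomial_add.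
  by move=> x; exact: is_deriveD.
- exists (fun x => p' x *: q x + p x *: q' x).
    by apply: polynomial_add; apply: polynomial_mul.
  by move=> x; exact: is_derive_scale.
Qed.

Lemma polynomial_fun_le p : polynomial_fun p ->
  exists C : R, exists d, 0 <= C /\ forall x, `|p x| <= C * (1 + `|x|) ^+ d.
Proof.
have e1 (x : 'cV[R]_m) d : 1 <= (1 + `|x|) ^+ d by rewrite exprn_ege1// japanese_ge1.
elim=> {p} [c|j|p q _ [C [d [C0 hC]]] _ [D [e [D0 hD]]]|p q _ [C [d [C0 hC]]] _ [D [e [D0 hD]]]].
- by exists `|c|, 0%N; split=> // x; rewrite expr0 mulr1.
- exists 1, 1%N; split=> // x; rewrite mul1r expr1 (le_trans (coord_le_norm x j))//.
  by rewrite lerDr.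
- exists (C + D), (d + e)%N; split=> [|x]; first exact: addr_ge0.
  rewrite (le_trans (ler_normD _ _))// mulrDl lerD//.
    by rewrite (le_trans (hC x))// ler_wpM2l// exprD ler_peMr// ltW.
  by rewrite (le_trans (hD x))// ler_wpM2l// exprD ler_peMl// ltW.
- exists (C * D), (d + e)%N; split=> [|x]; first exact: mulr_ge0.
  by rewrite normrZ exprD mulrACA; apply: ler_pM.
Qed.

Lemma polynomial_fun_continuous p : polynomial_fun p -> continuous p.
Proof.
elim=> {p} [c|j|p q _ cp _ cq|p q _ cp _ cq].
- exact: cst_continuous.
- by apply: continuous_coord => x; exact: cvg_id.
- exact: continuous_add.
- exact: continuous_scale.
Qed.

Lemma schwartz_gaussian (V : normedModType R) (a : V) : schwartz (fun x => gaussian x *: a).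
Proof.
have cG : continuous (fun x => gaussian x : R^o).
  suff H (s : seq 'I_m) : continuous (fun x : 'cV[R]_m => \prod_(i <- s) gauss_fun (x i 0) : R^o).
    exact: H.
  elim: s => [|i s IH].
    by under eq_fun do rewrite big_nil; exact: cst_continuous.
  under eq_fun do rewrite big_cons.
  apply: (@continuous_scale _ _ R^o) IH.
  apply: (continuous_comp_fun continuous_gauss_fun).
  by apply: continuous_coord => x; exact: cvg_id.
pose P (h : 'cV[R]_m -> V) := exists2 p, polynomial_fun p & h = fun x => p x *: (gaussian x *: a).
have cl : forall h, P h -> schwartz h.
  apply: (@schwartz_class _ m V P) => h [p pp ->]; split.
  - apply: continuous_scale; first exact: polynomial_fun_continuous.
    by apply: continuous_scale => //; exact: cst_continuous.
  - have [C [d [C0 hC]]] := polynomial_fun_le pp.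
    apply: (@rapid_le _ _ _ _ (fun x => gaussian x : R^o) _ (C * `|a|) d) rapid_gaussian.
      by rewrite mulr_ge0.
    move=> x; rewrite !normrZ [C * _ * _]mulrAC -[leRHS]mulrA [`|a| * _]mulrC.
    by rewrite ler_wpM2r.
  - move=> i; have [q pq dq] := polynomial_fun_derive i pp.
    exists (fun x => (q x + p x *: (-2 *: x i 0)) *: (gaussian x *: a)); split.
      exists (fun x => q x + p x *: ((-2 : R^o) *: (x i 0 : R^o))) => //.
      apply: polynomial_add => //; apply: polynomial_mul => //.
      by apply: polynomial_mul; [exact: polynomial_cst|exact: polynomial_coord].
    move=> x.
    have := is_derive_scale (dq x) (is_derive_scale (is_derive_gaussian x i)
      (is_derive_cst a x (delta_mx i 0 : 'cV[R]_m))).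
    congr is_derive; rewrite scaler0 addr0 scalerDl; congr (_ + _).
    rewrite !scalerA; congr (_ *: _).
    by rewrite -[(p x * -2) *: _]/(p x * -2 * x i 0); ring.
apply: cl; exists (fun=> 1); first exact: polynomial_cst.
by apply/funext => x; rewrite scale1r.
Qed.

End Gaussian.

(** Uniqueness of the oscillatory integral rests on the existence of one admissible cut-off; the
    Gaussian is Schwartz and equals 1 at 0. *)
Lemma osc_integralE (R : realType) (A : cstarAlgType R) n (b : 'cV[R]_n -> 'cV[R]_n -> A) (a : A) :
  is_osc_integral b a -> osc_integral b = a.
Proof.
move=> ba; have bx : is_osc_integral b (osc_integral b) := xgetPex _ (ex_intro _ a ba).
pose chi (x : 'cV[R]_(n + n)) : R^o := gaussian x *: (1 : R^o).
have sc : schwartz chi by exact: schwartz_gaussian.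
have c0 : chi 0 = 1 by rewrite /chi gaussian0 scale1r.
exact: cvg_unique (bx chi sc c0) (ba chi sc c0).
Qed.

Lemma deformed_prodE (R : realType) (A : cstarAlgType R) n (J : 'M[R]_n) (F G : 'cV[R]_n -> A)
    (K : R) (x : 'cV[R]_n) :
  continuous F -> (forall y, `|F y| <= K) -> schwartz G ->
  deformed_prod J F G x = integral_bar (fun xi =>
    cscale (expi (dot x xi)) (amul (F (x - J *m xi)) (fourier G xi))).
Proof.
by move=> cF FK sG; apply: osc_integralE; exact: is_osc_integral_product FK sG.
Qed.

(** * The Fourier transform of a Gaussian *)

Lemma integral1_gauss (R : realType) (V : completeNormedModType R) (v : V) :
  integral1 (fun t => gauss_fun t *: v) = Num.sqrt pi *: v.
Proof.
apply: integral1E => phi _.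
have -> : phi \o (fun t => gauss_fun t *: v) = fun t => gauss_fun t * phi v.
  by apply/funext => t /=; rewrite linearZ.
split; last by rewrite RintegralZr ?integrableT_gauss// /Rintegral integralT_gauss linearZ.
rewrite (_ : _ \o _ = fun t => (EFin \o gauss_fun) t * (phi v)%:E)%E//.
by apply: integrableZr => //; exact: integrableT_gauss.
Qed.

Lemma integral_Rn_gaussian (R : realType) (V : completeNormedModType R) m (v : V) :
  integral_Rn (fun x : 'cV[R]_m => gaussian x *: v) = Num.sqrt pi ^+ m *: v.
Proof.
elim: m => [|m IH] /=; first by rewrite /gaussian big_ord0 expr0.
rewrite -[RHS](_ : Num.sqrt pi *: (Num.sqrt pi ^+ m *: v) = _); last by rewrite scalerA exprS.
rewrite -integral1_gauss; congr integral1; apply/funext => t.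
rewrite -IH -integral_RnZ; last by rewrite gt_eqF// expR_gt0.
congr integral_Rn; apply/funext => x; rewrite scalerA; congr (_ *: _).
rewrite /gaussian (@big_split_ord _ _ _ 1 m) big_ord1; congr (gauss_fun _ * _).
  by rewrite (@col_mxEu _ 1 m) mxE eqxx mulr1n.
by apply: eq_bigr => i _; rewrite (@col_mxEd _ 1 m).
Qed.

Lemma constant_is_derive0 (R : realType) m (V : normedModType R) (f : 'cV[R]_m -> V) :
  (forall x i, is_derive x (delta_mx i 0 : 'cV[R]_m) f 0) -> forall x, f x = f 0.
Proof.
move=> df x; have step i h y : f (h *: delta_mx i 0 + y) = f y.
  have := @directional_mean_value _ _ _ f (fun=> 0) y (delta_mx i 0) h 0 (df ^~ i).
  rewrite mul0r => /(_ _)/wrap[s _|]; first by rewrite normr0.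
  by rewrite normr_le0 subr_eq0 => /eqP.
have -> : x = \sum_i x i 0 *: delta_mx i 0.
  apply/colP => j; rewrite summxE (bigD1 j)//= big1 ?addr0 => [|i ij]; rewrite !mxE ?eqxx ?mulr1//.
  by rewrite eq_sym (negbTE ij) mulr0.
by elim: (index_enum _) => [|i s IH]; rewrite ?big_nil// big_cons step.
Qed.

Section GaussianFourier.
Context {R : realType} {V : complexBanachType R} {m : nat} (c : V).

Let G (x : 'cV[R]_m) : V := gaussian x *: c.

Let sG : schwartz G. Proof. exact: schwartz_gaussian. Qed.

Let derivG i : pderiv [:: i] G = fun x => (- 2) *: (x i 0 *: G x).
Proof.
apply: pderiv1 => x.
have := is_derive_scale (is_derive_gaussian x i) (is_derive_cst c x (delta_mx i 0 : 'cV[R]_m)).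
congr is_derive; rewrite scaler0 addr0 !scalerA; congr (_ *: _); ring.
Qed.

Let Phi z := integral_Rn (modulate z G).

(** Differentiation under the integral brings down [i x_j]; since [x_j G = - (d_j G) / 2],
    integration by parts returns a multiple of [Phi]. *)
Let derivPhi z i : is_derive z (delta_mx i 0 : 'cV[R]_m) Phi (- (z i 0 / 2) *: Phi z).
Proof.
pose K (x : 'cV[R]_m) := cscale 'i%C (x i 0 *: G x).
have sK : schwartz K by apply: schwartz_cscale; exact: schwartz_coordM.
have [C CK] := schwartz_dominated [::] sK; have [D DG] := schwartz_dominated [::] sG.
have [D' DG'] := schwartz_dominated [:: i] sG.
have -> : - (z i 0 / 2) *: Phi z = integral_Rn (modulate z K).
  have -> : modulate z K = (fun x => - 2^-1 *: cscale 'i%C (modulate z (pderiv [:: i] G) x)).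
    apply/funext => x; rewrite /modulate derivG /K /G !(cscale_scale, scalerA).
    by congr (_ *: _); [field|rewrite !cscaleA mulrC].
  rewrite integral_RnZ ?oppr_eq0 ?invr_eq0 ?pnatr_eq0//.
  rewrite (integral_Rn_map (K := 1) (L := cscale 'i%C) _ _ (dominated_modulate z DG')).
  - rewrite (integral_modulate_pderiv z (schwartz_smooth sG) DG DG') cscalerN cscale_scale cscaleA.
    have -> : 'i%C * 'i%C = ((- 1)%:C)%C :> R[i].
      by apply/eqP; rewrite eq_complex /= !(mulr0, mulr1, mul0r, sub0r, addr0) !eqxx.
    by rewrite cscale_real scaleN1r !scalerN opprK scalerA; congr (_ *: _); rewrite mulNr mulrC.
  - exact: cscale_linear.
  - by move=> x; rewrite norm_cscale /ComplexField.Normc.normc /= expr0n add0r expr1n sqrtr1.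
apply: (@is_derive_integral _ _ _ _ (fun w => modulate w G) (fun w => modulate w K) z _ C).
- move=> y x; rewrite /modulate.
  have := is_derive_modulate x (is_derive_cst (G x) y (delta_mx i 0 : 'cV[R]_m)).
  rewrite /modulate addr0 -cscale_scale.
  by congr is_derive; [apply/funext => w|]; rewrite dotC.
- by move=> y; exists D; exact: dominated_modulate.
- exact/continuous_modulate/(CK.1).
- by move=> s _ x; rewrite norm_modulate; exact: (CK.2).
Qed.

(** [Phi] and [gaussian (z / 2)], that is [exp (- |z|^2 / 4)] for the Euclidean norm, solve the same
    first order system, so their quotient is constant; its value at 0 is the Gaussian integral. *)
Lemma integral_modulate_gaussian z :
  integral_Rn (modulate z G) = (gaussian (2^-1 *: z) * Num.sqrt pi ^+ m) *: c.
Proof.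
pose g (x : 'cV[R]_m) : R^o := gaussian (2^-1 *: x).
have g0 x : g x != 0 by rewrite gt_eqF// gaussian_gt0.
have dg x i : is_derive x (delta_mx i 0 : 'cV[R]_m) g (- (x i 0 / 2) * g x).
  have := @is_derive_comp_line _ _ _ _ (fun x : 'cV[R]_m => 2^-1 *: x) _ x (delta_mx i 0) _ 2^-1 _ _
    (is_derive_gaussian (2^-1 *: x) i).
  move=> /(_ _)/wrap[h|]; first by rewrite scalerDr scalerA mulrC.
  by congr is_derive; rewrite mxE -[_ *: _]/(_ * _) /g; field.
have := @constant_is_derive0 _ _ _ (fun x => (g x)^-1 *: Phi x).
move=> /(_ _)/wrap[x i|/(_ z)].
  have dV : is_derive x (delta_mx i 0 : 'cV[R]_m) (fun y => (g y)^-1 : R^o) (- (g x) ^- 2 * (- (x i 0 / 2) * g x)).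
    have [dgx dgE] := dg x i; split; first exact: (derivableV (g0 x) dgx).
    by rewrite (deriveV (g0 x) dgx) dgE.
  have := is_derive_scale dV (derivPhi x i).
  congr is_derive; rewrite scalerA -scalerDl.
  rewrite [X in X *: _](_ : _ = 0) ?scale0r//; field; exact: g0.
rewrite {2}/g scaler0 gaussian0 invr1 scale1r.
have -> : Phi 0 = Num.sqrt pi ^+ m *: c.
  rewrite -integral_Rn_gaussian; congr integral_Rn; apply/funext => x.
  by rewrite /modulate (_ : dot 0 x = 0) ?expi0 ?cscale1// /dot big1// => i _; rewrite mxE mul0r.
by move=> /(congr1 ( *:%R (g z))); rewrite !scalerA mulfV// scale1r.
Qed.

End GaussianFourier.

Lemma linear_continuous_bound (R : realType) (V W : normedModType R) (L : V -> W) :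
  (forall (r : R) u v, L (r *: u + v) = r *: L u + L v) -> continuous L ->
  exists2 K : R, 0 <= K & forall v, `|L v| <= K * `|v|.
Proof.
move=> lL; pose pL : {linear V -> W} := HB.pack_for {linear V -> W} L
  (GRing.isLinear.Build R V W *:%R L lL).
exact: (@continuous_linear_bound _ _ _ pL).
Qed.

Lemma schwartz0 (R : realType) (V : normedModType R) m : schwartz (fun _ : 'cV[R]_m => 0 : V).
Proof.
have := @schwartz_gaussian R m V 0; congr schwartz; apply/funext => x; exact: scaler0.
Qed.

(** * The completion of the Schwartz space *)

Section Completion.
Context {R : realType} {A : cstarAlgType R} {n : nat} (H : completion A n).
Implicit Types (f g u v w : 'cV[R]_n -> A) (h : H).
Local Notation emb := (emb H).

Lemma emb_cscaleD (c : R[i]) f g : schwartz f -> schwartz g ->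
  emb (fun x => cscale c (f x) + g x) = cscale c (emb f) + emb g.
Proof. exact: emb_linear. Qed.

Lemma embD f g : schwartz f -> schwartz g -> emb (fun x => f x + g x) = emb f + emb g.
Proof.
move=> sf sg; rewrite -[in RHS](cscale1 (emb f)) -emb_cscaleD//.
by congr emb; apply/funext => x; rewrite cscale1.
Qed.

Lemma emb0 : emb (fun=> 0) = 0.
Proof.
have := embD (schwartz0 A n) (schwartz0 A n).
rewrite (_ : (fun _ => _ + _) = fun=> 0); last by apply/funext => x; rewrite addr0.
by move/eqP; rewrite -subr_eq0 opprD addNKr oppr_eq0 => /eqP.
Qed.

Lemma emb_cscale (c : R[i]) f : schwartz f -> emb (fun x => cscale c (f x)) = cscale c (emb f).
Proof.
move=> sf; rewrite -[RHS]addr0 -emb0 -emb_cscaleD//; last exact: schwartz0.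
by congr emb; apply/funext => x; rewrite addr0.
Qed.

Lemma embZ (r : R) f : schwartz f -> emb (fun x => r *: f x) = r *: emb f.
Proof.
move=> sf; rewrite -cscale_real -emb_cscale//.
by congr emb; apply/funext => x; rewrite cscale_real.
Qed.

Lemma embB f g : schwartz f -> schwartz g -> emb (fun x => f x - g x) = emb f - emb g.
Proof.
move=> sf sg; rewrite -scaleN1r -embZ// -embD//; last exact: schwartzZ.
by congr emb; apply/funext => x; rewrite scaleN1r.
Qed.

Lemma norm_emb f : schwartz f ->
  `|emb f| = Num.sqrt `|integral_Rn (fun x => amul (star (f x)) (f x))|.
Proof. by move=> sf; rewrite norm_ip ip_emb. Qed.

Lemma emb_dense_cvg h : exists u : nat -> 'cV[R]_n -> A,
  (forall k, schwartz (u k)) /\ emb (u k) @[k --> \oo] --> h.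
Proof.
have E k : exists u, schwartz u /\ ball h k.+1%:R^-1 (emb u).
  have k0 : 0 < k.+1%:R^-1 :> R by rewrite invr_gt0.
  have [h' [hb [u su uh]]] : ball h k.+1%:R^-1 `&` (emb @` schwartz) !=set0.
    by apply: dense_emb; [exists h; exact: ballxx|exact: ball_open].
  by exists u; rewrite uh.
exists (fun k => sval (cid (E k))); split=> [k|]; first by case: (svalP (cid (E k))).
by apply: ball_seq_cvg => k; case: (svalP (cid (E k))).
Qed.

Lemma emb_continuous_eq (T : topologicalType) (F G : H -> T) : hausdorff_space T ->
  continuous F -> continuous G ->
  (forall u, schwartz u -> F (emb u) = G (emb u)) -> F = G.
Proof.
move=> hT cF cG FG; apply/funext => h; have [u [su uh]] := emb_dense_cvg h.
have HF : F (emb (u k)) @[k --> \oo] --> F h by exact: cvg_comp uh (cF h).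
have HG : G (emb (u k)) @[k --> \oo] --> G h by exact: cvg_comp uh (cG h).
apply: (cvg_unique hT) HG.
by rewrite (_ : (fun k => G _) = (fun k => F (emb (u k))))//; apply/funext => k; rewrite FG.
Qed.

Lemma cvg_ip (T : Type) (F : set_system T) {FF : Filter F} (a b : T -> H) h k :
  a x @[x --> F] --> h -> b x @[x --> F] --> k -> ip (a x) (b x) @[x --> F] --> ip h k.
Proof.
by move=> ah bk; exact: cvg_comp (cvg_pair ah bk) (@ip_continuous _ _ _ H (h, k)).
Qed.

Lemma continuous_ipr h : continuous (fun k => ip h k).
Proof. by move=> k; apply: cvg_ip; [exact: cvg_cst|exact: cvg_id]. Qed.

Lemma continuous_ipl k : continuous (fun h => ip h k).
Proof. by move=> h; apply: cvg_ip; [exact: cvg_id|exact: cvg_cst]. Qed.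

Lemma dominated_inner f g : schwartz f -> schwartz g ->
  exists C, dominated C (fun x => amul (star (f x)) (g x)).
Proof.
move=> sf sg; have [C [cf fC]] := schwartz_dominated [::] sf.
have [M gM] := schwartz_bounded sg.
exists (C * M); split=> [|x].
  apply: continuous_amul; last exact/smooth_continuous/schwartz_smooth.
  exact: continuous_comp_fun continuous_star cf.
rewrite (le_trans (norm_amul _ _))// norm_star mulrAC ler_pM//; exact: fC.
Qed.

(** Linearity is read off the integral formula on Schwartz functions and carried to the completion
    by density and continuity of [ip]. *)
Lemma ip_emb_linear w (r : R) (h k : H) : schwartz w ->
  ip (emb w) (r *: h + k) = r *: ip (emb w) h + ip (emb w) k.
Proof.
move=> sw; have [u [su uh]] := emb_dense_cvg h; have [v [sv vk]] := emb_dense_cvg k.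
have HL : ip (emb w) (r *: emb (u j) + emb (v j)) @[j --> \oo] --> ip (emb w) (r *: h + k).
  apply: cvg_ip; first exact: cvg_cst.
  by apply: cvgD vk; apply: cvgZr.
have HR : r *: ip (emb w) (emb (u j)) + ip (emb w) (emb (v j)) @[j --> \oo] -->
    r *: ip (emb w) h + ip (emb w) k.
  by apply: cvgD; [apply: cvgZr|]; apply: cvg_ip => //; exact: cvg_cst.
apply: (cvg_unique (@norm_hausdorff _ _)) HL _.
rewrite (_ : (fun j => ip _ _) = (fun j => r *: ip (emb w) (emb (u j)) + ip (emb w) (emb (v j))))//.
apply/funext => j; have sru : schwartz (fun x => r *: u j x) by exact: schwartzZ.
rewrite -embZ// -embD// !ip_emb//; last exact: schwartzD.
have [C uC] := dominated_inner sw (su j); have [D vD] := dominated_inner sw (sv j).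
have [C' uC'] := dominated_inner sw sru.
under eq_fun do rewrite amulDr.
rewrite (integral_RnD uC' vD); congr (_ + _).
under eq_fun do rewrite amulZrr.
apply: (integral_Rn_map (L := *:%R r) (K := `|r|)) uC => [s x y|x]; last by rewrite normrZ.
by rewrite scalerDr !scalerA mulrC.
Qed.

(** A vector orthogonal to the dense image of [emb] is orthogonal to itself by continuity, hence has
    norm 0. *)
Lemma eq_ip_emb (h k : H) : (forall w, schwartz w -> ip (emb w) h = ip (emb w) k) -> h = k.
Proof.
move=> hk; have E w : schwartz w -> ip (emb w) (h - k) = 0.
  by move=> sw; rewrite [h - k]addrC -scaleN1r ip_emb_linear// hk// scaleN1r addNr.
have : (fun l => ip l (h - k)) = fun=> 0.
  apply: (@emb_continuous_eq A) E; first exact: norm_hausdorff.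
    exact: continuous_ipl.
  exact: cst_continuous.
move=> /(congr1 (@^~ (h - k)))/= ip0.
apply/eqP; rewrite -subr_eq0 -normr_eq0 norm_ip ip0 normr0 sqrtr0//.
Qed.

End Completion.

Section SchwartzOperators.
Context {R : realType} {A : cstarAlgType R} {n : nat} (H : completion A n).
Implicit Types (f g u v w : 'cV[R]_n -> A) (h : H).
Local Notation emb := (emb H).

Lemma schwartz_amulr u (c : A) : schwartz u -> schwartz (fun x => amul (u x) c).
Proof.
apply: (schwartz_comp_bounded_linear (L := fun a => amul a c) (K := `|c|)) => //.
- by move=> r x y; rewrite amul_linearl.
- by move=> x; rewrite mulrC norm_amul.
- by apply: continuous_amul => x; [exact: cvg_id|exact: cvg_cst].
Qed.

(** The inner square of [u c] is [c^* <u, u> c]. *)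
Lemma norm_emb_amulr u (c : A) : schwartz u -> `|emb (fun x => amul (u x) c)| <= `|c| * `|emb u|.
Proof.
move=> su; rewrite !norm_emb//; last exact: schwartz_amulr.
have [C uC] := dominated_inner su su.
rewrite (_ : integral_Rn _ = amul (amul (star c) (integral_Rn (fun x => amul (star (u x)) (u x)))) c).
  have -> : `|c| = Num.sqrt (`|c| ^+ 2) by rewrite sqrtr_sqr normr_id.
  rewrite -sqrtrM ?sqr_ge0// ler_sqrt ?mulr_ge0 ?sqr_ge0//.
  rewrite (le_trans (norm_amul _ _))// expr2 mulrC -mulrA ler_wpM2l// -[`|c| in leRHS]norm_star.
  exact: norm_amul.
have -> : (fun x => amul (star (amul (u x) c)) (amul (u x) c)) =
    fun x => amul (amul (star c) (amul (star (u x)) (u x))) c.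
  by apply/funext => x; rewrite starM !amulA.
apply: (integral_Rn_map (L := fun a => amul (amul (star c) a) c) (K := `|c| * `|c|)) uC => [r x y|x].
  by rewrite amul_linearr amul_linearl.
rewrite (le_trans (norm_amul _ _))// mulrAC ler_wpM2r// -[`|c| in leRHS]norm_star.
exact: norm_amul.
Qed.

(** The operator [M_eta] on functions. *)
Definition shift_modulate (J : 'M[R]_n) (eta : 'cV[R]_n) u : 'cV[R]_n -> A :=
  modulate eta (fun x => u (x - J *m eta)).

Lemma schwartz_shift (b : 'cV[R]_n) u : schwartz u -> schwartz (fun x => u (x + b)).
Proof.
move=> su; rewrite (_ : (fun x => _) = fun x => u (1 *: x + b)); first exact: schwartz_comp_coord.
by apply/funext => x; rewrite scale1r.
Qed.

Lemma schwartz_shift_modulate J eta u : schwartz u -> schwartz (shift_modulate J eta u).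
Proof. by move=> su; apply: schwartz_modulate; exact: schwartz_shift. Qed.

Lemma norm_emb_shift_modulate J eta u : schwartz u -> `|emb (shift_modulate J eta u)| = `|emb u|.
Proof.
move=> su; rewrite !norm_emb//; last exact: schwartz_shift_modulate.
congr (Num.sqrt `|_|); rewrite -[in RHS](integral_Rn_shift _ (- (J *m eta))); congr integral_Rn.
apply/funext => x; rewrite /shift_modulate /modulate star_cscale_expi amulZl amulZr.
by rewrite cscale_expiK.
Qed.

(** Extension of a bounded linear map from a dense subspace. Nothing is assumed on the sign of [C],
    whence the positive constant [|C| + 1] in the divisions. *)
Lemma extends_bounded (P : ('cV[R]_n -> A) -> 'cV[R]_n -> A) (C : R) :
  (forall u, schwartz u -> schwartz (P u)) ->
  (forall (c : R[i]) u v, schwartz u -> schwartz v ->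
     P (fun x => cscale c (u x) + v x) = fun x => cscale c (P u x) + P v x) ->
  (forall u, schwartz u -> `|emb (P u)| <= C * `|emb u|) ->
  exists T : H -> H, extends P T.
Proof.
move=> sP lP PC.
have PB u v : schwartz u -> schwartz v -> `|emb (P u) - emb (P v)| <= C * `|emb u - emb v|.
  move=> su sv; rewrite -embB; [|exact: sP..].
  have E a b : schwartz a -> schwartz b -> `|emb (P (fun x => cscale (-1)%:C%C (a x) + b x))| <= C * `|emb b - emb a|.
    move=> sa sb; rewrite (_ : emb b - _ = cscale (-1)%:C%C (emb a) + emb b); last first.
      by rewrite cscale_real scaleN1r addrC.
    rewrite -emb_cscaleD// PC//.
    by apply: schwartzD => //; exact: schwartz_cscale.
  have := E v u sv su; rewrite lP// (_ : (fun x => _) = fun x => P u x - P v x)//.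
  by apply/funext => x; rewrite cscale_real scaleN1r addrC.
have C0 : 0 <= `|C| + 1 by rewrite addr_ge0.
(* The image of [h] is specified by an inequality against every Schwartz function, so that the
   choice of [l] involves no approximating sequence and compatibility with all of them is
   immediate. *)
have key h : exists l, forall u, schwartz u -> `|emb (P u) - l| <= C * `|emb u - h|.
  have [u [su uh]] := emb_dense_cvg h.
  have cv : cvg (emb (P (u k)) @[k --> \oo]).
    apply: cauchy_cvg; apply/cauchyP => e e0.
    have e1 : 0 < e / (2 * (`|C| + 1)) by rewrite divr_gt0// mulr_gt0// ltr_wpDl.
    have [N _ hN] := (cvgrPdist_lt _ _).1 uh _ e1.
    exists (emb (P (u N))); exists N => // k /= Nk; rewrite -ball_normE/=.
    rewrite (le_lt_trans (PB _ _ (su N) (su k)))//.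
    rewrite (@le_lt_trans _ _ ((`|C| + 1) * `|emb (u N) - emb (u k)|))//.
      by rewrite ler_wpM2r// (le_trans (ler_norm _))// lerDl.
    rewrite -ltr_pdivlMl ?ltr_wpDl//.
    have -> : (`|C| + 1)^-1 * e = e / (2 * (`|C| + 1)) + e / (2 * (`|C| + 1)).
      by field; rewrite gt_eqF// ltr_wpDl.
    rewrite (le_lt_trans (ler_distD h _ _))// ltrD//; last exact: hN.
    by rewrite distrC; apply: hN => /=.
  exists (lim (emb (P (u k)) @[k --> \oo])) => v sv.
  have lim1 : C * `|emb v - emb (u k)| - `|emb (P v) - emb (P (u k))| @[k --> \oo] -->
      C * `|emb v - h| - `|emb (P v) - lim (emb (P (u k)) @[k --> \oo])|.
    apply: cvgB; last by apply: cvg_norm; apply: cvgB => //; exact: cvg_cst.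
    by apply: cvgMr; apply: cvg_norm; apply: cvgB => //; exact: cvg_cst.
  rewrite -subr_ge0 -(cvg_lim _ lim1)//; apply: limr_ge; first exact: cvgP lim1.
  by apply: nearW => k; rewrite subr_ge0 PB.
pose T h := sval (cid (key h)).
have TC h u : schwartz u -> `|emb (P u) - T h| <= C * `|emb u - h| by exact: (svalP (cid (key h))).
have Temb u : schwartz u -> T (emb u) = emb (P u).
  move=> su; have := TC (emb u) u su; rewrite subrr normr0 mulr0 normr_le0 subr_eq0.
  by move=> /eqP.
have Tlim h (u : nat -> 'cV[R]_n -> A) : (forall k, schwartz (u k)) -> emb (u k) @[k --> \oo] --> h ->
    emb (P (u k)) @[k --> \oo] --> T h.
  move=> su uh; apply/cvgrPdist_le => e e0.
  have e1 : 0 < e / (`|C| + 1) by rewrite divr_gt0// ltr_wpDl.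
  have [N _ hN] := (cvgrPdist_le _ _).1 uh _ e1; exists N => // k /hN/= hk.
  rewrite distrC (le_trans (TC h _ (su k)))// (@le_trans _ _ ((`|C| + 1) * `|emb (u k) - h|))//.
    by rewrite ler_wpM2r// (le_trans (ler_norm _))// lerDl.
  by rewrite -ler_pdivlMl ?ltr_wpDl// mulrC distrC.
have lT c h (k : H) : T (cscale c h + k) = cscale c (T h) + T k.
  have [u [su uh]] := emb_dense_cvg h; have [v [sv vk]] := emb_dense_cvg k.
  have sw j : schwartz (fun x => cscale c (u j x) + v j x).
    by apply: schwartzD => //; exact: schwartz_cscale.
  have cvS (a b : nat -> H) a' b' : a j @[j --> \oo] --> a' -> b j @[j --> \oo] --> b' ->
      cscale c (a j) + b j @[j --> \oo] --> cscale c a' + b'.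
    by move=> ca cb; apply: cvgD cb; exact: cvg_comp ca (@continuous_cscale _ _ c a').
  have L1 := Tlim (cscale c h + k) _ sw.
  apply: (cvg_unique (@norm_hausdorff _ _) (L1 _)).
    by under eq_fun do rewrite emb_cscaleD//; exact: cvS.
  rewrite (_ : (fun k0 => _) = fun k0 => cscale c (emb (P (u k0))) + emb (P (v k0))).
    by apply: cvS; exact: Tlim.
  by apply/funext => j; rewrite lP// emb_cscaleD//; exact: sP.
exists T; split; last by move=> u su; split; [exact: sP|exact: Temb].
split=> //; apply: (bounded_additive_continuous (K := C)) => [r u v|h].
  by rewrite -cscale_real lT cscale_real.
(* The inequality specifying [T h], taken at [u = 0], is the operator bound by [C]. *)
have P0 : emb (P (fun=> 0)) = 0.
  have sz := schwartz0 A n; apply/eqP; rewrite -normr_le0.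
  by rewrite (le_trans (PC _ sz))// emb0 normr0 mulr0.
by have := TC h _ (schwartz0 A n); rewrite P0 emb0 !sub0r !normrN.
Qed.

End SchwartzOperators.

(** * Right multiplications as averages of modulated shifts *)

Section Twist.
Context {R : realType} {A : cstarAlgType R} {n : nat} (J : 'M[R]_n).
Implicit Types (u v w kappa : 'cV[R]_n -> A).

(** For [kappa = fourier g] this is the integrand of [R_g u]; for constant [kappa] it is
    [(M_eta u) c], which remains when the Gaussian has shrunk to a point. *)
Definition twist u kappa (eta x : 'cV[R]_n) : A := amul (shift_modulate J eta u x) (kappa eta).

Lemma schwartz_twist u kappa eta : schwartz u -> schwartz (twist u kappa eta).
Proof. by move=> su; apply: schwartz_amulr; exact: schwartz_shift_modulate. Qed.

Lemma norm_twist_le u kappa eta x : `|twist u kappa eta x| <= `|u (x - J *m eta)| * `|kappa eta|.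
Proof. by rewrite (le_trans (norm_amul _ _))// norm_modulate. Qed.

(** A Peetre type inequality: decay of [u] at [x - J eta] becomes decay in [x] at the price of
    polynomial growth in [eta]. *)
Lemma shift_norm_le : exists2 K : R, 1 <= K & forall eta x : 'cV[R]_n,
  1 + `|x| <= K * (1 + `|eta|) * (1 + `|x - J *m eta|).
Proof.
have lJ (r : R) (x y : 'cV[R]_n) : J *m (r *: x + y) = r *: (J *m x) + J *m y.
  by rewrite mulmxDr -scalemxAr.
have cJ : continuous (mulmx J : 'cV[R]_n -> 'cV[R]_n) by apply: continuous_mulmxr => x; exact: cvg_id.
have [K K0 JK] := linear_continuous_bound lJ cJ.
exists (1 + K) => [|eta x]; first by rewrite lerDl.
have h1 : `|x| <= `|x - J *m eta| + K * `|eta|.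
  by rewrite -[X in `|X| <= _](subrK (J *m eta)) (le_trans (ler_normD _ _))// lerD2l JK.
have := normr_ge0 eta; have := normr_ge0 (x - J *m eta); move: h1.
move: `|x| `|_ - _| `|eta| => a b c abc b0 c0; have := mulr_ge0 K0 b0.
have := mulr_ge0 (mulr_ge0 K0 b0) c0; have := mulr_ge0 b0 c0; lra.
Qed.

Lemma rapid_shift_le (u : 'cV[R]_n -> A) N : rapid u -> exists2 C : R, 0 <= C & forall eta x : 'cV[R]_n,
  (1 + `|x|) ^+ N * `|u (x - J *m eta)| <= C * (1 + `|eta|) ^+ N.
Proof.
move=> /(_ N)[M uM]; have [K K1 JK] := shift_norm_le.
have M0 : 0 <= M by rewrite (le_trans _ (uM 0))// mulr_ge0// exprn_ge0 ?addr_ge0.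
have K0 : 0 <= K by rewrite (le_trans _ K1).
exists (K ^+ N * M) => [|eta x]; first by rewrite mulr_ge0 ?exprn_ge0.
rewrite (@le_trans _ _ ((K * (1 + `|eta|) * (1 + `|x - J *m eta|)) ^+ N * `|u (x - J *m eta)|))//.
  by rewrite ler_wpM2r// lerXn2r// nnegrE ?addr_ge0// !mulr_ge0// addr_ge0.
rewrite !exprMn -!mulrA ler_wpM2l ?exprn_ge0// [leRHS]mulrC.
by rewrite ler_wpM2l ?exprn_ge0 ?addr_ge0//; exact: uM.
Qed.

Lemma rapid_weight_le m (V : normedModType R) (f : 'cV[R]_m -> V) N : rapid f ->
  exists2 C : R, 0 <= C & forall x, (1 + `|x|) ^+ N * `|f x| <= C * weight x.
Proof.
move=> /(_ (N + 2 * m)%N)[M fM].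
have M0 : 0 <= M by rewrite (le_trans _ (fM 0))// mulr_ge0// exprn_ge0 ?addr_ge0.
exists M => // x; rewrite -ler_pdivrMr ?weight_gt0// mulrC mulrA.
rewrite (le_trans _ (fM x))// ler_wpM2r// exprD mulrC ler_wpM2l ?exprn_ge0 ?addr_ge0//.
exact: weight_inv_le.
Qed.

(** The growth in [eta] left over by [rapid_shift_le] is absorbed by the rapid decay of [kappa]. *)
Lemma twist_decay u kappa N : rapid u -> rapid kappa ->
  exists2 C : R, 0 <= C & forall eta x,
    (1 + `|x|) ^+ N * `|twist u kappa eta x| <= C * weight eta.
Proof.
move=> ru rk; have [C C0 uC] := rapid_shift_le N ru; have [D D0 kD] := rapid_weight_le N rk.
exists (C * D) => [|eta x]; first exact: mulr_ge0.
rewrite (@le_trans _ _ ((1 + `|x|) ^+ N * `|u (x - J *m eta)| * `|kappa eta|))//.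
  by rewrite -mulrA ler_wpM2l ?exprn_ge0 ?addr_ge0// norm_twist_le.
rewrite (le_trans (ler_wpM2r _ (uC eta x)))// -!mulrA ler_wpM2l//; exact: kD.
Qed.

Lemma continuous_twist u kappa x : continuous u -> continuous kappa ->
  continuous (fun eta => twist u kappa eta x).
Proof.
move=> cu ck; apply: continuous_amul => //; apply: continuous_cscale_expi.
  by apply: continuous_dot; [move=> y; exact: cvg_id|exact: continuous_mx_cst].
apply: continuous_comp_fun cu _; apply: continuous_sub; first exact: continuous_mx_cst.
by apply: continuous_mulmxr => y; exact: cvg_id.
Qed.

Lemma continuous_twist_r u kappa eta : continuous u -> continuous (twist u kappa eta).
Proof.
move=> cu; apply: continuous_amul; last exact: cst_continuous.
apply: continuous_modulate; apply: continuous_comp_fun cu _.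
by apply: continuous_sub; [move=> y; exact: cvg_id|exact: continuous_mx_cst].
Qed.

Lemma schwartz_rapid u : schwartz u -> rapid u.
Proof. by move=> /schwartzP[_ /(_ [::])]. Qed.

Lemma schwartz_continuous u : schwartz u -> continuous u.
Proof. by move=> /schwartz_smooth/smooth_continuous. Qed.

Lemma dominated_twist u kappa : schwartz u -> schwartz kappa ->
  exists C, forall x, dominated C (fun eta => twist u kappa eta x).
Proof.
move=> su sk; have [C C0 h] := twist_decay 0 (schwartz_rapid su) (schwartz_rapid sk).
exists C => x; split=> [|eta]; first by apply: continuous_twist; exact: schwartz_continuous.
by have := h eta x; rewrite expr0 mul1r.
Qed.

(** Sums are needed for stability under derivatives: one in [x] falls either on the phase, changing
    [kappa] into [i eta_j kappa], or on [u]. *)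
Inductive twist_integral_sum : ('cV[R]_n -> A) -> Prop :=
| twist_integral_base u kappa : schwartz u -> schwartz kappa ->
    twist_integral_sum (fun x => integral_Rn (fun eta => twist u kappa eta x))
| twist_integral_add f g : twist_integral_sum f -> twist_integral_sum g ->
    twist_integral_sum (fun x => f x + g x).

Lemma is_derive_twist u kappa i x eta : schwartz u ->
  is_derive x (delta_mx i 0 : 'cV[R]_n) (twist u kappa eta)
    (twist u (fun eta => eta i 0 *: cscale 'i%C (kappa eta)) eta x +
     twist (pderiv [:: i] u) kappa eta x).
Proof.
move=> su; have [su1 du] := smooth_shift (- (J *m eta)) (schwartz_smooth su).
have d1 := smooth_is_derive i x su1; rewrite du in d1.
have := is_derive_linear (L := fun a => amul a (kappa eta)) _ _ (is_derive_modulate eta d1).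
move=> /(_ (amul_linearl _))/(_ _)/wrap[|].
  by apply: continuous_amul => y; [exact: cvg_id|exact: cvg_cst].
congr is_derive; rewrite cscaleDr amulDl; congr (_ + _).
by rewrite cscale_scale amulZrl /twist amulZrr amulZr -!amulZl cscaleA mulrC -cscaleA.
Qed.

Lemma schwartz_twist_integral u kappa : schwartz u -> schwartz kappa ->
  schwartz (fun x => integral_Rn (fun eta => twist u kappa eta x)).
Proof.
move=> su sk; apply: (@schwartz_class _ n A twist_integral_sum); last exact: twist_integral_base.
move=> {u kappa su sk} f; elim=> {f} [u kappa su sk|f g _ [cf rf df] _ [cg rg dg]]; last first.
  split; [exact: continuous_add|exact: rapidD|move=> i].
  have [f' [sf' df']] := df i; have [g' [sg' dg']] := dg i.
  by exists (fun x => f' x + g' x); split=> [|x]; [exact: twist_integral_add|exact: is_deriveD].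
have [C hC] := dominated_twist su sk.
split.
- move=> x; apply: (integral_Rn_continuous (C := C)) => [y _//|eta].
  exact/continuous_twist_r/schwartz_continuous.
- move=> N; have [D D0 hD] := twist_decay N (schwartz_rapid su) (schwartz_rapid sk).
  exists (D * wint R ^+ n) => x.
  have p0 : 0 < (1 + `|x|) ^+ N by rewrite exprn_gt0// japanese_gt0.
  rewrite -ler_pdivlMl// mulrA; apply: integral_Rn_norm_le; split; first exact: (hC x).1.
  by move=> eta; rewrite -mulrA ler_pdivlMl//; exact: hD.
- move=> i; pose k1 (eta : 'cV[R]_n) := eta i 0 *: cscale 'i%C (kappa eta).
  have sk1 : schwartz k1 by apply: schwartz_coordM; exact: schwartz_cscale.
  have su1 : schwartz (pderiv [:: i] u) by exact: schwartz_pderiv.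
  have [C1 h1] := dominated_twist su sk1; have [C2 h2] := dominated_twist su1 sk.
  exists (fun x => integral_Rn (fun eta => twist u k1 eta x) +
    integral_Rn (fun eta => twist (pderiv [:: i] u) kappa eta x)).
  split=> [|x]; first by apply: twist_integral_add; exact: twist_integral_base.
  rewrite -(integral_RnD (h1 x) (h2 x)).
  apply: (@is_derive_integral _ _ _ _ (fun x eta => twist u kappa eta x)
    (fun x eta => twist u k1 eta x + twist (pderiv [:: i] u) kappa eta x) x _ (C1 + C2)).
  + by move=> y eta; exact: is_derive_twist.
  + by move=> y; exists C.
  + by have [] := dominatedD (h1 x) (h2 x).
  + by move=> s _ y; have [_] := dominatedD (h1 (s *: delta_mx i 0 + x)) (h2 (s *: delta_mx i 0 + x)); exact.
Qed.

End Twist.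

Section TwistInCompletion.
Context {R : realType} {A : cstarAlgType R} {n : nat} (J : 'M[R]_n) (H : completion A n).
Implicit Types (u v w kappa : 'cV[R]_n -> A).
Local Notation emb := (emb H).
Local Notation twist := (twist J).

Lemma norm_emb_twist u kappa eta : schwartz u -> `|emb (twist u kappa eta)| <= `|kappa eta| * `|emb u|.
Proof.
move=> su; rewrite -(norm_emb_shift_modulate H J eta su).
exact/norm_emb_amulr/schwartz_shift_modulate.
Qed.

Lemma twist_weight_le u (r : R) : rapid u -> exists2 C : R, 0 <= C &
  forall eta x : 'cV[R]_n, `|eta| <= r -> `|u (x - J *m eta)| <= C * weight x.
Proof.
move=> ru; have [C C0 uC] := rapid_shift_le J (2 * n) ru.
exists (C * (1 + `|r|) ^+ (2 * n)) => [|eta x er]; first by rewrite mulr_ge0// exprn_ge0// addr_ge0.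
rewrite -ler_pdivrMr ?weight_gt0// mulrC.
rewrite (@le_trans _ _ ((1 + `|x|) ^+ (2 * n) * `|u (x - J *m eta)|))//.
  by rewrite ler_wpM2r// weight_inv_le.
rewrite (le_trans (uC eta x))// ler_wpM2l// lerXn2r// ?nnegrE ?addr_ge0// lerD2l.
by rewrite (le_trans er)// ler_norm.
Qed.

(** For [eta] in a bounded set the shifted functions are dominated by one multiple of [weight], so
    the inner square of the difference tends to 0 by dominated convergence. Boundedness of [kappa],
    rather than decay, admits constants. *)
Lemma continuous_emb_twist u kappa (M : R) : schwartz u -> continuous kappa ->
  (forall eta, `|kappa eta| <= M) -> continuous (fun eta => emb (twist u kappa eta)).
Proof.
move=> su ck kM eta; apply: sequential_continuity => e be.
have ee : e k @[k --> \oo] --> eta := ball_seq_cvg be.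
pose g k x := twist u kappa (e k) x - twist u kappa eta x.
have sg k : schwartz (g k).
  by rewrite /g; under eq_fun do rewrite -scaleN1r; apply: schwartzD; [|apply: schwartzZ]; exact: schwartz_twist.
have [C C0 uC] := twist_weight_le (`|eta| + 1) (schwartz_rapid su).
have M0 : 0 <= M by rewrite (le_trans _ (kM 0)).
have gb k x : `|g k x| <= C * M *+ 2 * weight x.
  have b z : `|z| <= `|eta| + 1 -> `|twist u kappa z x| <= C * M * weight x.
    move=> hz; rewrite (le_trans (norm_twist_le _ _ _ _ _))// mulrAC ler_pM//; exact: uC.
  rewrite mulr2n mulrDl (le_trans (ler_normB _ _))// lerD// b ?lerDl//.
  rewrite -[X in `|X| <= _](subrK eta) addrC (le_trans (ler_normD _ _))// lerD2l.
  have := be k; rewrite -ball_normE /= distrC => /ltW/le_trans; apply.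
  by rewrite invf_le1// ler1n.
have g0 x : g k x @[k --> \oo] --> (0 : A).
  rewrite -(subrr (twist u kappa eta x)); apply: cvgB; last exact: cvg_cst.
  exact: cvg_comp ee (@continuous_twist _ _ _ J u kappa x (schwartz_continuous su) ck eta).
have lim0 : integral_Rn (fun x => amul (star (g k x)) (g k x)) @[k --> \oo] -->
    integral_Rn (fun _ : 'cV[R]_n => 0 : A).
  apply: (integral_Rn_dct (C := (C * M *+ 2) * (C * M *+ 2))) => [k||x].
  - split=> [|x].
      have cg := schwartz_continuous (sg k).
      by apply: continuous_amul => //; exact: continuous_comp_fun continuous_star cg.
    rewrite (le_trans (norm_amul _ _))// norm_star.
    rewrite -mulrA; apply: ler_pM => //; rewrite (le_trans (gb k x))// ler_piMr ?weight_le1//.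
    by rewrite mulrn_wge0// mulr_ge0.
  - exact: cst_continuous.
  - rewrite -(amul0r (star 0 : A)); apply: cvg_amul => //.
    exact: cvg_comp (g0 x) (@continuous_star _ _ 0).
have Z : integral_Rn (fun _ : 'cV[R]_n => 0 : A) = 0.
  have := @integral_Rn_gaussian _ A n 0; rewrite scaler0 => {2}<-.
  by congr integral_Rn; apply/funext => x; rewrite scaler0.
rewrite Z in lim0.
have eqn k : emb (twist u kappa (e k)) = emb (g k) + emb (twist u kappa eta).
  rewrite -embD//; last exact: schwartz_twist.
  by congr (Defs.emb _ _); apply/funext => x; rewrite /g subrK.
rewrite (_ : (fun k => _) = fun k => emb (g k) + emb (twist u kappa eta)); last exact/funext.
rewrite -[X in _ --> X]add0r; apply: cvgD; last exact: cvg_cst.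
apply: norm_cvg0; rewrite (_ : (fun k => _) = fun k => Num.sqrt `|integral_Rn (fun x => amul (star (g k x)) (g k x))|).
  have n0 : `|integral_Rn (fun x => amul (star (g k x)) (g k x))| @[k --> \oo] --> (0 : R).
    by rewrite -(normr0 A); apply: cvg_norm.
  by rewrite -(sqrtr0 R); exact: cvg_comp n0 (@sqrt_continuous _ 0).
by apply/funext => k; rewrite norm_emb.
Qed.

Lemma dominated_emb_twist kappa : schwartz kappa ->
  exists2 C : R, 0 <= C & forall v, schwartz v -> dominated (C * `|emb v|) (fun eta => emb (twist v kappa eta)).
Proof.
move=> sk; have [C kC] := schwartz_dominated [::] sk.
exists C => [|v sv]; first exact: dominated_ge0 kC.
have [M kM] := schwartz_bounded sk.
split=> [|eta]; first exact: continuous_emb_twist (schwartz_continuous sk) kM.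
rewrite (le_trans (norm_emb_twist _ _ sv))// mulrAC ler_wpM2r//; exact: kC.2.
Qed.

(* The vector-valued integral is identified by testing against emb w. *)
Lemma emb_twist_integral u kappa : schwartz u -> schwartz kappa ->
  emb (fun x => integral_Rn (fun eta => twist u kappa eta x)) =
  integral_Rn (fun eta => emb (twist u kappa eta)).
Proof.
move=> su sk; have [C C0 dC] := dominated_emb_twist sk.
have [D dD] := dominated_twist J su sk.
apply: eq_ip_emb => w sw.
have lip (r : R) (h k : H) : ip (emb w) (r *: h + k) = r *: ip (emb w) h + ip (emb w) k.
  exact: ip_emb_linear.
have [K K0 wK] := linear_continuous_bound lip (@continuous_ipr _ _ _ H (emb w)).
rewrite -(integral_Rn_map (L := fun h => ip (emb w) h) lip wK (dC u su)).
rewrite ip_emb//; last exact: schwartz_twist_integral.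
have [M [cw wM]] := schwartz_dominated [::] sw.
rewrite (_ : (fun x => amul _ _) = fun x => integral_Rn (fun eta => amul (star (w x)) (twist u kappa eta x))).
  rewrite (_ : (fun eta => ip _ _) = fun eta => integral_Rn (fun x => amul (star (w x)) (twist u kappa eta x))).
    apply: (integral_Rn_swap (C := M * D)); split.
    - move=> x; apply: continuous_amul; first exact: cst_continuous.
      exact: (dD x).1.
    - move=> eta; apply: continuous_amul; first exact: continuous_comp_fun continuous_star cw.
      exact/continuous_twist_r/schwartz_continuous.
    - move=> x eta; rewrite (le_trans (norm_amul _ _))// norm_star.
      rewrite [M * D * _]mulrAC -[leRHS]mulrA; apply: ler_pM => //.
      exact: (dD x).2.
  by apply/funext => eta; rewrite ip_emb//; exact: schwartz_twist.
apply/funext => x.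
rewrite -(integral_Rn_map (L := fun a => amul (star (w x)) a) (K := `|star (w x)|) _ _ (dD x))//.
  by move=> r a b; rewrite amul_linearr.
by move=> a; exact: norm_amul.
Qed.

End TwistInCompletion.

Section RightMultiplication.
Context {R : realType} {A : cstarAlgType R} {n : nat} (J : 'M[R]_n) (H : completion A n).
Implicit Types (u v g : 'cV[R]_n -> A).
Local Notation emb := (emb H).
Local Notation twist := (twist J).

Lemma deformed_prod_twist u g : schwartz u -> schwartz g -> deformed_prod J u g =
  fun x => Num.sqrt (2 * pi) ^- n *: integral_Rn (fun eta => twist u (fourier g) eta x).
Proof.
move=> su sg; have [M uM] := schwartz_bounded su; apply/funext => x.
rewrite (deformed_prodE J x (schwartz_continuous su) uM sg); congr (_ *: _); congr integral_Rn.
by apply/funext => eta; rewrite /twist /shift_modulate /modulate amulZl dotC.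
Qed.

(** [right_mul] is a chosen extension, so one has to exist: as an average of the isometries [M_eta]
    followed by multiplication by [fourier g eta], the operator is bounded. The lemma is applied to
    [g] whose transform is an explicit Gaussian, which settles the hypothesis on [fourier g]. *)
Lemma extends_right_mul g : schwartz g -> schwartz (fourier g) ->
  extends (fun u => deformed_prod J u g) (right_mul H J g).
Proof.
move=> sg sk; apply: (xgetPex (fun=> 0)).
pose b : R := Num.sqrt (2 * pi) ^- n.
have [C C0 dC] := dominated_emb_twist J H sk.
apply: (extends_bounded (C := `|b| * (C * wint R ^+ n))) => [u su|a u v su sv|u su].
- rewrite deformed_prod_twist//; apply: schwartzZ; exact: schwartz_twist_integral.
- have sau : schwartz (fun x => cscale a (u x)) by exact: schwartz_cscale.
  have sauv : schwartz (fun x => cscale a (u x) + v x) by exact: schwartzD.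
  rewrite !deformed_prod_twist//; apply/funext => x; rewrite cscale_scale -scalerDr; congr (_ *: _).
  have [D dD] := dominated_twist J su sk; have [D2 dD2] := dominated_twist J sau sk.
  have [D3 dD3] := dominated_twist J sv sk.
  have E : (fun eta => twist (fun x => cscale a (u x)) (fourier g) eta x) =
      fun eta => cscale a (twist u (fourier g) eta x).
    apply/funext => eta; rewrite -amulZl; congr amul.
    by rewrite /shift_modulate /modulate !cscaleA mulrC.
  rewrite -(integral_Rn_map (L := cscale a) (K := ComplexField.Normc.normc a) _ _ (dD x)).
  + rewrite -E -(integral_RnD (dD2 x) (dD3 x)); congr integral_Rn; apply/funext => eta.
    by rewrite -amulDl /shift_modulate /modulate -cscaleDr.
  + exact: cscale_linear.
  + by move=> y; rewrite norm_cscale.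
- rewrite deformed_prod_twist// embZ ?emb_twist_integral//; last exact: schwartz_twist_integral.
  rewrite normrZ -mulrA ler_wpM2l// mulrAC; apply: integral_Rn_norm_le; exact: dC.
Qed.

Lemma right_mul_emb u g : schwartz u -> schwartz g -> schwartz (fourier g) ->
  right_mul H J g (emb u) =
  Num.sqrt (2 * pi) ^- n *: integral_Rn (fun eta => emb (twist u (fourier g) eta)).
Proof.
move=> su sg sk; have [_ /(_ u su)[_ ->]] := extends_right_mul sg sk.
rewrite deformed_prod_twist// embZ ?emb_twist_integral//; exact: schwartz_twist_integral.
Qed.

End RightMultiplication.

Lemma fourier_gaussian_surj (R : realType) (A : complexBanachType R) n (rho : R) (zeta : 'cV[R]_n) (c : A) :
  rho != 0 -> exists2 g : 'cV[R]_n -> A, schwartz g &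
  fourier g = fun xi => gaussian (rho^-1 *: (xi - zeta)) *: c.
Proof.
(* The transform of [gaussian (e x)] is a Gaussian in [xi / (2 e)], so width [rho] asks for
   [e = rho / 2]. The constant [k] collects the normalization, the Jacobian and the Gaussian
   integral; modulation by [zeta] moves the center. *)
move=> rho0; pose e := rho / 2; have e0 : e != 0 by rewrite mulf_neq0// invr_eq0 pnatr_eq0.
pose k : R := Num.sqrt (2 * pi) ^- n * (`|e| ^- n * Num.sqrt pi ^+ n).
have k0 : k != 0.
  rewrite mulf_neq0 ?bar_constant_neq0// mulf_neq0// ?invr_eq0 expf_neq0 ?normr_eq0//.
  by rewrite gt_eqF// sqrtr_gt0 pi_gt0.
pose G (x : 'cV[R]_n) := gaussian x *: (k^-1 *: c).
exists (modulate zeta (fun x => G (e *: x + 0))).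
  by apply: schwartz_modulate; apply: schwartz_comp_coord => //; exact: schwartz_gaussian.
apply/funext => xi; rewrite /fourier /integral_bar.
rewrite (_ : (fun y => _) = fun y => modulate (e^-1 *: (zeta - xi)) G (e *: y + 0)).
  rewrite integral_Rn_affine// integral_modulate_gaussian !scalerA.
  have -> : (2^-1 / e) *: (zeta - xi) = - (rho^-1 *: (xi - zeta)).
    by rewrite -scalerN opprB; congr (_ *: _); rewrite /e; field.
  rewrite gaussianN; congr (_ *: _); rewrite [gaussian _ * _]mulrC mulrA.
  by rewrite -[X in X * gaussian _]mulrA -/k mulrAC mulfV// mul1r.
apply/funext => y; rewrite /modulate -cscale_expiD addr0; congr (cscale (expi _) _).
by rewrite dotZr [dot (_ *: _) _]dotC dotZr mulrA mulfV// mul1r [dot y (_ - _)]dotC dotDl dotNl [dot xi y]dotC addrC.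
Qed.

(** * Operators commuting with the right multiplications *)

Section Commutant.
Context {R : realType} {A : cstarAlgType R} {n : nat} (J : 'M[R]_n) (H : completion A n).
Implicit Types (u v g : 'cV[R]_n -> A).
Local Notation emb := (emb H).
Local Notation twist := (twist J).

Context (P : ('cV[R]_n -> A) -> 'cV[R]_n -> A) (T : H -> H).
Hypothesis PT : extends P T.
Hypothesis comm : forall g, schwartz g -> commutator T (right_mul H J g) = fun=> 0.

Let lT (r : R) (h k : H) : T (r *: h + k) = r *: T h + T k.
Proof. by rewrite -cscale_real PT.1.1 cscale_real. Qed.

Let TZ (r : R) (h : H) : T (r *: h) = r *: T h.
Proof.
have T0 : T 0 = 0 by have := lT (-1) 0 0; rewrite scaler0 addr0 scaleN1r addNr.
by rewrite -[r *: h]addr0 lT T0 addr0.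
Qed.

Let sP u : schwartz u -> schwartz (P u). Proof. by move=> /PT.2[]. Qed.

Let Temb u : schwartz u -> T (emb u) = emb (P u). Proof. by move=> /PT.2[]. Qed.

Lemma commute_twist_integral u g : schwartz u -> schwartz g -> schwartz (fourier g) ->
  T (integral_Rn (fun eta => emb (twist u (fourier g) eta))) =
  integral_Rn (fun eta => emb (twist (P u) (fourier g) eta)).
Proof.
move=> su sg sk; apply: (scalerI (@bar_constant_neq0 R n)).
rewrite -TZ -!right_mul_emb//; last exact: sP.
by have /(congr1 (@^~ (emb u)))/eqP := comm sg; rewrite /commutator subr_eq0 Temb// => /eqP.
Qed.

(** The substitution [rho eta + zeta] transfers the width from the weight to the argument: the
    Gaussian is then the same for all [rho], and it dominates the integrands in the limit
    [rho --> 0]. *)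
Lemma commute_gaussian_average u (rho : R) zeta c : schwartz u -> rho != 0 ->
  T (integral_Rn (fun eta => gaussian eta *: emb (twist u (fun=> c) (rho *: eta + zeta)))) =
  integral_Rn (fun eta => gaussian eta *: emb (twist (P u) (fun=> c) (rho *: eta + zeta))).
Proof.
move=> su rho0; have [g sg gE] := fourier_gaussian_surj zeta c rho0.
have sk : schwartz (fourier g).
  rewrite gE (_ : (fun xi => _) = fun xi => gaussian (rho^-1 *: xi - rho^-1 *: zeta) *: c).
    by apply: (@schwartz_comp_coord _ _ _ (fun x => gaussian x *: c)); [rewrite invr_eq0|exact: schwartz_gaussian].
  by apply/funext => xi; rewrite scalerBr.
have E v : schwartz v ->
    integral_Rn (fun eta => gaussian eta *: emb (twist v (fun=> c) (rho *: eta + zeta))) =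
    `|rho| ^- n *: integral_Rn (fun eta => emb (twist v (fourier g) eta)).
  move=> sv; rewrite -(integral_Rn_affine _ zeta rho0); congr integral_Rn; apply/funext => eta.
  rewrite -embZ; last exact: schwartz_twist.
  congr (Defs.emb _ _); apply/funext => x; rewrite /twist gE amulZrr; congr (gaussian _ *: _).
  by rewrite addrK scalerA mulVf// scale1r.
by rewrite !E ?TZ ?commute_twist_integral//; exact: sP.
Qed.

Lemma commute_shift_modulate u zeta c : schwartz u ->
  T (emb (twist u (fun=> c) zeta)) = emb (twist (P u) (fun=> c) zeta).
Proof.
move=> su; pose rho k : R := k.+1%:R^-1.
have rho_cvg : rho k @[k --> \oo] --> 0 by exact: cvg_harmonic.
have lim v : schwartz v ->
    integral_Rn (fun eta => gaussian eta *: emb (twist v (fun=> c) (rho k *: eta + zeta)))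
      @[k --> \oo] --> Num.sqrt pi ^+ n *: emb (twist v (fun=> c) zeta).
  move=> sv; rewrite -integral_Rn_gaussian.
  have cv : continuous (fun eta => emb (twist v (fun=> c) eta)).
    by apply: (continuous_emb_twist (M := `|c|)) => //; exact: cst_continuous.
  have [C [cG GC]] := schwartz_dominated [::] (@schwartz_gaussian R n R^o 1).
  have G1 : pderiv [::] (fun x : 'cV[R]_n => gaussian x *: (1 : R^o)) = gaussian.
    by apply/funext => x; rewrite /= -[LHS]/(gaussian x * 1) mulr1.
  rewrite G1 in cG GC.
  have C0 : 0 <= C.
    by have := GC 0; rewrite gaussian0 normr1 => h; rewrite -(pmulr_lge0 _ (weight_gt0 (0 : 'cV[R]_n))) (le_trans _ h).
  apply: (integral_Rn_dct (C := C * (`|c| * `|emb v|))) => [k||eta].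
  - split=> [|eta].
      apply: continuous_scale => //; apply: continuous_comp_fun cv _.
      apply: continuous_add; last exact: continuous_mx_cst.
      exact: scaler_continuous.
    rewrite normrZ mulrAC ler_pM//.
    exact: (norm_emb_twist J H (fun=> c)).
  - by apply: continuous_scale => //; exact: cst_continuous.
  - have l : rho k *: eta + zeta @[k --> \oo] --> zeta.
      rewrite -[X in _ --> X]add0r -(scale0r eta); apply: cvgD; last exact: cvg_cst.
      exact: cvgZr_tmp.
    by apply: cvgZr; exact: cvg_comp l (cv zeta).
have rn k : rho k != 0 by rewrite invr_eq0 pnatr_eq0.
have s0 : Num.sqrt pi ^+ n != 0 :> R by rewrite expf_neq0// gt_eqF// sqrtr_gt0 pi_gt0.
apply: (scalerI s0); rewrite -TZ.
apply: (cvg_unique (@norm_hausdorff _ _) _ (lim _ (sP su))).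
rewrite (_ : (fun k => integral_Rn _) = fun k => T (integral_Rn (fun eta =>
  gaussian eta *: emb (twist u (fun=> c) (rho k *: eta + zeta))))).
  exact: cvg_comp (lim u su) (PT.1.2 _).
by apply/funext => k; rewrite commute_gaussian_average.
Qed.

End Commutant.

(** * Symbols, right linearity and conjugation by [M_eta] *)

Section FourierSymbol.
Context {R : realType} {A : cstarAlgType R} {n : nat}.
Implicit Types (u v : 'cV[R]_n -> A) (a : 'cV[R]_(n + n) -> A).

Lemma dominated_fourier u : schwartz u -> exists C, dominated C (fourier u).
Proof.
move=> su; have ud : unif_dominated (fun _ : unit => u).
  by split=> [_|s]; [exact: schwartz_smooth|have [C [_ uC]] := schwartz_dominated s su; exists C => _].
have [C hC] := unif_dominated_decay ud; have [D [cu uD]] := schwartz_dominated [::] su.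
exists (`|Num.sqrt (2 * pi) ^- n| * C); split=> [|xi]; last first.
  by rewrite fourier_modulate normrZ -mulrA ler_wpM2l// -(weightN xi); exact: (hC tt).
apply: (integral_bar_continuous (C := D)) => [xi|y].
  have [cm mD] := dominated_modulate (- xi) (conj cu uD).
  split=> [|y]; last by rewrite norm_cscale_expi; exact: uD.
  by move: cm; rewrite /modulate; under eq_fun do rewrite dotNl dotC.
apply: continuous_cscale_expi; last exact: cst_continuous.
have cd : continuous (fun x : 'cV[R]_n => dot (- y) x).
  by apply: continuous_dot; [exact: continuous_mx_cst|move=> x; exact: cvg_id].
by move: cd; under eq_fun do rewrite dotNl.
Qed.

Lemma fourier_amulr u c xi : schwartz u ->
  fourier (fun x => amul (u x) c) xi = amul (fourier u xi) c.
Proof.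
move=> su; have [C uC] := schwartz_dominated [::] su.
rewrite !fourier_modulate.
rewrite -(integral_bar_map (L := fun b => amul b c) (K := `|c|) _ _ (dominated_modulate (- xi) uC)).
- by congr integral_bar; apply/funext => x; rewrite /modulate amulZl.
- by move=> r x y; rewrite amul_linearl.
- by move=> x; rewrite mulrC norm_amul.
Qed.

Lemma fourier_shift_modulate J eta u xi : schwartz u ->
  fourier (shift_modulate J eta u) xi =
  cscale (expi (- dot (J *m eta) (xi - eta))) (fourier u (xi - eta)).
Proof.
move=> su; have [C uC] := schwartz_dominated [::] su.
rewrite -dotNl -(fourier_shift (- (J *m eta)) (xi - eta) uC) fourier_modulate.
congr integral_bar; apply/funext => x; rewrite /modulate -cscale_expiD -dotDl opprB addrC.
by rewrite [_ + x]addrC.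
Qed.

Definition symbol_op a u x : A :=
  integral_bar (fun xi => cscale (expi (dot x xi)) (amul (a (col_mx x xi)) (fourier u xi))).

Lemma dominated_symbol a u x : continuous a -> (exists M : R, forall w, `|a w| <= M) ->
  schwartz u ->
  exists C, dominated C (fun xi => cscale (expi (dot x xi)) (amul (a (col_mx x xi)) (fourier u xi))).
Proof.
move=> ca [M aM] su; have [C [cu uC]] := dominated_fourier su; exists (M * C); split=> [|xi].
  apply: continuous_cscale_expi.
    by apply: continuous_dot; [exact: continuous_mx_cst|move=> y; exact: cvg_id].
  apply: continuous_amul => //; apply: continuous_comp_fun ca _.
  by apply: continuous_col_mx; [exact: continuous_mx_cst|move=> y; exact: cvg_id].
rewrite norm_cscale_expi (le_trans (norm_amul _ _))// -mulrA; exact: ler_pM.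
Qed.

(** The symbol multiplies from the left, so a constant on the right passes through both integrals.
    This separates [c] from the operator once commutation is known only up to [c]. *)
Lemma symbol_op_amulr a u c x : continuous a -> (exists M : R, forall w, `|a w| <= M) ->
  schwartz u -> symbol_op a (fun x => amul (u x) c) x = amul (symbol_op a u x) c.
Proof.
move=> ca ba su; have [C dC] := dominated_symbol x ca ba su.
rewrite -(integral_bar_map (L := fun b => amul b c) (K := `|c|) _ _ dC).
- by congr integral_bar; apply/funext => xi; rewrite fourier_amulr// amulA amulZl.
- by move=> r b d; rewrite amul_linearl.
- by move=> b; rewrite mulrC norm_amul.
Qed.

(** Translate the frequency by [eta]: the phases [x.(xi + eta)] and [- (J eta).xi] regroup as
    [eta.x] and [(x - J eta).xi]. *)
Lemma symbol_op_shift_modulate J eta a u : continuous a -> (exists M : R, forall w, `|a w| <= M) ->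
  schwartz u ->
  symbol_op a (shift_modulate J eta u) =
  shift_modulate J eta (symbol_op (fun w => a (w + col_mx (J *m eta) eta)) u).
Proof.
move=> ca [M aM] su; apply/funext => x; rewrite /shift_modulate /modulate.
set a' := fun w => a _.
have ca' : continuous a'.
  by apply: continuous_comp_fun ca _; apply: continuous_add; [move=> w; exact: cvg_id|exact: continuous_mx_cst].
have [C dC] := dominated_symbol (x - J *m eta) ca' (ex_intro _ M (fun w => aM _)) su.
rewrite -(integral_bar_cscale_expi _ dC) -[LHS](integral_bar_shift _ eta).
congr integral_bar; apply/funext => xi.
rewrite fourier_shift_modulate// addrK /a' add_col_mx subrK.
rewrite amulZr !cscaleA -!expiD; congr (cscale (expi _) _).
by rewrite dotDr dotDl dotNl [dot x eta]dotC addrCA addrA addrC addrA.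
Qed.

End FourierSymbol.

Section ExtensionUniqueness.
Context {R : realType} {A : cstarAlgType R} {n : nat} (H : completion A n).
Implicit Types (P Q : ('cV[R]_n -> A) -> 'cV[R]_n -> A) (T : H -> H) (u : 'cV[R]_n -> A).

Lemma extends_unique P Q T T' : extends P T -> extends Q T' ->
  (forall u, schwartz u -> emb H (P u) = emb H (Q u)) -> T = T'.
Proof.
move=> [[_ cT] PT] [[_ cT'] QT] PQ.
apply: (emb_continuous_eq (@norm_hausdorff _ H) cT cT') => u su.
by have [_ ->] := PT u su; have [_ ->] := QT u su; exact: PQ.
Qed.

Lemma extends_extension P T : extends P T -> extends P (extension P : H -> H).
Proof. by move=> PT; exact: (xgetPex (fun=> 0) (ex_intro _ T PT)). Qed.

(* For I = <u, u> the hypothesis gives I c = 0 for every c, in particular I I^* = 0. *)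
Lemma emb_amulr_eq0 u : schwartz u -> (forall c, emb H (fun x => amul (u x) c) = 0) -> emb H u = 0.
Proof.
move=> su uc; have [C uC] := dominated_inner su su.
pose I := integral_Rn (fun x => amul (star (u x)) (u x)).
have Ic c : amul I c = 0.
  rewrite -(integral_Rn_map (L := fun b => amul b c) (K := `|c|) _ _ uC).
  - have := ip_emb H su (schwartz_amulr c su); rewrite uc.
    have -> : ip (emb H u) 0 = 0.
      by have := ip_emb_linear (H := H) (-1) 0 0 su; rewrite scaler0 addr0 scaleN1r addNr.
    by move=> /esym <-; congr integral_Rn; apply/funext => x; rewrite amulA.
  - by move=> r x y; rewrite amul_linearl.
  - by move=> x; rewrite mulrC norm_amul.
have I0 : `|I| = 0.
  apply/eqP; rewrite -norm_star -sqrf_eq0 -norm_star_amul starK Ic normr0//.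
by apply/eqP; rewrite -normr_eq0 norm_emb// -/I I0 sqrtr0.
Qed.

End ExtensionUniqueness.

Section BoundedSmooth.
Context {R : realType} {m : nat} {V : normedModType R}.
Implicit Type a : 'cV[R]_m -> V.

Lemma CBinf_continuous a : CBinf a -> continuous a.
Proof. by move=> [/smooth_continuous]. Qed.

Lemma CBinf_bounded a : CBinf a -> exists M : R, forall w, `|a w| <= M.
Proof. by move=> [_ /(_ [::])]. Qed.

Lemma CBinf_shift a b : CBinf a -> CBinf (fun w => a (w + b)).
Proof.
move=> [sa ba]; have [sab dab] := smooth_shift b sa; split=> // s.
by have [M aM] := ba s; exists M => w; rewrite dab.
Qed.

End BoundedSmooth.

(** * Invariance of the symbol and identification with a left multiplication *)

Section SymbolInvariance.
Context {R : realType} {A : cstarAlgType R} {n : nat} (J : 'M[R]_n) (H : completion A n).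
Implicit Types (a : 'cV[R]_(n + n) -> A) (u : 'cV[R]_n -> A).

Hypothesis pseudodiff_bij : set_bij (@CBinf R (n + n) A) (HS H) (pseudodiff H).

Let pseudodiff_inj a b : CBinf a -> CBinf b -> pseudodiff H a = pseudodiff H b -> a = b.
Proof. by have [_ inj _] := pseudodiff_bij => Ca Cb; apply: inj; exact: mem_set. Qed.

(* A symbol without continuous extension would get the default value of extension, which is
   also the operator of the symbol 0; this contradicts injectivity. *)
Lemma extends_pseudodiff a : CBinf a -> extends (symbol_op a) (pseudodiff H a).
Proof.
move=> Ca; have P0 u : symbol_op (fun=> 0) u = fun=> 0.
  apply/funext => x; rewrite /symbol_op (_ : (fun xi => _) = fun=> 0).
    have := @integral_Rn_gaussian _ A n 0; rewrite scaler0 /integral_bar => e.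
    rewrite (_ : integral_Rn _ = 0) ?scaler0// -{2}e.
    by congr integral_Rn; apply/funext => y; rewrite scaler0.
  by apply/funext => xi; rewrite amul0l cscaler0.
have C0 : CBinf (fun _ : 'cV[R]_(n + n) => 0 : A).
  have s0 := schwartz0 A (n + n); split; first exact: schwartz_smooth.
  by move=> s; exact: schwartz_bounded (schwartz_pderiv s s0).
have E0 : extends (symbol_op (fun=> 0)) (fun _ : H => 0).
  split=> [|u su]; last by rewrite P0 emb0; split=> //; exact: schwartz0.
  split; last exact: cst_continuous.
  by move=> c h k; rewrite cscaler0 addr0.
have [[T aT]|nT] := pselect (exists T : H -> H, extends (symbol_op a) T).
  exact: extends_extension aT.
have pa : pseudodiff H a = fun=> 0.
  by apply: xgetPN => T aT; apply: nT; exists T.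
have p0 : pseudodiff H (fun=> 0) = fun=> 0.
  by apply: extends_unique (extends_extension E0) E0 _ => u _.
have a0 : a = fun=> 0 by apply: pseudodiff_inj => //; rewrite pa p0.
by case: nT; rewrite a0; exists (fun=> 0).
Qed.

Context (a : 'cV[R]_(n + n) -> A) (Ca : CBinf a).
Hypothesis comm : forall g, schwartz g ->
  commutator (pseudodiff H a) (right_mul H J g) = fun=> 0.

Lemma symbol_invariant eta w : a (w + col_mx (J *m eta) eta) = a w.
Proof.
pose a' w := a (w + col_mx (J *m eta) eta).
have Ca' : CBinf a' by exact: CBinf_shift.
have Ea := extends_pseudodiff Ca; have Ea' := extends_pseudodiff Ca'.
have ca := CBinf_continuous Ca; have ba := CBinf_bounded Ca.
suff : a' = a by move/(congr1 (@^~ w)).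
apply: pseudodiff_inj => //; apply: (extends_unique Ea' Ea) => u su.
have sMu := schwartz_shift_modulate J eta su.
have [sPu _] := Ea.2 u su; have [sPu' _] := Ea'.2 u su.
(* [M_eta d] is the commutator of [a(x, D)] and [M_eta] applied to [u]. It vanishes after right
   multiplication by any [c], hence vanishes, and [M_eta] is isometric. *)
pose d x := symbol_op a' u x - symbol_op a u x.
have sd : schwartz d.
  by rewrite /d; under eq_fun do rewrite -scaleN1r; apply: schwartzD => //; exact: schwartzZ.
have Md : shift_modulate J eta d = fun x =>
    symbol_op a (shift_modulate J eta u) x - shift_modulate J eta (symbol_op a u) x.
  rewrite symbol_op_shift_modulate//.
  by apply/funext => x; rewrite /shift_modulate /modulate cscalerB.
suff : emb H (shift_modulate J eta d) = 0.
  move=> /(congr1 Num.norm); rewrite norm_emb_shift_modulate// normr0 => /eqP.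
  by rewrite normr_eq0 embB// subr_eq0 => /eqP.
apply: emb_amulr_eq0 => [|c]; first exact: schwartz_shift_modulate.
rewrite Md; under eq_fun do rewrite amulBl -symbol_op_amulr//.
have sMuc := schwartz_amulr c sMu.
have [s1 E1] := Ea.2 _ sMuc.
rewrite embB//; last exact/schwartz_amulr/schwartz_shift_modulate.
by rewrite -E1 (commute_shift_modulate Ea comm eta c su) subrr.
Qed.

Definition zero_frequency x : A := a (col_mx x 0).

(** Invariance along [(J eta, eta)] with [eta = - xi] moves the point to frequency 0. *)
Lemma symbol_zero_frequency x xi : a (col_mx x xi) = zero_frequency (x - J *m xi).
Proof.
by rewrite -(symbol_invariant (- xi)) add_col_mx mulmxN subrr.
Qed.

Lemma CBinf_zero_frequency : CBinf zero_frequency.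
Proof.
have cL : continuous (fun x : 'cV[R]_n => col_mx x (0 : 'cV[R]_n)).
  by apply: continuous_col_mx; [move=> x; exact: cvg_id|exact: continuous_mx_cst].
have Lc h (i : 'I_n) (x : 'cV[R]_n) : col_mx (h *: delta_mx i 0 + x) (0 : 'cV[R]_n) =
    (h * 1) *: delta_mx (lshift n i) 0 + col_mx x 0.
  apply/colP => l; rewrite !mxE; case: (split_ordP l) => l' ->.
    by rewrite !mxE eq_lshift mulr1.
  by rewrite !mxE eq_rlshift mulr0 add0r.
split.
  exact: (@smooth_comp_coord _ n (n + n) _ _ (@lshift n n) 1 cL Lc a Ca.1).
move=> s; have [M aM] := Ca.2 (map (@lshift n n) s); exists M => x.
rewrite (@pderiv_comp_coord _ n (n + n) _ _ (@lshift n n) 1 Lc a Ca.1).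
by rewrite expr1n scale1r.
Qed.

(** [left_mul] is a chosen extension of the deformed product; that one exists is witnessed by
    [pseudodiff H a] itself, since the two agree on Schwartz functions by [deformed_prodE]. *)
Lemma pseudodiff_left_mul : pseudodiff H a = left_mul H J zero_frequency.
Proof.
have Ea := extends_pseudodiff Ca.
have CF := CBinf_zero_frequency; have [M FM] := CBinf_bounded CF.
have eP u : schwartz u -> deformed_prod J zero_frequency u = symbol_op a u.
  move=> su; apply/funext => x; rewrite (deformed_prodE J x (CBinf_continuous CF) FM su).
  by congr integral_bar; apply/funext => xi; rewrite symbol_zero_frequency.
have EL : extends (fun u => deformed_prod J zero_frequency u) (pseudodiff H a).
  by split=> [|u su]; [exact: Ea.1|rewrite eP//; exact: Ea.2].
by apply: extends_unique Ea (extends_extension EL) _ => u su; rewrite eP.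
Qed.

End SymbolInvariance.

Theorem mainTheorem4 (R : realType) (A : cstarAlgType R) (n : nat)
    (J : 'M[R]_n) (H : completion A n) :
  separable_space A ->
  J^T = - J ->
  set_bij (@CBinf R (n + n) A) (HS H) (pseudodiff H) ->
  forall T : H -> H,
    adjointable T ->
    heisenberg_smooth T ->
    (forall g : 'cV[R]_n -> A, schwartz g ->
      commutator T (right_mul H J g) = (fun=> 0)) ->
    exists F : 'cV[R]_n -> A, CBinf F /\ T = left_mul H J F.
Proof.
move=> _ _ bij T adjT smoothT comm.
have [_ _ /(_ T (conj adjT smoothT))[a Ca aT]] := bij.
rewrite -aT in comm *; exists (zero_frequency a); split.
  exact: CBinf_zero_frequency.
exact: pseudodiff_left_mul.
Qed.
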